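(* Let $\mathbf K=[0,1]^3\times\{\pm1\}$. For each $F\in C(\mathbf K)$ there exists $\mathcal L(F)\in\mathbb R$ such that $$\frac{1}{\ln(1/\eta)}\int_\eta^{1/2}F(A(\omega,r),B(\omega,r),Q(\omega,r),\sigma(\omega,r))\frac{dr}{r}\to\mathcal L(F)$$ for a.e. $\omega=(\omega_1,\omega_2)\in\mathbb S^1$ with $0<\omega_2<\omega_1$, as $\eta\to0^+$.
   Context: Let $Z_r=\{x\in\mathbb R^2:\operatorname{dist}(x,\mathbb Z^2)>r\}$, $0<r<\tfrac12$, $\tau_r(x,\omega)=\inf\{t>0:x+t\omega\in\partial Z_r\}$, and $D(c,r)$ the disk of radius $r$ centred at $c$. For $\omega\in\mathbb S^1$ with $0<\omega_2<\omega_1$ and $\omega_2/\omega_1\notin\mathbb Q$ there are $(q,p),(\bar q,\bar p)\in\mathbb Z^2$ with $0<q<\bar q$, $q\bar p-\bar qp=\sigma\in\{\pm1\}$, such that for every $x$ with $|x|=r$, $x\cdot\omega\ge0$, the point $x+\tau_r(x,\omega)\omega$ lies on $\partial D((q,p),r)\cup\partial D((\bar q,\bar p),r)\cup\partial D((q+\bar q,p+\bar p),r)$. The union of lines $\{x+t\omega:t\in\mathbb R\}$ over such $x$ whose trajectory hits $\partial D((q,p),r)$ is a closed strip of width $a$, and those hitting $\partial D((\bar q,\bar p),r)$ a closed strip of width $b$. Define $Q(\omega,r)=2rq/\omega_1$, $A(\omega,r)=a/(2r)$, $B(\omega,r)=b/(2r)$, $\sigma(\omega,r)=q\bar p-p\bar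 q$. (Equivalently, with $\alpha=\omega_2/\omega_1$, $\epsilon=2r/\omega_1$ and the continued-fraction quantities $q_n(\alpha)$, $d_n(\alpha)=|q_n\alpha-p_n|$ defined by $p_0=1,p_1=0,q_0=0,q_1=1$, $p_{n+1}=a_np_n+p_{n-1}$, $q_{n+1}=a_nq_n+q_{n-1}$ with $a_n$ the partial quotients of $\alpha$, and $N=N(\alpha,\epsilon)=\inf\{n:d_n(\alpha)\le\epsilon\}$: $A=1-d_N/\epsilon$, $B=1-d_{N-1}/\epsilon-[(\epsilon-d_{N-1})/d_N]\,d_N/\epsilon$, $Q=\epsilon q_N$, $\sigma=(-1)^N$.) *)

(* Defs.v *)
From HB Require Import structures.
From mathcomp Require Import all_boot all_order all_algebra.
From mathcomp Require Import all_classical all_reals all_analysis.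
Set Implicit Arguments. Unset Strict Implicit. Unset Printing Implicit Defensive.
Import Order.TTheory GRing.Theory Num.Theory.
Import numFieldNormedType.Exports.
Local Open Scope classical_set_scope.
Local Open Scope ring_scope.

Section ThreeLength.
Variable R : realType.

Fixpoint gauss_iter (alpha : R) (k : nat) : R :=
  match k with
  | O => alpha
  | k'.+1 => let y := (gauss_iter alpha k')^-1 in y - (Num.floor y)%:~R
  end.

(* partial quotients: alpha = [0; a_1, a_2, ...], a_n = floor(1/x_{n-1}) (n >= 1) *)
Definition pquot (alpha : R) (n : nat) : R :=
  (Num.floor (gauss_iter alpha n.-1)^-1)%:~R.

(* (p_n, q_n) with p_0=1,p_1=0,q_0=0,q_1=1, p_{n+1}=a_n p_n+p_{n-1}, same for q.
   pq alpha n = ((p_n, q_n), (p_{n+1}, q_{n+1})). *)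
Fixpoint pq (alpha : R) (n : nat) : (R * R) * (R * R) :=
  match n with
  | O => ((1, 0), (0, 1))
  | n'.+1 =>
      let: (old, cur) := pq alpha n' in
      let a := pquot alpha n in
      (cur, (a * cur.1 + old.1, a * cur.2 + old.2))
  end.

Definition cf_p (alpha : R) (n : nat) : R := (pq alpha n).1.1.
Definition cf_q (alpha : R) (n : nat) : R := (pq alpha n).1.2.
Definition cf_d (alpha : R) (n : nat) : R := `|cf_q alpha n * alpha - cf_p alpha n|.

Definition cf_N (alpha eps : R) : nat :=
  match pselect (exists n, cf_d alpha n <= eps) with
  | left h => ex_minn h
  | right _ => 0%N
  end.

Definition alpha_of (w : R * R) : R := w.2 / w.1.
Definition eps_of (w : R * R) (r : R) : R := 2 * r / w.1.

Definition Aw (w : R * R) (r : R) : R :=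
  let al := alpha_of w in let e := eps_of w r in
  1 - cf_d al (cf_N al e) / e.

Definition Bw (w : R * R) (r : R) : R :=
  let al := alpha_of w in let e := eps_of w r in
  let N := cf_N al e in
  1 - cf_d al N.-1 / e
    - (Num.floor ((e - cf_d al N.-1) / cf_d al N))%:~R * cf_d al N / e.

Definition Qw (w : R * R) (r : R) : R :=
  let al := alpha_of w in let e := eps_of w r in
  e * cf_q al (cf_N al e).

Definition sigmaw (w : R * R) (r : R) : R :=
  (-1) ^+ (cf_N (alpha_of w) (eps_of w r)).

Definition Kset : set (R * R * R * R) :=
  [set x | x.1.1.1 \in `[0, 1] /\ x.1.1.2 \in `[0, 1] /\ x.1.2 \in `[0, 1]
           /\ (x.2 = 1 \/ x.2 = -1)].

Definition omega_of (theta : R) : R * R := (cos theta, sin theta).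

Definition avgF (F : R * R * R * R -> R) (w : R * R) (eta : R) : R :=
  (ln eta^-1)^-1 *
  Rintegral lebesgue_measure `[eta, 2^-1]
    (fun r => F (Aw w r, Bw w r, Qw w r, sigmaw w r) / r).

End ThreeLength.

(* Main.v *)
(* Under Lebesgue measure the partial quotients of alpha form a chain with
   complete connections: given the digits read so far, summarised by
   y = q_n / q_{n+1}, the next digit is a with probability
   (1 + y) / ((a + y) (a + 1 + y)), and y becomes 1 / (a + y).  Only the upper
   bound "the measure of a cylinder is at most a constant times the product of
   these probabilities" is needed, and it passes from alpha = tan theta to theta
   because tan is expanding on ]0, pi/4[.

   Second moments of martingales along n = k^3 give a strong law of large
   numbers: along almost every orbit, a bounded function of the digits may be
   replaced by its conditional mean given the past.  Iterating, a function of
   finitely many coming digits becomes a function of y alone, and then a nearly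
   constant one, since the transition operator contracts the Lipschitz seminorm
   by 23/24.  The sign sigma only brings alternating averages, which vanish.

   The integral in the theorem splits over the windows d_{n+1} <= epsilon < d_n.
   On each one the contribution is a function of the digit a_n, of the next
   Gauss iterate and of y, bounded by a multiple of ln (a_n + 1).  As ln (1/d_n)
   is itself such an ergodic sum, L(F) is the quotient of the two mean values.
   This settles Lipschitz F, and the general case follows by uniform
   approximation. *)
Require Import Defs.
From HB Require Import structures.
From mathcomp Require Import all_boot all_order all_algebra.
From mathcomp Require Import all_classical all_reals all_analysis.
From mathcomp Require Import measurable_realfun.
From mathcomp Require Import ring lra zify.
Import Order.TTheory GRing.Theory Num.Theory.
Import numFieldNormedType.Exports.
Local Open Scope classical_set_scope.
Local Open Scope ring_scope.
Set Implicit Arguments.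
Unset Strict Implicit.
Unset Printing Implicit Defensive.

(** * Continued fractions and cylinders *)

(** Neither an invariant measure nor an ergodic theorem enters. The state y takes their place: a
    cylinder has length 1 / (q_{n+1} (q_{n+1} + q_n)), so the share of each subcylinder depends on
    the past through q_n / q_{n+1} alone. Two obstacles shape the proof. Digits have infinite mean
    and their logarithms are unbounded; large digits are majorized through their fourth root, whose
    square still has finite mean. And the next Gauss iterate depends on the whole future, so it is
    cut after finitely many digits and the observable is read with a delay, which costs a boundary
    term only. Cubes balance two demands: the second moment at n is O(n), so a deviation of size
    k^(5/2) at n = k^3 has probability O(k^-2), which is summable, while consecutive cubes are
    O(k^2) apart, which is small against k^3. *)

Section ContinuedFraction.
Variable R : realType.
Implicit Types (x y z alpha : R) (a n : nat) (w : seq nat).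

(* Partial quotients are shifted by one, so that every sequence of natural
   numbers is an admissible word: the index [a] stands for the digit [a.+1]. *)
Definition branch a y : R := (a.+1%:R + y)^-1.

(** Irrationality in dynamical form: a zero of the Gauss orbit ends the expansion, and from there on
    inversion would only return its default value [0]. *)
Definition regular alpha : Prop :=
  0 < alpha < 1 /\ forall n, gauss_iter alpha n != 0.

Definition digit alpha n : nat := (Num.truncn (gauss_iter alpha n)^-1).-1.

Definition word alpha n : seq nat := mkseq (digit alpha) n.

Lemma wordS alpha n : word alpha n.+1 = rcons (word alpha n) (digit alpha n).
Proof. by rewrite /word /mkseq -addn1 iotaD map_cat cats1. Qed.

Lemma size_word alpha n : size (word alpha n) = n.
Proof. by rewrite size_mkseq. Qed.

Lemma branch_bound a y : 0 <= y <= 1 -> 0 <= branch a y <= 1.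
Proof.
move=> /andP[y0 y1]; rewrite /branch.
have h : 1 <= a.+1%:R + y by rewrite -natr1; have := ler0n R a; lra.
by rewrite invr_ge0 invf_le1; lra.
Qed.

Lemma gauss_iter_bound alpha n : regular alpha -> 0 < gauss_iter alpha n < 1.
Proof.
move=> [ha h]; case: n => [//|n] /=.
rewrite lt_def -/(gauss_iter alpha n.+1) (h n.+1) /=.
set y := (gauss_iter alpha n)^-1.
by rewrite subr_ge0 floor_le ltrBlDl -intrD1 floorD1_gt.
Qed.

Lemma pquotE alpha n : regular alpha ->
  pquot alpha n.+1 = (digit alpha n).+1%:R.
Proof.
move=> ra; have /andP[x0 x1] := gauss_iter_bound n ra.
rewrite /pquot /digit /=; set y := (gauss_iter alpha n)^-1.
have y1 : 1 < y by rewrite invf_gt1.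
have t1 : (1 <= Num.truncn y)%N by rewrite truncn_ge_nat ltW//; lra.
have y0 : 0 <= y by lra.
rewrite prednK// truncn_floor y0 -[LHS]/((Num.floor y)%:~R).
by rewrite -{1}(@gez0_abs (Num.floor y)) ?floor_ge0.
Qed.

Lemma gauss_iterS alpha n : regular alpha ->
  gauss_iter alpha n = branch (digit alpha n) (gauss_iter alpha n.+1).
Proof.
move=> ra; apply: invr_inj; rewrite /branch invrK -(pquotE n ra) /pquot /=.
by rewrite addrC subrK.
Qed.

Lemma pq_step alpha n : pq alpha n.+1 =
  ((pq alpha n).2, (pquot alpha n.+1 * (pq alpha n).2.1 + (pq alpha n).1.1,
                    pquot alpha n.+1 * (pq alpha n).2.2 + (pq alpha n).1.2)).
Proof. by rewrite /=; case: (pq alpha n). Qed.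

Lemma cf_pSS alpha n : cf_p alpha n.+2 =
  pquot alpha n.+1 * cf_p alpha n.+1 + cf_p alpha n.
Proof. by rewrite /cf_p !pq_step. Qed.

Lemma cf_qSS alpha n : cf_q alpha n.+2 =
  pquot alpha n.+1 * cf_q alpha n.+1 + cf_q alpha n.
Proof. by rewrite /cf_q !pq_step. Qed.

(** Both sides obey the same recurrence because [pquot alpha n.+1] is 1/x_n - x_{n+1} for the Gauss
    iterates x_n. Its order is two, so the induction carries two consecutive indices. *)
Lemma cf_sign alpha n : regular alpha ->
  cf_q alpha n * alpha - cf_p alpha n =
    (-1) ^+ n.+1 * \prod_(i < n) gauss_iter alpha i.
Proof.
move=> ra; suff: 
  cf_q alpha n * alpha - cf_p alpha n =
    (-1) ^+ n.+1 * \prod_(i < n) gauss_iter alpha i /\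
  cf_q alpha n.+1 * alpha - cf_p alpha n.+1 =
    (-1) ^+ n.+2 * \prod_(i < n.+1) gauss_iter alpha i by case.
elim: n => [|n [IH1 IH2]].
  by rewrite /cf_q/cf_p/= big_ord_recl !big_ord0 /= expr1 expr2; split; ring.
split=> //; rewrite cf_qSS cf_pSS.
have -> : (pquot alpha n.+1 * cf_q alpha n.+1 + cf_q alpha n) * alpha -
   (pquot alpha n.+1 * cf_p alpha n.+1 + cf_p alpha n) =
   pquot alpha n.+1 * (cf_q alpha n.+1 * alpha - cf_p alpha n.+1)
   + (cf_q alpha n * alpha - cf_p alpha n) by ring.
rewrite IH1 IH2 !big_ord_recr /= -/(gauss_iter alpha n.+1).
rewrite !exprS /pquot /=.
have x0 := ra.2 n.
by field.
Qed.

Lemma cf_dE alpha n : regular alpha ->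
  cf_d alpha n = \prod_(i < n) gauss_iter alpha i.
Proof.
move=> ra; rewrite /cf_d cf_sign// normrM normrX normrN1 expr1n mul1r ger0_norm//.
by apply: prodr_ge0 => i _; have /andP[/ltW] := gauss_iter_bound i ra.
Qed.

Lemma cf_d_gt0 alpha n : regular alpha -> 0 < cf_d alpha n.
Proof.
move=> ra; rewrite cf_dE//.
by apply: prodr_gt0 => i _; have /andP[] := gauss_iter_bound i ra.
Qed.

Lemma cf_dS alpha n : regular alpha ->
  cf_d alpha n.+1 = cf_d alpha n * gauss_iter alpha n.
Proof. by move=> ra; rewrite !cf_dE// big_ord_recr. Qed.

Lemma cf_d0 alpha : regular alpha -> cf_d alpha 0 = 1.
Proof. by move=> ra; rewrite cf_dE// big_ord0. Qed.

Lemma cf_d_lt alpha m n : regular alpha -> (m < n)%N ->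
  cf_d alpha n < cf_d alpha m.
Proof.
move=> ra; elim: n => // n IH; rewrite ltnS leq_eqVlt => mn.
have lt : cf_d alpha n.+1 < cf_d alpha n.
  by rewrite cf_dS// gtr_pMr ?cf_d_gt0//; case/andP: (gauss_iter_bound n ra).
by case/orP: mn => [/eqP-> //|/IH]; apply: lt_trans.
Qed.

Definition past w : R := foldl (fun y a => branch a y) 0 w.

Definition digit_prob y a : R := (1 + y) / ((a.+1%:R + y) * (a.+2%:R + y)).

Definition word_len w : R :=
  (foldl (fun s a => (branch a s.1, s.2 * digit_prob s.1 a)) (0, 1) w).2.

Lemma past_rcons w a : past (rcons w a) = branch a (past w).
Proof. by rewrite /past foldl_rcons. Qed.

Lemma word_len_rcons w a :
  word_len (rcons w a) = word_len w * digit_prob (past w) a.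
Proof.
rewrite /word_len foldl_rcons /=.
set f := fun _ => _.
suff -> : past w = (foldl f (0, 1) w).1 by [].
elim/last_ind: w => // w b IH.
by rewrite past_rcons foldl_rcons /= IH.
Qed.

Lemma past_bound w : 0 <= past w <= 1.
Proof.
elim/last_ind: w => [|w a IH]; first by rewrite /past/= lexx ler01.
by rewrite past_rcons; exact: branch_bound.
Qed.

Lemma digit_prob_gt0 y a : 0 <= y -> 0 < digit_prob y a.
Proof.
move=> y0; apply: divr_gt0; first exact: ltr_wpDr.
by apply: mulr_gt0; apply: ltr_wpDr.
Qed.

Lemma word_len_gt0 w : 0 < word_len w.
Proof.
elim/last_ind: w => [|w a IH]; first by rewrite /word_len ltr01.
rewrite word_len_rcons mulr_gt0// digit_prob_gt0//.
by case/andP: (past_bound w).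
Qed.

Lemma cf_q_past alpha n : regular alpha ->
  0 < cf_q alpha n.+1 /\ cf_q alpha n = past (word alpha n) * cf_q alpha n.+1.
Proof.
move=> ra; elim: n => [|n [q0 IH]].
  by rewrite /cf_q /past /= mul0r; split=> //; exact: ltr01.
have /andP[y0 _] := past_bound (word alpha n).
have h : 0 < (digit alpha n).+1%:R + past (word alpha n) by rewrite ltr_wpDr.
have E : cf_q alpha n.+2 =
    ((digit alpha n).+1%:R + past (word alpha n)) * cf_q alpha n.+1.
  by rewrite cf_qSS pquotE// IH; ring.
split; first by rewrite E mulr_gt0.
by rewrite wordS past_rcons E /branch mulKf ?gt_eqF.
Qed.

(** A digit [a] multiplies q_{n+1} by [a.+1 + y], and the product of probabilities telescopes to 1 /
    (q_{n+1} (q_{n+1} + q_n)), the length of the interval of slopes with this word. *)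
Lemma word_lenE alpha n : regular alpha ->
  word_len (word alpha n) * (cf_q alpha n.+1 ^+ 2 * (1 + past (word alpha n))) = 1.
Proof.
move=> ra; elim: n => [|n IH].
  by rewrite /word_len /past /cf_q /=; ring.
have [q0 E] := cf_q_past n ra; have [q1 E1] := cf_q_past n.+1 ra.
have /andP[y0 _] := past_bound (word alpha n).
rewrite -[RHS]IH wordS past_rcons word_len_rcons cf_qSS pquotE// E.
rewrite /digit_prob /branch -(natr1 (digit alpha n).+1).
set u := (digit alpha n).+1%:R : R; have u0 : 0 < u by [].
field; apply/andP; split; lra.
Qed.

Lemma cf_det alpha n : regular alpha ->
  cf_q alpha n.+1 * cf_d alpha n + cf_q alpha n * cf_d alpha n.+1 = 1.
Proof.
move=> ra; elim: n => [|n IH].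
  by rewrite cf_dS// cf_d0// /cf_q /=; ring.
rewrite -[RHS]IH cf_qSS !(cf_dS _ ra) /= -/(gauss_iter alpha n.+1).
by rewrite /pquot /=; have := ra.2 n => x0; field.
Qed.

Lemma pq_ext alpha beta n : regular alpha -> regular beta ->
  word alpha n = word beta n -> pq alpha n = pq beta n.
Proof.
move=> ra rb; elim: n => // n IH.
rewrite !wordS => /rcons_inj[/IH E D].
by rewrite !pq_step E !pquotE// D.
Qed.

(** Equal words give equal convergents p/q, and each slope lies within 1/q^2 of p/q, which makes
    2/q^2. As [past] is at most 1, [word_len] is at least 1/(2 q^2), whence the factor 4. *)
Lemma word_dist alpha beta n : regular alpha -> regular beta ->
  word alpha n = word beta n ->
  `|alpha - beta| <= 4 * word_len (word alpha n).
Proof.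
move=> ra rb E; have Epq := pq_ext ra rb E.
have Ep : cf_p alpha n.+1 = cf_p beta n.+1 by rewrite /cf_p !pq_step Epq.
have Eq : cf_q alpha n.+1 = cf_q beta n.+1 by rewrite /cf_q !pq_step Epq.
have [q0 Eqa] := cf_q_past n ra; have [_ Eqb] := cf_q_past n rb.
have dq c : regular c -> cf_q c n.+1 * cf_d c n.+1 <= 1.
  move=> rc; have [qc0 Eqc] := cf_q_past n rc; rewrite -(cf_det n rc).
  have /andP[y0 _] := past_bound (word c n).
  rewrite (le_trans (y := cf_q c n.+1 * cf_d c n))//.
    by rewrite ler_pM2l// ltW// cf_d_lt.
  by rewrite lerDl mulr_ge0// ?(ltW (cf_d_gt0 _ _))// Eqc mulr_ge0// ltW.
have L := word_lenE n ra; have /andP[y0 y1] := past_bound (word alpha n).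
have l0 := word_len_gt0 (word alpha n).
have H : cf_q alpha n.+1 ^+ 2 * `|alpha - beta| <= 2.
  have : cf_q alpha n.+1 * `|alpha - beta| <= cf_d alpha n.+1 + cf_d beta n.+1.
    rewrite -{1}(gtr0_norm q0) -normrM /cf_d -Ep -Eq.
    set q := cf_q _ _; set p := cf_p _ _.
    have -> : q * (alpha - beta) = (q * alpha - p) - (q * beta - p) by ring.
    exact: ler_normB.
  move=> /(ler_wpM2l (ltW q0)).
  rewrite mulrA -expr2 mulrDr => h; apply: (le_trans h).
  by have := dq _ ra; have := dq _ rb; rewrite -Eq; lra.
have Q2 : 0 < cf_q alpha n.+1 ^+ 2 by rewrite exprn_gt0.
rewrite -(ler_pM2l Q2); apply: (le_trans H).
have -> : cf_q alpha n.+1 ^+ 2 * (4 * word_len (word alpha n)) =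
  4 * (word_len (word alpha n) * cf_q alpha n.+1 ^+ 2) by ring.
move: L; rewrite mulrA; set t := _ * _ ^+ 2.
have t0 : 0 < t by rewrite mulr_gt0.
move=> tE; have : t * 2 >= t * (1 + past (word alpha n)) by rewrite ler_pM2l//; lra.
lra.
Qed.

(** This turns Q = epsilon q_N into an expression in the current iterate and [past], once epsilon is
    measured in units of d_{n+1}. *)
Lemma cf_q_d alpha n : regular alpha ->
  cf_d alpha n.+1 * cf_q alpha n.+1 =
    ((gauss_iter alpha n)^-1 + past (word alpha n))^-1.
Proof.
move=> ra; have [q0 E] := cf_q_past n ra.
have /andP[y0 y1] := past_bound (word alpha n).
have /andP[x0 x1] := gauss_iter_bound n ra.
have d0 := cf_d_gt0 n ra.
have := cf_det n ra; rewrite E !cf_dS// => h.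
set q := cf_q _ _ in h q0 *; set d := cf_d _ _ in h d0 *.
set x := gauss_iter _ _ in h x0 x1 *; set y := past _ in h y0 y1 *.
have qd : q * d = (1 + y * x)^-1.
  have n0 : 1 + y * x != 0 by apply: lt0r_neq0; nra.
  by apply: (mulIf n0); rewrite mulVf// -[RHS]h; ring.
have -> : d * x * q = x * (q * d) by ring.
rewrite qd; field; apply/andP; split; apply: lt0r_neq0 => //; nra.
Qed.

Lemma gauss_iter_pair alpha n : regular alpha ->
  gauss_iter alpha n * gauss_iter alpha n.+1 <= 2^-1.
Proof.
move=> ra; have /andP[x0 x1] := gauss_iter_bound n.+1 ra.
rewrite (gauss_iterS n ra) /branch -(natr1 (digit alpha n)).
set a : R := _%:R; have a0 : 0 <= a by [].
set x := gauss_iter _ _ in x0 x1 *.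
by rewrite mulrC ler_pdivrMr; lra.
Qed.

Lemma rational_gauss_iter alpha n :
  gauss_iter alpha n = 0 -> exists q : rat, alpha = ratr q.
Proof.
move=> h; suff: forall k, (k <= n)%N -> exists q : rat, gauss_iter alpha (n - k) = ratr q.
  by move=> /(_ n (leqnn n)); rewrite subnn.
elim=> [_|k IH kn]; first by exists 0; rewrite subn0 h rmorph0.
have [q] := IH (ltnW kn); rewrite -(subnSK kn) /=.
set x := gauss_iter _ _ => /(canRL (subrK _)) E.
by exists (q + (Num.floor x^-1)%:~R)^-1; rewrite fmorphV rmorphD /= ratr_int -E invrK.
Qed.

End ContinuedFraction.

(** * The distribution of the next digit *)

Section DigitMean.
Variable R : realType.
Implicit Types (x y z c C : R) (a n : nat) (u v : nat -> R).

Definition dsum y v n : R := \sum_(a < n) digit_prob y a * v a.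

Definition dmean y v : R := limn (dsum y v).

Definition dsummable y v : Prop := exists C, forall n, dsum y (fun a => `|v a|) n <= C.

Lemma ler_dsum y u v n : 0 <= y -> (forall a, u a <= v a) -> dsum y u n <= dsum y v n.
Proof.
move=> y0 uv; apply: ler_sum => i _.
by rewrite ler_wpM2l// ltW// digit_prob_gt0.
Qed.

Lemma dsumD y u v n : dsum y (fun a => u a + v a) n = dsum y u n + dsum y v n.
Proof. by rewrite /dsum -big_split; apply: eq_bigr => i _; rewrite mulrDr. Qed.

Lemma dsumZ y c v n : dsum y (fun a => c * v a) n = c * dsum y v n.
Proof. by rewrite /dsum mulr_sumr; apply: eq_bigr => i _; rewrite mulrCA. Qed.

(** Telescoping: [digit_prob y a] is 1 + y times the difference of 1 / (a + 1 + y) and 1 / (a + 2 +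
    y). In the limit the total mass is 1. *)
Lemma dsum_cst y c n : 0 <= y ->
  dsum y (fun=> c) n = c * (1 - (1 + y) / (n.+1%:R + y)).
Proof.
move=> y0; rewrite /dsum -mulr_suml mulrC; congr (_ * _).
elim: n => [|n IH]; first by rewrite big_ord0 divff ?subrr//; lra.
rewrite big_ord_recr /= IH /digit_prob -(natr1 n.+1).
have : 0 < n.+1%:R :> R by [].
by set m := n.+1%:R => m0; field; rewrite !lt0r_neq0//; lra.
Qed.

Lemma dsum_cst_le y c n : 0 <= y -> 0 <= c -> dsum y (fun=> c) n <= c.
Proof.
move=> y0 c0; rewrite dsum_cst// ler_piMr// lerBlDr lerDl.
by rewrite divr_ge0// addr_ge0.
Qed.

Lemma dsummable_bounded y v c : 0 <= y -> (forall a, `|v a| <= c) -> dsummable y v.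
Proof.
move=> y0 vc; exists c => n; apply: le_trans (dsum_cst_le n y0 _).
  exact: ler_dsum.
exact: le_trans (vc 0%N).
Qed.

Lemma dsummable_le y u v : 0 <= y -> (forall a, `|u a| <= `|v a|) ->
  dsummable y v -> dsummable y u.
Proof. by move=> y0 uv [C h]; exists C => n; apply: le_trans (h n); apply: ler_dsum. Qed.

Lemma dsummableD y u v : 0 <= y ->
  dsummable y u -> dsummable y v -> dsummable y (fun a => u a + v a).
Proof.
move=> y0 [C h] [D k]; exists (C + D) => n.
apply: le_trans (lerD (h n) (k n)); rewrite -dsumD.
by apply: ler_dsum => // a; exact: ler_normD.
Qed.

Lemma dsummableZ y c v : dsummable y v -> dsummable y (fun a => c * v a).
Proof.
move=> [C h]; exists (`|c| * C) => n.
rewrite (_ : (fun a => `|c * v a|) = fun a => `|c| * `|v a|); last first.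
  by apply/funext => a; rewrite normrM.
by rewrite dsumZ ler_wpM2l.
Qed.

Lemma dsum_nondecreasing y v : 0 <= y -> (forall a, 0 <= v a) ->
  nondecreasing_seq (dsum y v).
Proof.
move=> y0 v0; apply/nondecreasing_seqP => n.
by rewrite /dsum big_ord_recr /= lerDl mulr_ge0// ltW// digit_prob_gt0.
Qed.

Lemma is_cvg_dsum y v : 0 <= y -> dsummable y v -> cvgn (dsum y v).
Proof.
move=> y0 sv.
have pos u : (forall a, 0 <= u a) -> dsummable y u -> cvgn (dsum y u).
  move=> u0 [C h]; apply: nondecreasing_is_cvgn; first exact: dsum_nondecreasing.
  exists C => _ [n _ <-]; apply: le_trans (h n).
  by apply: ler_dsum => // a; exact: ler_norm.
have -> : dsum y v = (dsum y (fun a => v a + `|v a|)) - (dsum y (fun a => `|v a|)).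
  apply/funext => n.
  by rewrite -[RHS]/(dsum y (fun a => v a + `|v a|) n - dsum y _ n) dsumD addrK.
have sn : dsummable y (fun a => `|v a|).
  by apply: dsummable_le sv => // a; rewrite normr_id.
apply: is_cvgB; apply: pos => //; last exact: dsummableD.
by move=> a; rewrite -lerBlDr sub0r lerNnormlW.
Qed.

Lemma dmeanD y u v : 0 <= y -> dsummable y u -> dsummable y v ->
  dmean y (fun a => u a + v a) = dmean y u + dmean y v.
Proof.
move=> y0 su sv; rewrite /dmean -limD; [|exact: is_cvg_dsum..].
by congr (limn _); apply/funext => n; rewrite dsumD.
Qed.

Lemma dmeanZ y c v : 0 <= y -> dsummable y v ->
  dmean y (fun a => c * v a) = c * dmean y v.
Proof.
move=> y0 sv; apply/cvg_lim => //.
rewrite (_ : dsum _ _ = fun n => c * dsum y v n); last first.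
  by apply/funext => n; rewrite dsumZ.
by apply: cvgM; [exact: cvg_cst|exact: is_cvg_dsum].
Qed.

Lemma dmean_le y v C : 0 <= y -> dsummable y v -> (forall n, dsum y v n <= C) ->
  dmean y v <= C.
Proof.
by move=> y0 sv h; apply: limr_le; [exact: is_cvg_dsum|exact: nearW].
Qed.

Lemma dsum_le_dmean y v n : 0 <= y -> dsummable y v -> (forall a, 0 <= v a) ->
  dsum y v n <= dmean y v.
Proof.
move=> y0 sv v0; apply: nondecreasing_cvgn_le; last exact: is_cvg_dsum.
exact: dsum_nondecreasing.
Qed.

Lemma dmean_norm_le y v C : 0 <= y ->
  (forall n, dsum y (fun a => `|v a|) n <= C) -> `|dmean y v| <= C.
Proof.
move=> y0 h; have sv : dsummable y v by exists C.
have sN : dsummable y (fun a => -1 * v a) by exact: dsummableZ.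
rewrite ler_norml; apply/andP; split.
  rewrite lerNl -mulN1r -dmeanZ//; apply: dmean_le => // n.
  apply: le_trans (h n); apply: ler_dsum => // a.
  by rewrite mulN1r -normrN ler_norm.
apply: dmean_le => // n.
by apply: le_trans (h n); apply: ler_dsum => // a; rewrite ler_norm.
Qed.

Lemma dmean_bounded y v c : 0 <= y -> (forall a, `|v a| <= c) -> `|dmean y v| <= c.
Proof.
move=> y0 h; apply: dmean_norm_le => // n.
apply: le_trans (dsum_cst_le n y0 _); first exact: ler_dsum.
exact: le_trans (h 0%N).
Qed.

Lemma dmean_cst y c : 0 <= y -> dmean y (fun=> c) = c.
Proof.
move=> y0; rewrite /dmean; apply/cvg_lim => //.
have -> : dsum y (fun=> c) = (fun n => c * (1 - (1 + y) * (n.+1%:R + y)^-1)).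
  by apply/funext => n; rewrite dsum_cst.
suff h : (n.+1%:R + y)^-1 @[n --> \oo] --> (0 : R).
  rewrite -[X in _ --> X](_ : c * (1 - (1 + y) * 0) = c); last by ring.
  apply: cvgM; first exact: cvg_cst.
  apply: cvgB; first exact: cvg_cst.
  by apply: cvgM; first exact: cvg_cst.
apply: (@squeeze_cvgr _ _ _ _ (fun=> 0) (@harmonic R)).
- apply: nearW => n; rewrite invr_ge0 addr_ge0//= lef_pV2 ?posrE ?ltr_wpDr//.
  by rewrite lerDl.
- exact: cvg_cst.
- exact: cvg_harmonic.
Qed.

Lemma dmean_ge0 y v : 0 <= y -> dsummable y v -> (forall a, 0 <= v a) ->
  0 <= dmean y v.
Proof.
by move=> y0 sv v0; apply: le_trans (dsum_le_dmean 0 y0 sv v0); rewrite /dsum big_ord0.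
Qed.

Lemma dsummable_sqr y v : 0 <= y -> dsummable y (fun a => v a ^+ 2) -> dsummable y v.
Proof.
move=> y0 sv; apply: (dsummable_le (v := fun a => v a ^+ 2 + 1)) => // [a|].
  rewrite -(real_normK (num_real (v a))); have := normr_ge0 (v a).
  by set t := `|v a| => t0; rewrite ger0_norm; nra.
apply: dsummableD => //; apply: (dsummable_bounded (c := 1)) => // a.
by rewrite normr1.
Qed.

(** Growth of the second moment in one martingale step: the centred increment has mean zero, so the
    cross term disappears, and its variance is at most the second moment [C]. Squares being
    nonnegative, partial sums stay below the full mean. *)
Lemma dsum_sqr_shift y v C x n : 0 <= y -> (forall a, 0 <= v a) ->
  (forall n, dsum y (fun a => v a ^+ 2) n <= C) ->
  dsum y (fun a => (x + (v a - dmean y v)) ^+ 2) n <= x ^+ 2 + C.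
Proof.
move=> y0 v0 hC; set m := dmean y v.
have s2 : dsummable y (fun a => v a ^+ 2).
  exists C => k; apply: le_trans (hC k).
  by apply: ler_dsum => // a; rewrite ger0_norm// sqr_ge0.
have s1 := dsummable_sqr y0 s2.
have s0 c : dsummable y (fun=> c) by apply: (dsummable_bounded (c := `|c|)).
have -> : (fun a => (x + (v a - m)) ^+ 2) =
   (fun a => v a ^+ 2 + (2 * (x - m) * v a + (x - m) ^+ 2)).
  by apply/funext => a; ring.
have s3 : dsummable y (fun a => 2 * (x - m) * v a) by exact: dsummableZ.
have s4 : dsummable y (fun a => 2 * (x - m) * v a + (x - m) ^+ 2) by exact: dsummableD.
have s5 : dsummable y (fun a => v a ^+ 2 + (2 * (x - m) * v a + (x - m) ^+ 2)).
  exact: dsummableD.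
apply: le_trans (dsum_le_dmean n y0 s5 _) _.
  move=> a; rewrite [X in 0 <= X](_ : _ = (x + (v a - m)) ^+ 2) ?sqr_ge0//; ring.
rewrite dmeanD// dmeanD// dmeanZ// dmean_cst// -/m.
have : dmean y (fun a => v a ^+ 2) <= C by exact: dmean_le.
by have := sqr_ge0 m; nra.
Qed.

Lemma digit_prob_dist y z a : 0 <= y -> 0 <= z ->
  `|digit_prob y a - digit_prob z a| <= `|y - z| / (a.+2%:R) ^+ 2.
Proof.
move=> y0 z0; rewrite /digit_prob -(natr1 a.+1) -(natr1 a).
set u : R := a%:R; have u0 : 0 <= u by [].
set b := u + 1 + y; set c := u + 1 + z.
have b1 : u + 1 <= b by rewrite lerDl.
have c1 : u + 1 <= c by rewrite lerDl.
(* With y - z factored out, the remaining numerator lies between - b c and b c, while (b + 1)(c + 1)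
   is at least (u + 2)^2. *)
have -> : (1 + y) / (b * (u + 1 + 1 + y)) - (1 + z) / (c * (u + 1 + 1 + z)) =
  (y - z) * ((u * (b + c + 1) - b * c) / (b * c * ((b + 1) * (c + 1)))).
  by rewrite /b /c; field; rewrite !lt0r_neq0//; lra.
have bc0 : 0 < b * c by apply: mulr_gt0; lra.
have d0 : 0 < (b + 1) * (c + 1) by apply: mulr_gt0; lra.
have u2 : 0 < (u + 1 + 1) ^+ 2 by apply: exprn_gt0; lra.
rewrite normrM ler_wpM2l// normrM normfV (gtr0_norm (mulr_gt0 bc0 d0)).
rewrite ler_pdivrMr; last exact: mulr_gt0.
rewrite [leRHS]mulrC ler_pdivlMr//.
have H : `|u * (b + c + 1) - b * c| <= b * c.
  by rewrite ler_norml; apply/andP; split; nra.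
have H2 : (u + 1 + 1) ^+ 2 <= (b + 1) * (c + 1) by nra.
by apply: ler_pM => //; exact: ltW.
Qed.

End DigitMean.

(** * Filling the gaps between cubes *)

Section CubeGap.
Variable R : realType.

Lemma cube_bracket n : exists k, (k ^ 3 <= n < k.+1 ^ 3)%N.
Proof.
elim: n => [|n [k /andP[kn nk]]]; first by exists 0%N.
have [lt|ge] := ltnP n.+1 (k.+1 ^ 3); first by exists k; rewrite lt (leq_trans kn).
exists k.+1; rewrite ge /=; apply: leq_ltn_trans nk _.
by rewrite ltn_exp2r.
Qed.

(** [D] is controlled at cubes and falls by at most [c] per step. The preceding cube thus bounds
    [D n] from below and the following one from above; the at most 7 k^2 steps in between are
    negligible against k^3. *)
Lemma cube_gap (D : nat -> R) (c : R) (K : nat) : 0 <= c ->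
  (forall n, D n - c <= D n.+1) ->
  (forall k, (K <= k)%N -> D (k ^ 3)%N ^+ 2 <= k%:R ^+ 5) ->
  n%:R^-1 * D n @[n --> \oo] --> (0 : R).
Proof.
move=> c0 Dc DK.
have Dmn m n : D m - n%:R * c <= D (m + n)%N.
  elim: n => [|n IH]; first by rewrite addn0 mul0r subr0.
  rewrite addnS; apply: le_trans (Dc _); rewrite -natr1; lra.
apply/cvgr0Pnorm_le => e e0.
have natub (y : R) : exists N : nat, y <= N%:R.
  by exists (Num.truncn y).+1; exact/ltW/truncnS_gt.
(* For x >= 1, (x + 1)^5 is at most 32 x^5, hence at most (e x^3 / 2)^2 once x e^2 >= 128; the drift
   7 c x^2 is at most e x^3 / 2 once x e >= 14 c. *)
have [S hS] := natub (128 / e ^+ 2); have [T hT] := natub (14 * c / e).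
pose M := (K + S + T).+1%N.
exists (M ^ 3)%N => //= n Mn.
have [k /andP[kn nk]] := cube_bracket n.
have Mk : (M <= k)%N.
  by rewrite -ltnS -(ltn_exp2r _ _ (isT : (0 < 3)%N)) (leq_ltn_trans Mn).
have Kk : (K <= k)%N by apply: leq_trans Mk; rewrite /M; lia.
set x : R := k%:R.
have x1 : 1 <= x by rewrite ler1n (leq_trans _ Mk).
have xe : 128 <= x * e ^+ 2.
  rewrite -ler_pdivrMr ?exprn_gt0//; apply: le_trans hS _.
  by rewrite ler_nat; apply: leq_trans Mk; rewrite /M; lia.
have xc : 14 * c <= x * e.
  rewrite -ler_pdivrMr//; apply: le_trans hT _.
  by rewrite ler_nat; apply: leq_trans Mk; rewrite /M; lia.
have nx : x ^+ 3 <= n%:R by rewrite -natrX ler_nat.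
have n0 : 0 < n%:R :> R by apply: lt_le_trans nx; rewrite exprn_gt0//; lra.
have nx2 : n%:R <= (x + 1) ^+ 3 by rewrite natr1 -natrX ler_nat ltnW.
have gap : (x + 1) ^+ 3 - x ^+ 3 <= 7 * x ^+ 2.
  have -> : (x + 1) ^+ 3 - x ^+ 3 = 3 * x ^+ 2 + 3 * x + 1 by ring.
  by rewrite expr2; nra.
have gapc : c * ((x + 1) ^+ 3 - x ^+ 3) <= e / 2 * x ^+ 3.
  apply: le_trans (ler_wpM2l c0 gap) _.
  have -> : c * (7 * x ^+ 2) = (14 * c) * x ^+ 2 / 2 by field.
  have -> : e / 2 * x ^+ 3 = (x * e) * x ^+ 2 / 2 by field.
  by rewrite ler_pM2r// ler_wpM2r// sqr_ge0.
have big u : u ^+ 2 <= (x + 1) ^+ 5 -> `|u| <= e / 2 * x ^+ 3.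
  have ex0 : 0 <= e / 2 * x ^+ 3 by rewrite mulr_ge0 ?exprn_ge0//; lra.
  move=> hu; rewrite -(ler_pXn2r (n := 2)) ?nnegrE//.
  rewrite real_normK ?num_real//; apply: le_trans hu _.
  have : (x + 1) ^+ 5 <= (2 * x) ^+ 5 by rewrite lerXn2r ?nnegrE; lra.
  move/le_trans; apply.
  have -> : (2 * x) ^+ 5 = 128 * x ^+ 5 / 4 by field.
  have -> : (e / 2 * x ^+ 3) ^+ 2 = (x * e ^+ 2) * x ^+ 5 / 4 by field.
  by rewrite ler_pM2r// ler_wpM2r// exprn_ge0//; lra.
have lo : - (e / 2 * x ^+ 3) <= D (k ^ 3)%N.
  apply: lerNnormlW; apply: big; apply: le_trans (DK _ Kk) _.
  by rewrite lerXn2r ?nnegrE -/x; lra.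
have hi : D (k.+1 ^ 3)%N <= e / 2 * x ^+ 3.
  apply: le_trans (ler_norm _) _; apply: big; apply: le_trans (DK _ _) _.
    exact: leq_trans Kk _.
  by rewrite -natr1.
have B1 : D (k ^ 3)%N - e / 2 * x ^+ 3 <= D n.
  rewrite -[in leRHS](subnKC kn); apply: le_trans (Dmn _ _).
  rewrite lerD2l lerN2 natrB// natrX -/x mulrC; apply: le_trans gapc.
  by rewrite ler_wpM2l// lerB.
have B2 : D n - e / 2 * x ^+ 3 <= D (k.+1 ^ 3)%N.
  rewrite -[in leRHS](subnKC (ltnW nk)); apply: le_trans (Dmn _ _).
  rewrite lerD2l lerN2 natrB ?(ltnW nk)// natrX -natr1 -/x mulrC; apply: le_trans gapc.
  by rewrite ler_wpM2l// lerB.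
rewrite normrM normfV (gtr0_norm n0) mulrC ler_pdivrMr//.
have : e * x ^+ 3 <= e * n%:R by rewrite ler_pM2l.
by rewrite ler_norml => h; apply/andP; split; lra.
Qed.

End CubeGap.

(** * Null sets of angles and covers by cylinders *)

Section AlmostEverywhere.
Variable R : realType.
Implicit Types (th alpha c C : R) (w : seq nat) (A B : set R) (P Q : R -> Prop).
Local Notation mu := (@lebesgue_measure R).

Definition angle_regular th : Prop := (th \in `]0, pi / 4[) /\ regular (tan th).

(** A property of the slope, with the exceptional set measured in the angle, as in the theorem.
    Rational slopes are left out here; [irregular_negligible] disposes of them. *)
Definition ae_slope P : Prop :=
  mu.-negligible [set th | angle_regular th /\ ~ P (tan th)].

Lemma ae_slopeW P Q : (forall alpha, regular alpha -> P alpha -> Q alpha) ->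
  ae_slope P -> ae_slope Q.
Proof.
move=> PQ; apply: negligibleS => th /= [rt nQ]; split=> // p.
by apply: nQ; apply: PQ p; exact: rt.2.
Qed.

Lemma ae_slope_forall (P : nat -> R -> Prop) :
  (forall n, ae_slope (P n)) -> ae_slope (fun alpha => forall n, P n alpha).
Proof.
move=> h; apply: negligibleS (negligible_bigcup h) => th /= [rt].
by move=> /existsNP[n np]; exists n.
Qed.

Lemma ae_slope_and P Q : ae_slope P -> ae_slope Q ->
  ae_slope (fun alpha => P alpha /\ Q alpha).
Proof.
move=> p q; have := @ae_slope_forall (fun n => if n is 0 then P else Q).
move=> h; apply: ae_slopeW (h _); last by case.
by move=> alpha _ k; split; [exact: (k 0%N)|exact: (k 1%N)].
Qed.

Lemma ae_slopeT P : (forall alpha, regular alpha -> P alpha) -> ae_slope P.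
Proof.
move=> h; rewrite /ae_slope (_ : [set _ | _] = set0); first exact: negligible_set0.
by apply/seteqP; split => // th /= [rt]; apply; apply: h; exact: rt.2.
Qed.

(** An outer-measure bound: the measurable set [B] only has to cover [A], so events defined through
    words need no measurability proof. *)
Definition mcover A c : Prop :=
  exists B, [/\ measurable B, A `<=` B & (mu B <= c%:E)%E].

Lemma mcoverS A A' c c' : A' `<=` A -> c <= c' -> mcover A c -> mcover A' c'.
Proof.
move=> AA cc [B [mB AB Bc]]; exists B; split=> //; first exact: subset_trans AB.
by apply: le_trans Bc _; rewrite lee_fin.
Qed.

Lemma mcover_bigcup (A : nat -> set R) (b : nat -> R) c :
  (forall a, mcover (A a) (b a)) -> (forall n, \sum_(a < n) b a <= c) ->
  mcover (\bigcup_a A a) c.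
Proof.
move=> /choice[B hB] bc; exists (\bigcup_a B a); split.
- by apply: bigcup_measurable => a _; have [] := hB a.
- by move=> x [a _ Ax]; exists a => //; have [_ h _] := hB a; exact: h.
- have mB a : measurable (B a) by have [] := hB a.
  apply: (@le_trans _ _ (\sum_(n <oo) mu (B n))%E).
    apply: measure_sigma_subadditive => //.
    by apply: bigcup_measurable => a _; exact: mB.
  apply: lime_le; first exact: is_cvg_nneseries.
  apply: nearW => n; apply: (@le_trans _ _ (\sum_(0 <= i < n) (b i)%:E)%E).
    by apply: lee_sum => i _; have [] := hB i.
  by rewrite sumEFin lee_fin big_mkord.
Qed.

Lemma cos_gt0_quarter th : th \in `]0, pi / 4[ -> 0 < cos th.
Proof.
rewrite in_itv /= => /andP[t0 t1]; have p0 := pi_gt0 R.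
by apply: cos_gt0_pihalf; apply/andP; split; lra.
Qed.

Lemma tan_expanding (s t : R) : s \in `]0, pi / 4[ -> t \in `]0, pi / 4[ ->
  `|s - t| <= `|tan s - tan t|.
Proof.
wlog st : s t / s <= t => [H|hs ht].
  case/orP: (le_total s t) => [/H//|ts hs ht].
  by rewrite distrC (distrC (tan s)); exact: H.
have cx x : x \in `[s, t] -> 0 < cos x.
  move: hs ht; rewrite !in_itv /= => /andP[s0 _] /andP[_ t1] /andP[sx xt].
  by apply: cos_gt0_quarter; rewrite in_itv /=; apply/andP; split; lra.
have dt x : x \in `]s, t[ -> is_derive x 1 (@tan R) ((cos x) ^- 2).
  by move=> /subset_itv_oo_cc/cx/lt0r_neq0; exact: is_derive_tan.
have ct : {within `[s, t], continuous (@tan R)}.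
  apply: continuous_in_subspaceT => x; rewrite inE => /cx/lt0r_neq0.
  exact: continuous_tan.
have [c cst E] := MVT_segment st dt ct.
have h1 : 1 <= (cos c) ^- 2.
  have c0 := cx _ cst; rewrite invf_ge1; last exact: exprn_gt0.
  by have := cos_le1 c; rewrite expr2; nra.
rewrite distrC (distrC (tan _)) E normrM (ger0_norm (le_trans ler01 h1)).
by rewrite ler_peMl.
Qed.

(** All angles with this word lie within [4 * word_len R w] of any one of them, since passing from
    slopes to angles does not increase distances; the interval around one such angle is twice as
    long. *)
Lemma cylinder_cover w :
  mcover [set th | angle_regular th /\ word (tan th) (size w) = w]
    (8 * word_len R w).
Proof.
have l0 := word_len_gt0 R w.
set S := [set th | _].
have [->|/set0P[t0 [[t0i t0r] t0w]]] := eqVneq S set0.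
  by exists set0; split=> //; rewrite measure0 lee_fin mulr_ge0// ltW.
exists `[t0 - 4 * word_len R w, t0 + 4 * word_len R w]%classic; split.
- exact: measurable_itv.
- move=> t [[ti tr] tw] /=; rewrite in_itv /=.
  have := word_dist tr t0r (etrans tw (esym t0w)); rewrite tw => h.
  by have := le_trans (tan_expanding ti t0i) h; rewrite ler_norml => /andP[? ?]; apply/andP; split; lra.
- rewrite lebesgue_measure_itv /=; case: ifPn => _.
    by rewrite -EFinD lee_fin; lra.
  by rewrite lee_fin mulr_ge0// ltW.
Qed.

(** Markov's inequality inside a cylinder, for a quantity whose conditional mean grows by at most
    [C] per digit; the induction splits the cylinder by its next digit. The factor 8 is paid only at
    [n = 0], so it does not accumulate. *)
Lemma word_markov (V : seq nat -> R) C c n w : 0 < c -> 0 <= C -> (forall w, 0 <= V w) ->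
  (forall w k, dsum (past R w) (fun a => V (rcons w a)) k <= V w + C) ->
  mcover [set th | angle_regular th /\ word (tan th) (size w) = w /\
                   c <= V (word (tan th) (size w + n))]
    (8 * word_len R w * (V w + n%:R * C) / c).
Proof.
move=> c0 C0 V0 VC; elim: n w => [|n IH] w; have l0 := word_len_gt0 R w.
  rewrite mul0r addr0; case: (lerP c (V w)) => cV.
    apply: mcoverS (cylinder_cover w); first by move=> t [? []].
    rewrite -mulrA; apply: ler_peMr; first by rewrite mulr_ge0// ltW.
    by rewrite ler_pdivlMr// mul1r.
  exists set0; split=> //.
    by move=> t /= [_ [E]]; rewrite addn0 E leNgt cV.
  by rewrite measure0 lee_fin divr_ge0// ?(ltW c0)// mulr_ge0// mulr_ge0// ltW.
apply: (mcoverS (A := \bigcup_a [set th | angle_regular th /\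
      word (tan th) (size (rcons w a)) = rcons w a /\
      c <= V (word (tan th) (size (rcons w a) + n))])).
- move=> t /= [rt [E h]]; exists (digit (tan t) (size w)) => //=; split=> //.
  by rewrite size_rcons wordS E; split=> //; rewrite addSnnS.
- exact: lexx.
- apply: mcover_bigcup; first by move=> a; exact: IH.
  move=> k; rewrite -mulr_suml ler_pM2r ?invr_gt0//.
  have -> : \sum_(a < k) 8 * word_len R (rcons w a) * (V (rcons w a) + n%:R * C) =
     8 * word_len R w * (dsum (past R w) (fun a => V (rcons w a) + n%:R * C) k).
    rewrite /dsum mulr_sumr; apply: eq_bigr => a _.
    by rewrite word_len_rcons; ring.
  rewrite ler_pM2l ?mulr_gt0//.
  have y0 : 0 <= past R w by case/andP: (past_bound R w).
  rewrite dsumD; apply: le_trans (lerD (VC _ _) (dsum_cst_le _ y0 _)) _.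
    by rewrite mulr_ge0.
  rewrite -natr1; lra.
Qed.

End AlmostEverywhere.

(** * The strong law of large numbers *)

Section Averages.
Variable R : realType.
Implicit Types (u v : nat -> R) (n : nat) (c e : R).

Definition avg u n : R := n%:R^-1 * \sum_(i < n) u i.

Lemma avgD u v n : avg (fun i => u i + v i) n = avg u n + avg v n.
Proof. by rewrite /avg big_split mulrDr. Qed.

Lemma avgZ c u n : avg (fun i => c * u i) n = c * avg u n.
Proof. by rewrite /avg -mulr_sumr mulrCA. Qed.

Lemma avgB u v n : avg (fun i => u i - v i) n = avg u n - avg v n.
Proof. by rewrite /avg sumrB mulrBr. Qed.

Lemma avg_norm_le u v n : (forall i, `|u i| <= v i) -> `|avg u n| <= avg v n.
Proof.
move=> uv; rewrite /avg normrM ger0_norm ?invr_ge0//.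
by rewrite ler_wpM2l ?invr_ge0//; apply: le_trans (ler_norm_sum _ _ _) (ler_sum _ _).
Qed.

Lemma avg_cst_le c n : 0 <= c -> avg (fun=> c) n <= c.
Proof.
move=> c0; rewrite /avg sumr_const card_ord; case: n => [|n].
  by rewrite mulr0n mulr0.
by rewrite -[c *+ _]mulr_natl mulKf// pnatr_eq0.
Qed.

Lemma avg_bounded u c n : 0 <= c -> (forall i, `|u i| <= c) -> `|avg u n| <= c.
Proof. by move=> c0 uc; apply: le_trans (avg_norm_le n uc) (avg_cst_le n c0). Qed.

Lemma cvg_bounded_avg u c : (forall n, `|u n| <= c) ->
  n%:R^-1 * u n @[n --> \oo] --> (0 : R).
Proof.
move=> uc; have c0 : 0 <= c by apply: le_trans (uc 0%N).
apply/cvgr0Pnorm_le => e e0; exists (Num.truncn (c / e)).+1 => //= n hn.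
have n0 : 0 < n%:R :> R by rewrite ltr0n; apply: leq_trans hn.
rewrite normrM ger0_norm ?invr_ge0 ?(ltW n0)// mulrC ler_pdivrMr//.
apply: le_trans (uc n) _; rewrite mulrC -ler_pdivrMr//.
apply: le_trans (ltW (truncnS_gt _)) _.
by rewrite ler_nat.
Qed.

Lemma avg_shift u n : avg (fun i => u i.+1) n = avg u n + n%:R^-1 * (u n - u 0%N).
Proof.
rewrite /avg -mulrDr; congr (_ * _).
have : \sum_(i < n.+1) u i = \sum_(i < n.+1) u i by [].
by rewrite {1}big_ord_recl big_ord_recr /= => E; lra.
Qed.

Lemma avg_sign (s : R) : s = 1 \/ s = -1 ->
  exists c, avg (fun i => s ^+ i) n @[n --> \oo] --> c.
Proof.
case=> ->.
  exists 1; apply: (@cvg_trans _ ((fun=> 1 : R) @ \oo)); last exact: cvg_cst.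
  apply: near_eq_cvg; near=> n; rewrite /avg.
  under eq_bigr do rewrite expr1n.
  rewrite sumr_const card_ord mulVf// pnatr_eq0 -lt0n.
  by near: n; exact: nbhs_infty_gt.
exists 0; apply: (cvg_bounded_avg (c := 1)) => n.
have -> : \sum_(i < n) (-1) ^+ i = (odd n)%:R :> R.
  elim: n => [|n IH]; first by rewrite big_ord0.
  by rewrite big_ord_recr /= IH -signr_odd; case: (odd n) => /=; ring.
by case: (odd n); rewrite ?normr1 ?normr0 ?lexx ?ler01.
Unshelve. all: by end_near. Qed.

End Averages.

(** * Compensated sums along an orbit *)

Section StrongLaw.
Variable R : realType.
Implicit Types (h H : seq nat -> R) (w : seq nat) (alpha B C : R).
Local Notation mu := (@lebesgue_measure R).

Definition next_mean h w : R := dmean (past R w) (fun a => h (rcons w a)).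

(** A martingale for the transition weights [digit_prob]; as a function of words it needs no
    filtration. *)
Definition mart h w : R :=
  \sum_(i < size w) (h (take i.+1 w) - next_mean h (take i w)).

Lemma past_ge0 w : 0 <= past R w.
Proof. by case/andP: (past_bound R w). Qed.

Lemma mart_rcons h w a :
  mart h (rcons w a) = mart h w + (h (rcons w a) - next_mean h w).
Proof.
rewrite /mart size_rcons big_ord_recr /= take_oversize ?size_rcons//.
rewrite -cats1 take_size_cat//; congr (_ + _); apply: eq_bigr => i _.
by rewrite !takel_cat// ltnW.
Qed.

Lemma mart_word h alpha n : mart h (word alpha n) =
  \sum_(i < n) (h (word alpha i.+1) - next_mean h (word alpha i)).
Proof.
elim: n => [|n IH]; first by rewrite /mart !big_ord0.
by rewrite [in LHS]wordS mart_rcons IH big_ord_recr /= -wordS.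
Qed.

Lemma sum_inv_sqr_le n : \sum_(k < n) ((k.+1%:R) ^+ 2)^-1 <= 2 :> R.
Proof.
suff : \sum_(k < n) ((k.+1%:R) ^+ 2)^-1 <= 2 - 2 / n.+1%:R :> R.
  by move/le_trans; apply; rewrite lerBlDr lerDl divr_ge0.
elim: n => [|n IH]; first by rewrite big_ord0 divr1 subrr.
rewrite big_ord_recr /=; apply: le_trans (lerD IH (lexx _)) _.
rewrite -(natr1 n.+1); have : 1 <= n.+1%:R :> R by rewrite ler1n.
set m := n.+1%:R => m1.
have -> : 2 - 2 / m + (m ^+ 2)^-1 = 2 - 2 / (m + 1) + (1 - m) / (m ^+ 2 * (m + 1)).
  by field; rewrite !lt0r_neq0//; lra.
rewrite gerDl; apply: mulr_le0_ge0; first lra.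
by rewrite invr_ge0 mulr_ge0 ?sqr_ge0//; lra.
Qed.

(** Chebyshev's inequality at n = (k + 1)^3, with threshold (k + 1)^5 for the square, gives a cover
    of measure 8 C / (k + 1)^2. Borel-Cantelli applies, and [cube_gap] supplies the remaining n: as
    [h] is nonnegative, an increment is at least minus the conditional mean, which is bounded. *)
Lemma strong_law h C : (forall w, 0 <= h w) ->
  (forall w n, dsum (past R w) (fun a => h (rcons w a) ^+ 2) n <= C) ->
  ae_slope (fun alpha => avg (fun i => h (word alpha i.+1) -
      next_mean h (word alpha i)) n @[n --> \oo] --> (0 : R)).
Proof.
move=> h0 hC.
have C0 : 0 <= C by apply: le_trans (hC [::] 0%N); rewrite /dsum big_ord0.
pose V w := mart h w ^+ 2.
have V0 w : 0 <= V w by rewrite sqr_ge0.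
have VC w k : dsum (past R w) (fun a => V (rcons w a)) k <= V w + C.
  rewrite (_ : (fun a => _) = fun a => (mart h w + (h (rcons w a) -
      dmean (past R w) (fun a => h (rcons w a)))) ^+ 2); last first.
    by apply/funext => a; rewrite /V mart_rcons.
  by apply: dsum_sqr_shift (past_ge0 w) _ _ => // n; exact: hC.
have mean0 w : 0 <= next_mean h w.
  apply: dmean_ge0 (past_ge0 w) _ _ => //; apply: dsummable_sqr (past_ge0 w) _.
  exists C => n; apply: le_trans (hC w n); apply: ler_dsum (past_ge0 w) _ => a.
  by rewrite ger0_norm// sqr_ge0.
have meanC w : next_mean h w <= C + 1.
  have y0 := past_ge0 w.
  have s2 : dsummable (past R w) (fun a => h (rcons w a) ^+ 2).
    exists C => n; apply: le_trans (hC w n); apply: ler_dsum (past_ge0 w) _ => a.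
    by rewrite ger0_norm// sqr_ge0.
  apply: dmean_le => //; first exact: dsummable_sqr.
  move=> n; apply: le_trans (lerD (hC w n) (dsum_cst_le n y0 ler01)).
  by rewrite -dsumD; apply: ler_dsum => // a; have := h0 (rcons w a); nra.
have cover k := word_markov (k.+1 ^ 3) [::] (exprn_gt0 5 (ltr0Sn R k)) C0 V0 VC.
have [B hB] := choice cover.
have mB k : measurable (B k) by have [] := hB k.
have N0 : mu (lim_sup_set B) = 0%E.
  apply: lim_sup_set_cvg0 => //.
  apply: (@le_lt_trans _ _ (16 * C)%:E); last exact: ltry.
  apply: lime_le; first exact: is_cvg_nneseries.
  apply: nearW => n; rewrite /eseries /=.
  apply: (@le_trans _ _ (\sum_(0 <= k < n) (8 * C * ((k.+1%:R) ^+ 2)^-1)%:E)%E).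
    apply: lee_sum => k _; have [_ _] := hB k; move=> /le_trans; apply.
    rewrite lee_fin /V /mart /= big_ord0 expr0n /= add0r /word_len /= natrX.
    rewrite le_eqVlt; apply/orP; left; apply/eqP.
    by have : k.+1%:R != 0 :> R by []; set m := k.+1%:R => m0; field.
  rewrite sumEFin lee_fin big_mkord -mulr_sumr.
  have := sum_inv_sqr_le n; nra.
exists (lim_sup_set B); split => //.
  apply: bigcap_measurable => // k _; apply: bigcup_measurable => j _; exact: mB.
move=> th /= [rt]; apply: contra_notP => /=.
rewrite /lim_sup_set /bigcap /= => /existsNP[K /not_implyP[_ hK]].
rewrite /avg; under eq_fun do rewrite -mart_word.
(* [B k] belongs to the cube of [k.+1], hence the threshold [K.+1]. *)
apply: (cube_gap (c := C + 1) (K := K.+1)); first by rewrite addr_ge0.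
  move=> n; rewrite wordS mart_rcons; have := meanC (word (tan th) n).
  have := h0 (rcons (word (tan th) n) (digit (tan th) n)); lra.
move=> [//|k]; rewrite ltnS => Kk; rewrite leNgt; apply/negP => /ltW lt.
apply: hK; exists k => //; have [_ sB _] := hB k; apply: sB => /=.
by split.
Qed.

End StrongLaw.

(** * Ergodic averages *)

Section Ergodic.
Variable R : realType.
Implicit Types (h H : seq nat -> R) (w : seq nat) (alpha B C e L s y z : R).
Implicit Types (u v : R -> nat -> R).
Local Notation mu := (@lebesgue_measure R).

Lemma tan_unit (th : R) : th \in `]0, pi / 4[ -> 0 < tan th < 1.
Proof.
move=> hth; have p0 := pi_gt0 R; move: hth; rewrite in_itv /= => /andP[t0 t1].
rewrite -{1}(tan0 R) -(tan_piquarter R).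
by rewrite !ltr_tan ?in_itv /=; apply/andP; split; lra.
Qed.

Lemma irregular_negligible :
  mu.-negligible [set th | (th \in `]0, pi / 4[) /\ ~ regular (tan th)].
Proof.
pose Q := \bigcup_(q in [set: rat]) [set atan (ratr q : R)].
exists Q; split.
- exact: bigcupT_measurable_rat.
- have cQ : countable Q by apply: bigcup_countable.
  exact: countable_lebesgue_measure0.
- move=> th [hth]; have p0 := pi_gt0 R => irr.
  have [n hn] : exists n, gauss_iter (tan th) n = 0.
    apply: contra_notP irr => /forallNP h; split; first exact: tan_unit.
    by move=> n; apply/eqP.
  have [q E] := rational_gauss_iter hn; exists q => //.
  rewrite /= -E tanK// in_itv /=; move: hth; rewrite in_itv /= => /andP[? ?].
  by apply/andP; split; lra.
Qed.

Lemma angle_witness (P : R -> Prop) :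
  mu.-negligible [set th | (th \in `]0, pi / 4[) /\ ~ P th] ->
  exists th, (th \in `]0, pi / 4[) /\ P th.
Proof.
move=> aP; apply: contrapT => /forallNP nP.
have : mu.-negligible (`]0, pi / 4[%classic : set R).
  by apply: negligibleS aP => th /= hth; split=> // p; apply: (nP th).
move=> [N [mN N0 sN]]; pose I : set R := `]0, pi / 4[%classic.
have : (mu I <= 0)%E.
  by rewrite -N0; apply: le_measure => //; rewrite inE//; exact: measurable_itv.
have p0 := pi_gt0 R; rewrite /I lebesgue_measure_itv /= lte_fin divr_gt0//.
by rewrite -EFinB subr0 lee_fin leNgt divr_gt0.
Qed.

Lemma ae_slope_witness (P : R -> Prop) :
  ae_slope P -> exists alpha, regular alpha /\ P alpha.
Proof.
move=> aP; have [|th [_ h]] := @angle_witness (fun th => regular (tan th) /\ P (tan th)).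
  apply: negligibleS (negligibleU irregular_negligible aP) => th /= [hth nP].
  have [r|r] := pselect (regular (tan th)); last by left.
  by right; split => // p; apply: nP.
by exists (tan th).
Qed.

(** Convergence to a constant, up to every precision. The constant may change with [e], which makes
    the notion stable under approximation on average; [erg_cvg] recovers a genuine limit. *)
Definition erg u : Prop := forall e, 0 < e -> exists c : R,
  ae_slope (fun alpha => \forall n \near \oo, `|avg (u alpha) n - c| <= e).

Lemma erg_cvg u : erg u -> exists c : R,
  ae_slope (fun alpha => avg (u alpha) n @[n --> \oo] --> c).
Proof.
move=> eu.
have /choice[c hc] (j : nat) : exists c : R, ae_slope (fun alpha =>
    \forall n \near \oo, `|avg (u alpha) n - c| <= j.+1%:R^-1).
  by apply: eu; rewrite invr_gt0.
have hA := ae_slope_forall hc.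
have cvgA alpha : (forall j, \forall n \near \oo, `|avg (u alpha) n - c j| <= j.+1%:R^-1) ->
    cvgn (avg (u alpha)).
  move=> h; apply/cauchy_cvgP/cauchy_exP => e e0.
  have [j je] : exists j : nat, j.+1%:R^-1 < e.
    exists (Num.truncn e^-1); rewrite invf_plt ?posrE//; exact: truncnS_gt.
  exists (c j); have := h j; apply: filterS => n /le_lt_trans/(_ je).
  by rewrite /ball /= distrC.
(* The constants [c j] are common to almost all slopes, so the limit along one orbit is the limit
   along the others. *)
have [a0 [ra0 h0]] := ae_slope_witness hA.
exists (limn (avg (u a0))).
have near_c j : `|limn (avg (u a0)) - c j| <= j.+1%:R^-1.
  apply/ler_addgt0Pr => e e0; near \oo => n.
  apply: le_trans (ler_distD (avg (u a0) n) _ _) _; rewrite addrC.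
  apply: lerD; near: n; first exact: h0.
  by move/cvgrPdist_le : (cvgA _ h0); apply.
apply: ae_slopeW hA => alpha ra h.
apply/cvgrPdist_le => e e0.
have [j je] : exists j : nat, j.+1%:R^-1 < e / 2.
  by exists (Num.truncn (e / 2)^-1); rewrite invf_plt ?posrE ?divr_gt0//; exact: truncnS_gt.
near=> n; rewrite (splitr e); apply: le_trans (ler_distD (c j) _ _) _.
apply: lerD; first exact: le_trans (near_c j) (ltW je).
rewrite distrC; apply: le_trans (ltW je); near: n; exact: h.
Unshelve. all: by end_near. Qed.

Lemma erg_approx u : (forall e, 0 < e -> exists v, erg v /\ ae_slope (fun alpha =>
    \forall n \near \oo, `|avg (u alpha) n - avg (v alpha) n| <= e)) -> erg u.
Proof.
move=> h e e0; have e2 : 0 < e / 2 by rewrite divr_gt0.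
have [v [ev uv]] := h _ e2; have [c hc] := ev _ e2; exists c.
apply: ae_slopeW (ae_slope_and uv hc) => alpha _ [h1 h2].
near=> n; rewrite (splitr e); apply: le_trans (ler_distD (avg (v alpha) n) _ _) _.
by apply: lerD; near: n.
Unshelve. all: by end_near. Qed.

Lemma ergD u v : erg u -> erg v -> erg (fun alpha i => u alpha i + v alpha i).
Proof.
move=> eu ev e e0; have e2 : 0 < e / 2 by rewrite divr_gt0.
have [c hc] := eu _ e2; have [d hd] := ev _ e2; exists (c + d).
apply: ae_slopeW (ae_slope_and hc hd) => alpha _ [h1 h2].
near=> n; rewrite (splitr e) avgD opprD addrACA.
apply: le_trans (ler_normD _ _) _.
by apply: lerD; near: n.
Unshelve. all: by end_near. Qed.

(** The strong law for the nonnegative function [H + B], where [B] cancels against its own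
    conditional mean. Re-indexing from [i.+1] to [i] costs at most 2 B / n. *)
Lemma erg_transfer H B : (forall w, `|H w| <= B) ->
  ae_slope (fun alpha => (avg (fun i => H (word alpha i)) n -
    avg (fun i => next_mean H (word alpha i)) n) @[n --> \oo] --> (0 : R)).
Proof.
move=> HB; pose h w := H w + B.
have h0 w : 0 <= h w by rewrite /h -lerBlDr sub0r lerNnormlW.
have hB w : h w <= 2 * B by have := le_trans (ler_norm _) (HB w); rewrite /h; lra.
have B0 : 0 <= B by exact: le_trans (HB [::]).
have hC w n : dsum (past R w) (fun a => h (rcons w a) ^+ 2) n <= (2 * B) ^+ 2.
  apply: le_trans (dsum_cst_le n (past_ge0 R w) (sqr_ge0 _)).
  by apply: ler_dsum (past_ge0 R w) _ => a; rewrite lerXn2r ?nnegrE// mulr_ge0.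
have nh w : next_mean h w = next_mean H w + B.
  rewrite /next_mean /h dmeanD ?dmean_cst ?past_ge0//.
    by apply: (dsummable_bounded (c := B)); rewrite ?past_ge0.
  by apply: (dsummable_bounded (c := `|B|)); rewrite ?past_ge0.
apply: ae_slopeW (strong_law h0 hC) => alpha _ hl.
have bd : n%:R^-1 * (H (word alpha n) - H (word alpha 0)) @[n --> \oo] --> (0 : R).
  apply: (cvg_bounded_avg (c := B + B)) => n.
  by apply: le_trans (ler_normB _ _) (lerD _ _).
rewrite (_ : (fun n => _) = (fun n =>
    avg (fun i => h (word alpha i.+1) - next_mean h (word alpha i)) n
    - n%:R^-1 * (H (word alpha n) - H (word alpha 0)))).
  by rewrite -[X in _ --> X](subr0 0); exact: cvgB hl bd.
apply/funext => n.
rewrite (_ : (fun i => h (word alpha i.+1) - next_mean h (word alpha i)) =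
    (fun i => H (word alpha i.+1) - next_mean H (word alpha i))); last first.
  by apply/funext => i; rewrite nh /h opprD addrACA subrr addr0.
by rewrite avgB (avg_shift (fun i => H (word alpha i))) addrAC addrK.
Qed.

Lemma branch_dist y z a : 0 <= y -> 0 <= z ->
  `|branch a y - branch a z| <= `|y - z| / (a.+1%:R) ^+ 2.
Proof.
move=> y0 z0; rewrite /branch; have a1 : 1 <= a.+1%:R :> R by rewrite ler1n.
set b : R := a.+1%:R in a1 *.
have -> : (b + y)^-1 - (b + z)^-1 = (z - y) * ((b + y) * (b + z))^-1.
  by field; rewrite !lt0r_neq0//; lra.
rewrite normrM distrC ler_wpM2l// ger0_norm ?invr_ge0; last by nra.
by rewrite lef_pV2 ?posrE ?exprn_gt0//; nra.
Qed.

Lemma branch_dist1 y z a : 0 <= y -> 0 <= z -> `|branch a y - branch a z| <= `|y - z|.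
Proof.
move=> y0 z0; apply: le_trans (branch_dist a y0 z0) _.
by rewrite ler_pdivrMr ?exprn_gt0// ler_peMr// -natrX ler1n expn_gt0.
Qed.

(** As (a + 2)^2 exceeds (a + 3/2)(a + 5/2), the sum of 1 / (a + 2)^2 is dominated by a telescoping
    one that starts at 1 / (3/2). *)
Lemma digit_prob_tv y z n : 0 <= y -> 0 <= z ->
  \sum_(a < n) `|digit_prob y a - digit_prob z a| <= 2 / 3 * `|y - z|.
Proof.
move=> y0 z0.
apply: le_trans (_ : \sum_(a < n) `|y - z| / (a.+2%:R) ^+ 2 <= _).
  by apply: ler_sum => a _; exact: digit_prob_dist.
rewrite -mulr_sumr mulrC ler_wpM2r//.
suff : \sum_(a < n) ((a.+2%:R) ^+ 2)^-1 <= 2 / 3 - (n%:R + 3 / 2)^-1 :> R.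
  by move/le_trans; apply; rewrite lerBlDr lerDl invr_ge0 addr_ge0// divr_ge0.
elim: n => [|n IH]; first by rewrite big_ord0 add0r invf_div subrr.
rewrite big_ord_recr /=; apply: le_trans (lerD IH (lexx _)) _.
rewrite -(natr1 n.+1) -(natr1 n); have : 0 <= n%:R :> R by [].
set m := n%:R => m1.
have -> : (m + 3 / 2)^-1 = (m + 1 + 3 / 2)^-1 + ((m + 3 / 2) * (m + 1 + 3 / 2))^-1.
  by field; rewrite !lt0r_neq0//; lra.
suff : ((m + 1 + 1) ^+ 2)^-1 <= ((m + 3 / 2) * (m + 1 + 3 / 2))^-1 by lra.
by rewrite lef_pV2 ?posrE; nra.
Qed.

Lemma dmean_dist y z (f g : nat -> R) C : 0 <= y -> 0 <= z ->
  dsummable y f -> dsummable z g ->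
  (forall n, \sum_(a < n) (digit_prob y a * `|f a - g a| +
     `|digit_prob y a - digit_prob z a| * `|g a|) <= C) ->
  `|dmean y f - dmean z g| <= C.
Proof.
move=> y0 z0 sf sg h; rewrite /dmean -limB; [|exact: is_cvg_dsum..].
have cl : cvgn (dsum y f - dsum z g) by apply: is_cvgB; exact: is_cvg_dsum.
rewrite -lim_norm//; apply: limr_le; first exact: is_cvg_norm.
apply: nearW => n; apply: le_trans (h n).
rewrite -[(dsum y f - dsum z g) n]/(dsum y f n - dsum z g n) /dsum -sumrB.
apply: le_trans (ler_norm_sum _ _ _) _; apply: ler_sum => a _.
have -> : digit_prob y a * f a - digit_prob z a * g a =
   digit_prob y a * (f a - g a) + (digit_prob y a - digit_prob z a) * g a by ring.
apply: le_trans (ler_normD _ _) _.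
rewrite [X in X + _]normrM [X in _ + X]normrM.
by rewrite (ger0_norm (ltW (digit_prob_gt0 a y0))).
Qed.


Definition lipschitz01 L (phi : R -> R) : Prop :=
  forall y z, 0 <= y <= 1 -> 0 <= z <= 1 -> `|phi y - phi z| <= L * `|y - z|.

Lemma lipschitz01_bounded L phi y : lipschitz01 L phi -> 0 <= L -> 0 <= y <= 1 ->
  `|phi y| <= `|phi 0| + L.
Proof.
move=> lp L0 y01; have z01 : 0 <= (0 : R) <= 1 by rewrite lexx ler01.
have := lp y 0 y01 z01; rewrite subr0 => h.
rewrite -[phi y](subrK (phi 0)) addrC; apply: le_trans (ler_normD _ _) _.
rewrite lerD2l; apply: le_trans h _; case/andP: y01 => y0 y1.
by rewrite (ger0_norm y0) ler_piMr.
Qed.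

Definition transition (phi : R -> R) y : R := dmean y (fun a => phi (branch a y)).

(* Split the difference of the two means into a displacement of the branches,
   which contracts by 1/4 unless the digit is 1, and a change of the digit
   distribution, of total variation at most 2/3, tested on an oscillation of at
   most half the Lipschitz constant: 1/4 + 3/8 + 1/3 = 23/24. *)
Lemma transition_contracts L phi : 0 <= L -> lipschitz01 L phi ->
  lipschitz01 (23 / 24 * L) (transition phi).
Proof.
move=> L0 lp y z y01 z01.
have /andP[y0 y1] := y01; have /andP[z0 z1] := z01.
pose m := phi (2^-1).
have h01 : 0 <= (2^-1 : R) <= 1 by apply/andP; split; lra.
have bd x a : 0 <= x <= 1 -> `|phi (branch a x) - m| <= L / 2.
  move=> x01; have b01 := branch_bound a x01.
  apply: le_trans (lp _ _ b01 h01) _; rewrite ler_wpM2l// ler_norml.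
  by case/andP: b01 => *; apply/andP; split; lra.
have sy : dsummable y (fun a => phi (branch a y) - m).
  by apply: (dsummable_bounded (c := L / 2)) => // a; exact: bd.
have sz : dsummable z (fun a => phi (branch a z) - m).
  by apply: (dsummable_bounded (c := L / 2)) => // a; exact: bd.
have sc x : 0 <= x -> dsummable x (fun=> m).
  by move=> x0; apply: (dsummable_bounded (c := `|m|)).
have tE x : 0 <= x -> dsummable x (fun a => phi (branch a x) - m) ->
    transition phi x = dmean x (fun a => phi (branch a x) - m) + m.
  move=> x0 sx; rewrite -[X in _ + X](dmean_cst m x0) -dmeanD//; last exact: sc.
  by congr (dmean _ _); apply/funext => a; rewrite subrK.
rewrite (tE y y0 sy) (tE z z0 sz) opprD addrACA subrr addr0.
apply: dmean_dist => // n; set d := `|y - z|.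
have d0 : 0 <= d by exact: normr_ge0.
apply: (@le_trans _ _ (\sum_(a < n) (L * d * (digit_prob y a / 4 +
    (if a == 0%N :> nat then 3 / 8 else 0)) +
    L / 2 * `|digit_prob y a - digit_prob z a|))).
  apply: ler_sum => a _; apply: lerD; last first.
    by rewrite mulrC ler_wpM2r//; exact: bd.
  rewrite opprB addrA subrK.
  have p0 := digit_prob_gt0 a y0.
  have L1 := lp _ _ (branch_bound a y01) (branch_bound a z01).
  have B := branch_dist a y0 z0; rewrite -/d in B.
  case: eqP => [a0|/eqP a0].
    have p1 : digit_prob y a <= 1 / 2.
      by rewrite a0 /digit_prob ler_pdivrMr; nra.
    have B1 := branch_dist1 a y0 z0; rewrite -/d in B1.
    have H := le_trans L1 (ler_wpM2l L0 B1).
    have Ld : 0 <= L * d by rewrite mulr_ge0.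
    by apply: le_trans (ler_wpM2l (ltW p0) H) _; rewrite mulrC ler_wpM2l//; lra.
  have B4 : `|branch a y - branch a z| <= d / 4.
    apply: le_trans B _; rewrite ler_wpM2l// lef_pV2 ?posrE ?exprn_gt0//.
    have : 2 <= a.+1%:R :> R by rewrite ler_nat ltnS lt0n.
    by nra.
  have := le_trans L1 (ler_wpM2l L0 B4) => H.
  apply: le_trans (ler_wpM2l (ltW p0) H) _; rewrite addr0.
  by rewrite le_eqVlt; apply/orP; left; apply/eqP; field.
rewrite big_split /= -mulr_sumr -mulr_sumr big_split /= -mulr_suml.
have S1 : \sum_(a < n) digit_prob y a <= 1.
  have := dsum_cst_le n y0 ler01; rewrite /dsum.
  by under eq_bigr do rewrite mulr1.
have S2 : \sum_(a < n) (if a == 0%N :> nat then 3 / 8 else 0 : R) <= 3 / 8.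
  case: {S1} n => [|k]; first by rewrite big_ord0; lra.
  by rewrite big_ord_recl /= big1 ?addr0.
have S3 := digit_prob_tv n y0 z0; rewrite -/d in S3.
have Ld : 0 <= L * d by rewrite mulr_ge0.
have A1 := ler_wpM2l Ld (lerD (ler_wpM2r (_ : 0 <= 4^-1) S1) S2).
have A2 : L / 2 * (\sum_(a < n) `|digit_prob y a - digit_prob z a|) <=
   L / 2 * (2 / 3 * d) by rewrite ler_wpM2l// divr_ge0.
apply: le_trans (lerD (A1 _) A2) _; first by rewrite invr_ge0.
rewrite le_eqVlt; apply/orP; left; apply/eqP; by field.
Qed.

(** Each use of [erg_transfer] trades [phi] for [s] times its image under [transition], whose
    Lipschitz constant is smaller by the factor 23/24. After [j] trades the function differs from
    its value at 0 by at most (23/24)^j L, and for a constant only the average of [s ^+ i]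
    remains. *)
Lemma erg_past_aux s j phi L e : s = 1 \/ s = -1 -> 0 <= L -> lipschitz01 L phi ->
  0 < e -> exists c : R, ae_slope (fun alpha => \forall n \near \oo,
    `|avg (fun i => s ^+ i * phi (past R (word alpha i))) n - c|
      <= (23 / 24) ^+ j * L + e).
Proof.
move=> hs; have ns i : `|s ^+ i| = 1.
  by rewrite normrX; case: hs => ->; rewrite ?normrN normr1 expr1n.
elim: j phi L e => [|j IH] phi L e L0 lp e0.
  have [c hc] := avg_sign hs; exists (phi 0 * c); apply: ae_slopeT => alpha _.
  rewrite expr0 mul1r.
  have hc' : phi 0 * avg (fun i => s ^+ i) n @[n --> \oo] --> phi 0 * c.
    by apply: cvgM => //; exact: cvg_cst.
  move/cvgrPdist_le : hc' => /(_ _ e0); apply: filterS => n hn.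
  apply: le_trans (ler_distD (phi 0 * avg (fun i => s ^+ i) n) _ _) _.
  apply: lerD; last by rewrite distrC.
  rewrite -avgZ -avgB; apply: avg_bounded => // i.
  rewrite mulrC -mulrBl normrM ns mulr1.
  have p01 := past_bound R (word alpha i).
  have z01 : 0 <= (0 : R) <= 1 by rewrite lexx ler01.
  apply: le_trans (lp _ _ p01 z01) _; rewrite subr0.
  by case/andP: p01 => p0 p1; rewrite ger0_norm// ler_piMr.
have e2 : 0 < e / 2 by rewrite divr_gt0.
have L0' : 0 <= 23 / 24 * L by rewrite mulr_ge0// divr_ge0.
have [c hc] := IH (transition phi) _ _ L0' (transition_contracts L0 lp) e2.
pose H w := s ^+ size w * phi (past R w).
have HB w : `|H w| <= `|phi 0| + L.
  by rewrite /H normrM ns mul1r; apply: lipschitz01_bounded (past_bound R w).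
have nH w : next_mean H w = s * (s ^+ size w * transition phi (past R w)).
  rewrite /next_mean /transition mulrA -exprS -dmeanZ ?past_ge0//.
    by congr (dmean _ _); apply/funext => a; rewrite /H size_rcons past_rcons.
  apply: (dsummable_bounded (c := `|phi 0| + L)); rewrite ?past_ge0// => a.
  by apply: lipschitz01_bounded => //; exact: branch_bound (past_bound R w).
exists (s * c); apply: ae_slopeW (ae_slope_and (erg_transfer HB) hc).
move=> alpha _ [/cvgr0Pnorm_le/(_ _ e2) h1 h2].
near=> n.
rewrite (_ : (fun i => _) = fun i => H (word alpha i)); last first.
  by apply/funext => i; rewrite /H size_word.
apply: le_trans (ler_distD (avg (fun i => next_mean H (word alpha i)) n) _ _) _.
rewrite [X in _ <= X](_ : _ = e / 2 + ((23 / 24) ^+ j * (23 / 24 * L) + e / 2)); last first.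
  by rewrite exprSr; field.
apply: lerD; first by near: n.
rewrite (_ : (fun i => next_mean H _) = fun i => s * (s ^+ i *
    transition phi (past R (word alpha i)))); last first.
  by apply/funext => i; rewrite nH size_word.
rewrite avgZ -mulrBr normrM -(expr1 s) ns mul1r.
by near: n.
Unshelve. all: by end_near. Qed.

Lemma erg_past s phi L : s = 1 \/ s = -1 -> 0 <= L -> lipschitz01 L phi ->
  erg (fun alpha i => s ^+ i * phi (past R (word alpha i))).
Proof.
move=> hs L0 lp e e0; have e2 : 0 < e / 2 by rewrite divr_gt0.
have : (23 / 24 : R) ^+ j * L @[j --> \oo] --> (0 : R).
  rewrite -(mul0r L); apply: cvgM; last exact: cvg_cst.
  by apply: cvg_expr; rewrite ger0_norm; lra.
move=> /cvgr0Pnorm_le/(_ _ e2)[j _ /(_ j (leqnn j))] hj.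
have [c hc] := erg_past_aux j hs L0 lp e2; exists c.
apply: ae_slopeW hc => alpha _; apply: filterS => n h; apply: (le_trans h).
by rewrite [X in _ <= X](splitr e) lerD2r; apply: le_trans hj; exact: ler_norm.
Qed.

(** [psi] sees the last [k] digits and the [past] of what precedes them. Words shorter than [k] get
    a default value, which concerns finitely many terms of an orbit. *)
Definition window_fun s k (psi : seq nat -> R -> R) w : R :=
  if (k <= size w)%N then
    s ^+ size w * psi (drop (size w - k) w) (past R (take (size w - k) w))
  else 0.

Lemma foldl_branch_bound y w : 0 <= y <= 1 ->
  0 <= foldl (fun y a => branch a y) y w <= 1.
Proof. by elim: w y => //= a w IH y y01; apply: IH; exact: branch_bound. Qed.

Lemma foldl_branch_dist y z w : 0 <= y <= 1 -> 0 <= z <= 1 ->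
  `|foldl (fun y a => branch a y) y w - foldl (fun y a => branch a y) z w|
    <= `|y - z|.
Proof.
elim: w y z => //= a w IH y z y01 z01.
apply: le_trans (IH _ _ (branch_bound a y01) (branch_bound a z01)) _.
by apply: branch_dist1; [case/andP: y01|case/andP: z01].
Qed.

(** Induction on [k], averaging out the latest digit: its law is that of the state reached from [y]
    through the other digits of the window. This state is 1-Lipschitz in [y], and the law varies by
    at most 2/3 of the distance of states, so each digit adds (2/3) B to the Lipschitz constant. *)
Lemma erg_window s k psi B L : s = 1 \/ s = -1 -> 0 <= B -> 0 <= L ->
  (forall (v : seq nat) y, 0 <= y <= 1 -> `|psi v y| <= B) ->
  (forall v : seq nat, lipschitz01 L (psi v)) ->
  erg (fun alpha i => window_fun s k psi (word alpha i)).
Proof.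
move=> hs; have ns i : `|s ^+ i| = 1.
  by rewrite normrX; case: hs => ->; rewrite ?normrN normr1 expr1n.
elim: k psi L => [|k IH] psi L B0 L0 pB pL.
  have := erg_past hs L0 (pL [::]).
  rewrite (_ : (fun alpha i => _) =
    (fun alpha i => window_fun s 0 psi (word alpha i)))//.
  apply/funext => alpha; apply/funext => i.
  by rewrite /window_fun leq0n subn0 drop_size take_size size_word.
(* The factor [s] accounts for [rcons w a] being one digit longer than [w]. *)
pose psi' (v : seq nat) y := s * dmean (foldl (fun y a => branch a y) y v) (fun a => psi (rcons v a) y).
have fb y (v : seq nat) : 0 <= y <= 1 -> 0 <= foldl (fun y a => branch a y) y v.
  by move=> y01; case/andP: (foldl_branch_bound v y01).
have sm (v : seq nat) y : 0 <= y <= 1 ->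
    dsummable (foldl (fun y a => branch a y) y v) (fun a => psi (rcons v a) y).
  move=> y01; apply: (dsummable_bounded (c := B)); first exact: fb.
  by move=> a; exact: pB.
have pB' (v : seq nat) y : 0 <= y <= 1 -> `|psi' v y| <= B.
  move=> y01; rewrite /psi' normrM -(expr1 s) ns mul1r.
  by apply: dmean_bounded => [|a]; [exact: fb|exact: pB].
have pL' (v : seq nat) : lipschitz01 (L + 2 / 3 * B) (psi' v).
  move=> y z y01 z01; rewrite /psi' -mulrBr normrM -(expr1 s) ns mul1r.
  apply: dmean_dist; [exact: fb|exact: fb|exact: sm|exact: sm|move=> n].
  rewrite big_split /= mulrDl; apply: lerD.
    apply: le_trans (dsum_cst_le n (fb y v y01) _); last exact: mulr_ge0.
    exact: (ler_dsum n (fb y v y01) (fun a => pL (rcons v a) y z y01 z01)).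
  apply: (@le_trans _ _ (\sum_(a < n) (`|digit_prob (foldl (fun y a => branch a y) y v) a -
     digit_prob (foldl (fun y a => branch a y) z v) a| * B))).
    by apply: ler_sum => a _; rewrite ler_wpM2l//; exact: pB.
  rewrite -mulr_suml mulrAC ler_wpM2r//.
  apply: le_trans (digit_prob_tv n (fb y v y01) (fb z v z01)) _.
  by rewrite ler_wpM2l// ?divr_ge0//; exact: foldl_branch_dist.
have L0' : 0 <= L + 2 / 3 * B by rewrite addr_ge0// mulr_ge0// divr_ge0.
have E := IH psi' _ B0 L0' pB' pL'.
apply: erg_approx => e e0; exists (fun alpha i => window_fun s k psi' (word alpha i)).
split => //.
have HB w : `|window_fun s k.+1 psi w| <= B.
  rewrite /window_fun; case: ifP => _; last by rewrite normr0.
  by rewrite normrM ns mul1r; apply: pB; exact: past_bound.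
apply: ae_slopeW (erg_transfer HB) => alpha _ /cvgr0Pnorm_le/(_ _ e0).
apply: filterS => n; rewrite (_ : next_mean _ = window_fun s k psi')//.
apply/funext => w; rewrite /next_mean /window_fun.
under [X in dmean _ X]eq_fun do rewrite size_rcons ltnS.
case: (leqP k (size w)) => [kw|_]; last by rewrite dmean_cst ?past_ge0.
rewrite mulrA -exprSr.
have -> : past R w = foldl (fun y a => branch a y)
     (past R (take (size w - k) w)) (drop (size w - k) w).
  by rewrite -{1}(cat_take_drop (size w - k) w) /past foldl_cat.
rewrite -dmeanZ; last 2 first.
- by apply: fb; exact: past_bound.
- by apply: sm; exact: past_bound.
congr (dmean _ _); apply/funext => a.
by rewrite subSS drop_rcons ?leq_subr// -(cats1 w a) takel_cat ?leq_subr.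
Qed.

End Ergodic.

(** * Observables of a digit, its future and its past *)

Section Observables.
Variable R : realType.
Implicit Types (alpha B e s x y z : R) (w : seq nat) (G : nat -> R -> R -> R).

(** Up to the factor 4 this dominates the logarithm of a large digit. Its square is of order
    a^(1/2), summable against weights of order a^-2, and its second moment tends to zero as [M]
    grows. *)
Definition quartic_tail M w : R :=
  if (M <= last 0%N w)%N then Num.sqrt (Num.sqrt (last 0%N w).+2%:R) else 0.

Lemma quartic_tail_ge0 M w : 0 <= quartic_tail M w.
Proof. by rewrite /quartic_tail; case: ifP => // _; rewrite sqrtr_ge0. Qed.

Lemma digit_prob_le y a : 0 <= y <= 1 -> digit_prob y a <= 2 / (a.+1%:R * a.+2%:R).
Proof.
move=> /andP[y0 y1]; have pos k : k.+1%:R <= k.+1%:R + y by rewrite lerDl.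
have pos0 k : 0 < k.+1%:R + y by rewrite ltr_wpDr.
rewrite /digit_prob; apply: ler_pM.
- exact: addr_ge0.
- by rewrite invr_ge0 mulr_ge0// ltW.
- lra.
- by rewrite lef_pV2 ?posrE ?mulr_gt0//; apply: ler_pM.
Qed.

(** The sum is compared with a telescoping one. For consecutive square roots a and b, b - a = 1 / (a
    + b) and b <= 2 a, so 6 (b - a) >= 2 / a: this is the origin of the 6. *)
Lemma quartic_tail_moment M w n :
  dsum (past R w) (fun a => quartic_tail M (rcons w a) ^+ 2) n
    <= 6 / Num.sqrt M.+1%:R.
Proof.
pose r k : R := Num.sqrt k.+1%:R.
have r0 k : 0 < r k by rewrite sqrtr_gt0.
suff : dsum (past R w) (fun a => quartic_tail M (rcons w a) ^+ 2) n <=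
    6 / r M - 6 / r (maxn M n).
  by move/le_trans; apply; rewrite lerBlDr lerDl divr_ge0// ltW.
elim: n => [|n IH]; first by rewrite /dsum big_ord0 maxn0 subrr.
rewrite /dsum big_ord_recr /= {2}/quartic_tail last_rcons.
case: (leqP M n) => Mn; last first.
  rewrite expr0n /= mulr0 addr0; apply: (le_trans IH).
  by rewrite (maxn_idPl (ltnW Mn)) (maxn_idPl Mn).
rewrite (maxn_idPr (leqW Mn)); apply: le_trans (lerD IH (lexx _)) _.
rewrite (maxn_idPr Mn) sqr_sqrtr ?sqrtr_ge0// -/(r n.+1).
have p := digit_prob_le n (past_bound R w).
have E1 : r n ^+ 2 = n.+1%:R by rewrite sqr_sqrtr.
have E2 : r n.+1 ^+ 2 = n.+2%:R by rewrite sqr_sqrtr.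
have E3 : r n.+1 ^+ 2 = r n ^+ 2 + 1 by rewrite E1 E2 natr1.
have r1 : 1 <= r n ^+ 2 by rewrite E1 ler1n.
have a0 := r0 n; have b0 := r0 n.+1.
have := ler_wpM2r (ltW b0) p; rewrite -E1 -E2.
move: E3 r1 a0 b0; set a := r n; set b := r n.+1 => E3 r1 a0 b0 h.
rewrite -lerBrDl; apply: (le_trans h).
have -> : 6 / r M - 6 / b - (6 / r M - 6 / a) = 6 * (b - a) / (a * b).
  by field; rewrite !lt0r_neq0.
have -> : 2 / (a ^+ 2 * b ^+ 2) * b = 2 / a / (a * b).
  by field; rewrite !lt0r_neq0.
rewrite ler_wpM2r ?invr_ge0 ?mulr_ge0 ?(ltW a0) ?(ltW b0)//.
rewrite ler_pdivrMr//.
have ba : b <= 2 * a by rewrite -(ler_pXn2r (n := 2)) ?nnegrE ?mulr_ge0 ?(ltW b0) ?(ltW a0)// exprMn E3; nra.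
have : (b - a) * (b + a) = 1 by have := E3; rewrite !expr2; lra.
by nra.
Qed.

Lemma quartic_tail_avg M e : 0 < e -> ae_slope (fun alpha => \forall n \near \oo,
  avg (fun i => quartic_tail M (word alpha i.+1)) n <= 6 / Num.sqrt M.+1%:R + e).
Proof.
move=> e0; apply: ae_slopeW (strong_law (quartic_tail_ge0 M) (quartic_tail_moment M)).
move=> alpha _ /cvgr0Pnorm_le/(_ _ e0); apply: filterS => n.
rewrite avgB => /(le_trans (ler_norm _)); rewrite lerBlDl => /le_trans; apply.
rewrite lerD2r; apply: le_trans (ler_norm _) _; apply: avg_bounded.
  by rewrite divr_ge0// sqrtr_ge0.
move=> i; apply: dmean_norm_le (past_ge0 R _) _ => k.
apply: le_trans (quartic_tail_moment M (word alpha i) k).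
apply: ler_dsum (past_ge0 R _) _ => a; rewrite ger0_norm ?quartic_tail_ge0//.
rewrite /quartic_tail last_rcons; case: ifP => _; last by rewrite expr0n.
have r1 (t : R) : 1 <= t -> 1 <= Num.sqrt t.
  by move=> t1; rewrite -[X in X <= _]sqrtr1 ler_wsqrtr.
rewrite expr2 ler_peMr ?sqrtr_ge0//.
by apply: (r1 _ (r1 _ _)); rewrite ler1n.
Qed.

Lemma ln_le_quartic a : ln (a.+2%:R : R) <= 4 * Num.sqrt (Num.sqrt a.+2%:R).
Proof.
set t := Num.sqrt (Num.sqrt _); have t0 : 0 < t by rewrite !sqrtr_gt0.
have -> : a.+2%:R = t ^+ 4.
  by rewrite (exprM t 2 2) sqr_sqrtr ?sqrtr_ge0// sqr_sqrtr.
by rewrite lnXn// -[leLHS]mulr_natl ler_pM2l// ltW// ln_sublinear.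
Qed.

Definition cf_value w z : R := foldr (fun a z => branch a z) z w.

Lemma cf_value_bound w z : 0 <= z <= 1 -> 0 <= cf_value w z <= 1.
Proof. by move=> z01; elim: w => //= a w IH; exact: branch_bound. Qed.

(** The branch of digit 1 has derivative -1 at 0, so a uniform contraction needs two branches
    together. *)
Lemma branch2_dist a b y z : 0 <= y -> 0 <= z ->
  `|branch a (branch b y) - branch a (branch b z)| <= `|y - z| / 4.
Proof.
move=> y0 z0; rewrite /branch.
have a1 : 1 <= a.+1%:R :> R by rewrite ler1n.
have b1 : 1 <= b.+1%:R :> R by rewrite ler1n.
set p : R := a.+1%:R in a1 *; set q : R := b.+1%:R in b1 *.
have h1 : 2 <= p * (q + y) + 1 by nra.
have h2 : 2 <= p * (q + z) + 1 by nra.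
have -> : (p + (q + y)^-1)^-1 - (p + (q + z)^-1)^-1 =
  (y - z) * ((p * (q + y) + 1) * (p * (q + z) + 1))^-1.
  by field; rewrite !lt0r_neq0//; lra.
rewrite normrM ler_wpM2l// ger0_norm ?invr_ge0; last by nra.
by rewrite lef_pV2 ?posrE; nra.
Qed.

Lemma cf_value_dist m w y z : 0 <= y <= 1 -> 0 <= z <= 1 -> size w = m.*2 ->
  `|cf_value w y - cf_value w z| <= 4^-1 ^+ m.
Proof.
move=> y01 z01; elim: m w => [|m IH] [|a [|b w]] //=.
  move=> _; rewrite expr0 ler_norml.
  by case/andP: y01 => *; case/andP: z01 => *; apply/andP; split; lra.
move=> [] /IH h; rewrite exprSr.
have /andP[u0 _] := cf_value_bound w y01.
have /andP[v0 _] := cf_value_bound w z01.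
apply: le_trans (branch2_dist a b u0 v0) _.
by rewrite ler_wpM2r// invr_ge0.
Qed.

Lemma gauss_iter_cf_value alpha i k : regular alpha ->
  gauss_iter alpha i =
    cf_value (map (digit alpha) (iota i k)) (gauss_iter alpha (i + k)).
Proof.
move=> ra; elim: k i => [|k IH] i; first by rewrite addn0.
by rewrite (gauss_iterS i ra) (IH i.+1) addSnnS.
Qed.

Lemma sum_shift_dist (f : nat -> R) B K n : 0 <= B -> (forall i, `|f i| <= B) ->
  `|\sum_(i < n) f (i + K)%N - \sum_(i < n) f i| <= K%:R * (2 * B).
Proof.
move=> B0 fB; elim: K => [|K IH].
  rewrite mul0r; under eq_bigr do rewrite addn0.
  by rewrite subrr normr0.
apply: le_trans (ler_distD (\sum_(i < n) f (i + K)%N) _ _) _.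
rewrite -natr1 mulrDl mul1r addrC; apply: lerD => //.
have : \sum_(i < n.+1) f (i + K)%N = \sum_(i < n.+1) f (i + K)%N by [].
rewrite {1}big_ord_recl big_ord_recr /= => E.
have -> : \sum_(i < n) f (i + K.+1)%N - \sum_(i < n) f (i + K)%N = f (n + K)%N - f (0 + K)%N.
  under [X in X - _]eq_bigr do rewrite -addSnnS.
  by move: E; rewrite /bump /=; under [X in _ + X = _]eq_bigr do rewrite add1n; lra.
by apply: le_trans (ler_normB _ _) _; have := fB (n + K)%N; have := fB (0 + K)%N; lra.
Qed.

Lemma window_fun_word s m psi alpha i :
  window_fun s m psi (word alpha (i + m)) =
    s ^+ (i + m) * psi (map (digit alpha) (iota i m)) (past R (word alpha i)).
Proof.
rewrite /window_fun size_word leq_addl addnK; congr (_ * psi _ (past R _)).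
  by rewrite /word /mkseq -map_drop drop_iota addKn add0n.
by rewrite /word /mkseq -map_take take_iota minnC (minn_idPr (leq_addr _ _)).
Qed.

Definition unit_itv x : Prop := 0 <= x <= 1.

(** The constant may depend on the digit: only finitely many digits are treated through it, the
    others through [quartic_tail]. *)
Definition slot_lipschitz G : Prop := forall a, exists L, 0 <= L /\
  forall x x' y y', unit_itv x -> unit_itv x' -> unit_itv y -> unit_itv y' ->
  `|G a x y - G a x' y'| <= L * (`|x - x'| + `|y - y'|).

(** For digits below [M] the next Gauss iterate is replaced by a continued fraction of [m.*2]
    digits, and the result is a window function read [K] steps later. Terms with larger digits are
    dropped, the loss being majorized by [quartic_tail]. *)
Lemma erg_observable s G B : s = 1 \/ s = -1 -> 0 <= B ->
  (forall a x y, unit_itv x -> unit_itv y -> `|G a x y| <= B * ln a.+2%:R) ->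
  slot_lipschitz G ->
  erg (fun alpha i => s ^+ i *
    G (digit alpha i) (gauss_iter alpha i.+1) (past R (word alpha i))).
Proof.
move=> hs B0 GB /choice[L hL].
have ns i : `|s ^+ i| = 1.
  by rewrite normrX; case: hs => ->; rewrite ?normrN normr1 expr1n.
have ss i : s ^+ i * s ^+ i = 1.
  by rewrite -exprD addnn -mul2n exprM; case: hs => ->; rewrite ?sqrrN expr1n expr1n.
apply: erg_approx => e e0.
have e4 : 0 < e / 4 by rewrite divr_gt0.
(* Four quarters of [e] are spent: on the mean of the large digits, as here, on its fluctuation, on
   the truncation of the iterate and on the delay. *)
have [M hM] : exists M : nat, 4 * B * (6 / Num.sqrt M.+1%:R) <= e / 4.
  have q0 : 0 <= 96 * B / e by rewrite divr_ge0 ?mulr_ge0 ?(ltW e0).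
  exists (Num.truncn ((96 * B / e) ^+ 2)).
  set r := Num.sqrt _; have r0 : 0 < r by rewrite sqrtr_gt0.
  have : 96 * B / e <= r.
    rewrite -(ler_pXn2r (n := 2)) ?nnegrE ?(ltW r0)// sqr_sqrtr//.
    exact/ltW/truncnS_gt.
  rewrite ler_pdivrMr// => h.
  rewrite mulrA ler_pdivrMr//; lra.
pose CM := \sum_(a < M) L a.
have CM0 : 0 <= CM by apply: sumr_ge0 => a _; have [] := hL a.
have LCM a : (a < M)%N -> L a <= CM.
  move=> aM; rewrite /CM (bigD1 (Ordinal aM)) //= lerDl.
  by apply: sumr_ge0 => b _; have [] := hL b.
have [m hm] : exists m : nat, CM * 4^-1 ^+ m <= e / 4.
  have : CM * (4^-1 : R) ^+ j @[j --> \oo] --> (0 : R).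
    rewrite -(mulr0 CM); apply: cvgM; first exact: cvg_cst.
    by apply: cvg_expr; rewrite ger0_norm; lra.
  move=> /cvgr0Pnorm_le/(_ _ e4)[j _ /(_ j (leqnn j))] hj; exists j.
  by apply: le_trans hj; exact: ler_norm.
(* One digit for [a] and [m.*2] for the iterate after it. The window read at time [i + K] carries
   [s ^+ (i + K)], so [psi] contains another [s ^+ K] to restore [s ^+ i]. *)
pose K := m.*2.+1.
pose psi (v : seq nat) y : R := if v is a :: v' then
   if (a < M)%N then s ^+ K * G a (cf_value v' 0) y else 0 else 0.
have u0 : unit_itv 0 by rewrite /unit_itv lexx ler01.
pose B' := B * ln M.+1%:R.
have B'0 : 0 <= B' by rewrite mulr_ge0// ln_ge0// ler1n.
have pB v y : 0 <= y <= 1 -> `|psi v y| <= B'.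
  move=> y01; case: v => [|a v] /=; first by rewrite normr0.
  case: ifP => aM; last by rewrite normr0.
  rewrite normrM ns mul1r; apply: le_trans (GB _ _ _ (cf_value_bound v u0) y01) _.
  by rewrite ler_wpM2l// ler_ln ?posrE// ler_nat.
have pL v : lipschitz01 CM (psi v).
  move=> y z y01 z01; case: v => [|a v] /=; first by rewrite subrr normr0 mulr_ge0.
  case: ifP => aM; last by rewrite subrr normr0 mulr_ge0.
  have c01 := cf_value_bound v u0.
  rewrite -mulrBr normrM ns mul1r; have [La0 h] := hL a.
  apply: le_trans (h _ _ _ _ c01 c01 y01 z01) _.
  by rewrite subrr normr0 add0r ler_wpM2r// LCM.
exists (fun alpha i => window_fun s K psi (word alpha i)); split.
  exact: erg_window hs B'0 CM0 pB pL.
have e' : 0 < e / (16 * B + 1) by rewrite divr_gt0// ltr_wpDl// mulr_ge0.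
apply: ae_slopeW (quartic_tail_avg M e') => alpha ra hq.
pose f i := window_fun s K psi (word alpha i).
have fB i : `|f i| <= B'.
  rewrite /f /window_fun; case: ifP => _; last by rewrite normr0.
  by rewrite normrM ns mul1r; apply: pB; exact: past_bound.
have hsh : \forall n \near \oo, `|n%:R^-1 * (\sum_(i < n) f (i + K)%N - \sum_(i < n) f i)| <= e / 4.
  have := cvg_bounded_avg (fun n => sum_shift_dist K n B'0 fB).
  by move/cvgr0Pnorm_le/(_ _ e4).
have pt i : `|s ^+ i * G (digit alpha i) (gauss_iter alpha i.+1) (past R (word alpha i))
    - f (i + K)%N| <= CM * 4^-1 ^+ m + 4 * B * quartic_tail M (word alpha i.+1).
  rewrite /f window_fun_word /K /= exprD -mulrA -mulrBr normrM ns mul1r /quartic_tail.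
  rewrite wordS last_rcons.
  have p01 := past_bound R (word alpha i).
  have x01 k : unit_itv (gauss_iter alpha k).
    by have /andP[? ?] := gauss_iter_bound k ra; rewrite /unit_itv !ltW.
  case: (ltnP (digit alpha i) M) => aM.
    rewrite mulr0 addr0 mulrA -exprD -/K exprD ss mul1r.
    have [La0 h] := hL (digit alpha i).
    have c01 := cf_value_bound (map (digit alpha) (iota i.+1 m.*2)) u0.
    apply: le_trans (h _ _ _ _ (x01 i.+1) c01 p01 p01) _.
    rewrite subrr normr0 addr0 (gauss_iter_cf_value i.+1 m.*2 ra).
    apply: ler_pM => //; first exact: LCM.
    by apply: cf_value_dist => //; [exact: x01|rewrite size_map size_iota].
  rewrite mulr0 subr0; apply: le_trans (GB _ _ _ (x01 i.+1) p01) _.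
  apply: ler_wpDl; first by rewrite mulr_ge0// exprn_ge0.
  by rewrite (mulrC 4) -mulrA ler_wpM2l// ln_le_quartic.
near=> n.
have h1 := avg_norm_le n pt.
rewrite avgB avgD avgZ in h1.
have h2 : n%:R^-1 * (\sum_(i < n) f (i + K)%N - \sum_(i < n) f i) =
    avg (fun i => f (i + K)%N) n - avg f n by rewrite mulrBr.
have h3 : `|avg (fun i => f (i + K)%N) n - avg f n| <= e / 4.
  by rewrite -h2; near: n.
apply: le_trans (ler_distD (avg (fun i => f (i + K)%N) n) _ _) _.
apply: le_trans (lerD h1 h3) _.
have h4 : avg (fun=> CM * 4^-1 ^+ m) n <= e / 4.
  by apply: le_trans (avg_cst_le n _) hm; rewrite mulr_ge0// exprn_ge0.
have h5 : avg (fun i => quartic_tail M (word alpha i.+1)) n <=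
   6 / Num.sqrt M.+1%:R + e / (16 * B + 1) by near: n.
have h6 : 4 * B * (e / (16 * B + 1)) <= e / 4.
  rewrite mulrA ler_pdivrMr; last by lra.
  by nra.
have B4 : 0 <= 4 * B by rewrite mulr_ge0.
have := ler_wpM2l B4 h5; rewrite mulrDr; lra.
Unshelve. all: by end_near. Qed.

End Observables.

(** * Integrals over one window of scales *)

Section AffineSubstitution.
Variable R : realType.
Local Notation mu := (@lebesgue_measure R).
Implicit Types (f : R -> R) (p q : R).

Lemma lipschitz_within_continuous f (A : set R) (L : R) :
  (forall x y, A x -> A y -> `|f x - f y| <= L * `|x - y|) ->
  {within A, continuous f}.
Proof.
move=> fL; apply/subspace_continuousP => x Ax; apply/cvgrPdist_le => e e0.
have L0 : 0 < `|L| + 1 by rewrite ltr_wpDl.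
rewrite near_withinE; near=> y => Ay.
apply: le_trans (fL _ _ Ax Ay) _.
apply: (@le_trans _ _ ((`|L| + 1) * `|x - y|)).
  by rewrite ler_wpM2r//; apply: le_trans (ler_norm _) _; rewrite lerDl.
rewrite mulrC -ler_pdivlMr//; near: y.
by apply: (@cvgr_dist_le _ _ _ (nbhs x) _ id); [exact: cvg_id|exact: divr_gt0].
Unshelve. all: by end_near. Qed.

Lemma segment_integrable f p q : {within `[p, q], continuous f} ->
  mu.-integrable `[p, q] (EFin \o f).
Proof. by move=> cf; apply: continuous_compact_integrable => //; exact: segment_compact. Qed.

Lemma Rintegral_affine f p q : p < q -> {within `[p, q], continuous f} ->
  \int[mu]_(x in `[p, q]) f x = \int[mu]_(s in `[0, 1]) (f (p + s * (q - p)) * (q - p)).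
Proof.
move=> pq cf; pose F (s : R) := p + s * (q - p).
have dF (s : R) : is_derive s 1 F (q - p).
  rewrite /F; apply: is_derive_eq.
  by rewrite add0r scaler0 add0r mul1r -[LHS]/((q - p) * 1) mulr1.
have dFE : derive1 F = fun=> q - p.
  by apply/funext => s; rewrite derive1E; exact: derive_val.
have F0 : F 0 = p by rewrite /F mul0r addr0.
have F1 : F 1 = q by rewrite /F mul1r addrC subrK.
rewrite /Rintegral; congr fine; rewrite -{1}F0 -{1}F1.
rewrite (@integration_by_substitution_increasing _ F f 0 1)//.
- by apply: eq_integral => s _ /=; rewrite fctE /= dFE.
- by move=> x y _ _ xy; rewrite /F ltrD2l ltr_pM2r// subr_gt0.
- by move=> x _; rewrite dFE; exact: cvg_cst.
- by rewrite dFE; exact: is_cvg_cst.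
- by rewrite dFE; exact: is_cvg_cst.
- have cF x : {for x, continuous F} by apply: differentiable_continuous; apply/derivable1_diffP; case: (dF x).
  split; first by move=> x _; case: (dF x).
  + by apply: cvg_at_right_filter; exact: cF.
  + by apply: cvg_at_left_filter; exact: cF.
- by rewrite F0 F1.
Qed.

Lemma Rintegral_inv p q : 0 < p -> p <= q ->
  \int[mu]_(x in `[p, q]) x^-1 = ln q - ln p.
Proof.
move=> p0; rewrite le_eqVlt => /predU1P[<-|pq].
  by rewrite set_itv1 Rintegral_set1 subrr.
have pos x : x \in `[p, q] -> 0 < x.
  by rewrite in_itv /= => /andP[px _]; exact: lt_le_trans px.
have dl x : x \in `[p, q] -> is_derive x 1 (@ln R) x^-1.
  by move=> /pos x0; exact: is_derive1_ln.
rewrite /Rintegral (@continuous_FTC2 _ _ (@ln R))//.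
- apply: continuous_in_subspaceT => x; rewrite inE => /pos x0.
  by apply: cvgV; [exact: lt0r_neq0|exact: cvg_id].
- split.
  + by move=> x /subset_itv_oo_cc/dl[].
  + by apply: cvg_at_right_filter; exact: continuous_ln.
  + by apply: cvg_at_left_filter; apply: continuous_ln; exact: lt_trans pq.
- by move=> x /subset_itv_oo_cc/dl ?; rewrite derive1E; exact: derive_val.
Qed.

End AffineSubstitution.

(** * The contribution of one window of scales *)

Section SlotIntegral.
Variable R : realType.
Local Notation mu := (@lebesgue_measure R).
Implicit Types (Phi : R -> R -> R -> R) (a j : nat) (s t w x y B L : R).

(* The values A, B, Q at the scale [t * d_{n+1}], when [x], [y] and [a] describe
   the continued fraction at step [n] and [x + j <= t < x + j + 1]. *)
Definition slot_value Phi a j t x y : R :=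
  Phi (1 - t^-1) (1 - (x + j%:R) / t) (t / (a.+1%:R + x + y)).

(** A window is 1 <= t < a + 1 + x, and the floor in B jumps at the points x + j; cut off at 1, only
    the first piece can be short. *)
Definition piece_start j x : R := if j is 0%N then 1 else x + j%:R.
Definition piece_len j x : R := if j is 0%N then x else 1.
Definition piece_pt j s x : R := piece_start j x + s * piece_len j x.

(** The integral against dt / t, transported to [0, 1] so that the domain no longer moves with [x];
    regularity in [x] and [y] can then be read off the integrand. *)
Definition piece Phi a j x y : R := \int[mu]_(s in `[0, 1])
  (slot_value Phi a j (piece_pt j s x) x y * (piece_len j x / piece_pt j s x)).

Definition slot_integral Phi a x y : R := \sum_(j < a.+1) piece Phi a j x y.

Definition bounded3 B Phi : Prop := forall u v z : R, `|Phi u v z| <= B.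
Definition lipschitz3 L Phi : Prop := forall u v z u' v' z' : R,
  `|Phi u v z - Phi u' v' z'| <= L * (`|u - u'| + `|v - v'| + `|z - z'|).

Lemma piece_end j x : piece_start j x + piece_len j x = x + j.+1%:R.
Proof. by case: j => [|j] /=; [rewrite addrC|rewrite -addrA natr1]. Qed.

Lemma piece_start_ge1 j x : unit_itv x -> 1 <= piece_start j x.
Proof.
move=> /andP[x0 _]; case: j => [|j] /=; first exact: lexx.
by rewrite -natr1; have := ler0n R j; lra.
Qed.

Lemma piece_start_ge j x : unit_itv x -> x + j%:R <= piece_start j x.
Proof. by move=> /andP[_ x1]; case: j => [|j] //=; rewrite addr0. Qed.

Lemma piece_len_bound j x : unit_itv x -> 0 <= piece_len j x <= 1.
Proof. by move=> x01; case: j => //= _; rewrite ler01 lexx. Qed.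

Lemma piece_pt_bound j s x : unit_itv s -> unit_itv x ->
  piece_start j x <= piece_pt j s x <= x + j.+1%:R.
Proof.
move=> /andP[s0 s1] x01; have /andP[l0 l1] := piece_len_bound j x01.
by rewrite /piece_pt -piece_end; apply/andP; split; nra.
Qed.

Lemma inv_dist t t' : 1 <= t -> 1 <= t' -> `|t^-1 - t'^-1| <= `|t - t'|.
Proof.
move=> t1 t'1; have -> : t^-1 - t'^-1 = (t' - t) * (t * t')^-1.
  by field; rewrite !lt0r_neq0//; lra.
rewrite normrM distrC ler_piMr// ger0_norm ?invr_ge0; last by nra.
by rewrite invf_le1; nra.
Qed.

Lemma div_dist w w' t t' k : 0 <= w' <= k -> 1 <= t -> 1 <= t' ->
  `|w / t - w' / t'| <= `|w - w'| + k * `|t - t'|.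
Proof.
move=> /andP[w0 wk] t1 t'1.
have -> : w / t - w' / t' = (w - w') / t + w' * (t^-1 - t'^-1) by ring.
apply: le_trans (ler_normD _ _) _; rewrite !normrM; apply: lerD.
  rewrite ler_piMr// ger0_norm ?invr_ge0; last by lra.
  by rewrite invf_le1; lra.
by rewrite ger0_norm//; apply: ler_pM => //; exact: inv_dist.
Qed.

Lemma slot_value_dist Phi a j t t' x x' y y' L : lipschitz3 L Phi -> 0 <= L ->
  (j <= a)%N -> 1 <= t <= a.+2%:R -> 1 <= t' <= a.+2%:R ->
  unit_itv x -> unit_itv x' -> unit_itv y -> unit_itv y' ->
  `|slot_value Phi a j t x y - slot_value Phi a j t' x' y'|
    <= L * a.+3%:R * (`|t - t'| + `|x - x'| + `|y - y'|).
Proof.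
move=> PL L0 ja /andP[t1 ta] /andP[t'1 t'a] /andP[x0 x1] /andP[x'0 x'1].
move=> /andP[y0 y1] /andP[y'0 y'1].
apply: le_trans (PL _ _ _ _ _ _) _; rewrite -mulrA ler_wpM2l//.
have jR : j%:R <= a%:R :> R by rewrite ler_nat.
have j0 : 0 <= j%:R :> R by [].
move: ta t'a; rewrite -!(natr1 a.+2) -!(natr1 a.+1) -!(natr1 a) => ta t'a.
move: jR ta t'a; set n : R := a%:R; set m : R := j%:R in j0 * => jR ta t'a.
have H1 : `|1 - t^-1 - (1 - t'^-1)| <= `|t - t'|.
  by rewrite opprB addrC addrA subrK distrC; exact: inv_dist.
have H2 : `|1 - (x + m) / t - (1 - (x' + m) / t')| <= `|x - x'| + (n + 1) * `|t - t'|.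
  rewrite opprB addrC addrA subrK distrC.
  have -> : x - x' = (x + m) - (x' + m) by ring.
  by apply: div_dist => //; apply/andP; split; lra.
have H3 : `|t / (n + 1 + x + y) - t' / (n + 1 + x' + y')| <=
    `|t - t'| + (n + 2) * (`|x - x'| + `|y - y'|).
  apply: le_trans (@div_dist _ _ _ _ (n + 2) _ _ _) _; [|lra|lra|].
    by apply/andP; split; lra.
  rewrite lerD2l ler_wpM2l//; first lra.
  have -> : n + 1 + x + y - (n + 1 + x' + y') = (x - x') + (y - y') by ring.
  exact: ler_normD.
have := normr_ge0 (t - t'); have := normr_ge0 (x - x'); have := normr_ge0 (y - y').
nra.
Qed.

Lemma slot_density_dist Phi a j t t' w w' x x' y y' L B :
  lipschitz3 L Phi -> 0 <= L -> bounded3 B Phi -> 0 <= B ->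
  (j <= a)%N -> 1 <= t <= a.+2%:R -> 1 <= t' <= a.+2%:R ->
  0 <= w <= 1 -> 0 <= w' <= 1 ->
  unit_itv x -> unit_itv x' -> unit_itv y -> unit_itv y' ->
  `|slot_value Phi a j t x y * (w / t) - slot_value Phi a j t' x' y' * (w' / t')|
    <= (L * a.+3%:R + B) * (`|t - t'| + `|w - w'| + `|x - x'| + `|y - y'|).
Proof.
move=> PL L0 PB B0 ja ht ht' hw hw' hx hx' hy hy'.
have H1 := slot_value_dist PL L0 ja ht ht' hx hx' hy hy'.
have /andP[t1 _] := ht; have /andP[t'1 _] := ht'; have /andP[w0 w1] := hw.
have H2 := div_dist w hw' t1 t'1; rewrite mul1r in H2.
set p := slot_value _ _ _ t _ _ in H1 *; set p' := slot_value _ _ _ t' _ _ in H1 *.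
have -> : p * (w / t) - p' * (w' / t') = (p - p') * (w / t) + p' * (w / t - w' / t') by ring.
apply: le_trans (ler_normD _ _) _; rewrite !normrM.
have H3 : `|p'| <= B by exact: PB.
have H4 : `|w| * `|t^-1| <= 1.
  rewrite -normrM ger0_norm; last by rewrite divr_ge0//; lra.
  by rewrite ler_pdivrMr; lra.
have H5 : `|p - p'| * (`|w| * `|t^-1|) <= `|p - p'| by rewrite ler_piMr.
have H6 := ler_pM (normr_ge0 p') (normr_ge0 (w / t - w' / t')) H3 H2.
have Z : 0 <= L * a.+3%:R by rewrite mulr_ge0.
have := normr_ge0 (t - t'); have := normr_ge0 (x - x'); have := normr_ge0 (y - y').
have := normr_ge0 (w - w'); nra.
Qed.

Lemma piece_pt_itv a j s x : (j <= a)%N -> unit_itv s -> unit_itv x ->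
  1 <= piece_pt j s x <= a.+2%:R.
Proof.
move=> ja s01 x01; have /andP[h1 h2] := piece_pt_bound j s01 x01.
rewrite (le_trans (piece_start_ge1 j x01) h1) /=; apply: (le_trans h2).
rewrite -(natr1 a.+1); have /andP[_ x1] := x01.
have : j.+1%:R <= a.+1%:R :> R by rewrite ler_nat.
by lra.
Qed.

Lemma piece_start_dist j x x' : `|piece_start j x - piece_start j x'| <= `|x - x'|.
Proof.
case: j => [|j] /=; first by rewrite subrr normr0.
by rewrite opprD addrACA subrr addr0.
Qed.

Lemma piece_len_dist j x x' : `|piece_len j x - piece_len j x'| <= `|x - x'|.
Proof. by case: j => [|j] //=; rewrite subrr normr0. Qed.

Section Bounds.
Variables (Phi : R -> R -> R -> R) (L B : R).
Hypotheses (PL : lipschitz3 L Phi) (L0 : 0 <= L) (PB : bounded3 B Phi) (B0 : 0 <= B).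

Lemma piece_continuous a j x y : (j <= a)%N -> unit_itv x -> unit_itv y ->
  {within `[0, 1], continuous (fun s =>
    slot_value Phi a j (piece_pt j s x) x y * (piece_len j x / piece_pt j s x))}.
Proof.
move=> ja x01 y01; apply: (@lipschitz_within_continuous _ _ _ (L * a.+3%:R + B)).
move=> s s'; rewrite /= !in_itv /= => s01 s'01.
have ll := piece_len_bound j x01.
apply: le_trans (slot_density_dist PL L0 PB B0 ja (piece_pt_itv ja s01 x01)
  (piece_pt_itv ja s'01 x01) ll ll x01 x01 y01 y01) _.
rewrite !subrr normr0 !addr0 ler_wpM2l//; first by rewrite addr_ge0// mulr_ge0.
rewrite /piece_pt opprD addrACA subrr add0r -mulrBl normrM ler_piMr//.
by case/andP: ll => l0 l1; rewrite ger0_norm.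
Qed.

(** The 4 collects how the data move with [x]: [piece_pt] by at most twice the displacement,
    [piece_len] and [x] itself by at most once. *)
Lemma piece_dist a j x x' y y' : (j <= a)%N ->
  unit_itv x -> unit_itv x' -> unit_itv y -> unit_itv y' ->
  `|piece Phi a j x y - piece Phi a j x' y'|
    <= (L * a.+3%:R + B) * 4 * (`|x - x'| + `|y - y'|).
Proof.
move=> ja x01 x'01 y01 y'01; rewrite /piece.
have i1 := segment_integrable (piece_continuous ja x01 y01).
have i2 := segment_integrable (piece_continuous ja x'01 y'01).
move: i1 i2; set f := (fun s => slot_value _ _ _ (piece_pt j s x) _ _ * _).
set g := (fun s => slot_value _ _ _ (piece_pt j s x') _ _ * _) => i1 i2.
have i12 : mu.-integrable `[0, 1] (EFin \o (fun s => f s - g s)).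
  by apply: (eq_integrable _ _ _ _ (integrableB _ i1 i2)).
rewrite -RintegralB//.
apply: le_trans (le_normr_Rintegral _ i12) _ => //.
set C := _ * 4 * _.
have mI : fine (mu (`[0, 1]%classic : set R)) = 1.
  by rewrite lebesgue_measure_itv /= lte_fin ltr01 /= oppr0 addr0.
have -> : C = \int[mu]_(_ in `[0, 1]) C by rewrite Rintegral_cst// mI mulr1.
apply: le_Rintegral => //.
- exact: integrable_norm.
- apply: segment_integrable; apply: continuous_subspaceT => s; exact: cvg_cst.
move=> s; rewrite /= in_itv /= => s01.
apply: le_trans (slot_density_dist PL L0 PB B0 ja (piece_pt_itv ja s01 x01)
  (piece_pt_itv ja s01 x'01) (piece_len_bound j x01) (piece_len_bound j x'01)
  x01 x'01 y01 y'01) _.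
rewrite /C -mulrA ler_wpM2l//; first by rewrite addr_ge0// mulr_ge0.
have h1 := piece_len_dist j x x'; have h2 := piece_start_dist j x x'.
have h3 : `|piece_pt j s x - piece_pt j s x'| <= 2 * `|x - x'|.
  rewrite /piece_pt opprD addrACA -mulrBr; apply: le_trans (ler_normD _ _) _.
  rewrite normrM; case/andP: s01 => s0 s1; rewrite (ger0_norm s0).
  have := normr_ge0 (piece_len j x - piece_len j x'); nra.
by have := normr_ge0 (y - y'); lra.
Qed.

Lemma piece_bound a j x y : (j <= a)%N -> unit_itv x -> unit_itv y ->
  `|piece Phi a j x y| <= B * (ln (x + j.+1%:R) - ln (piece_start j x)).
Proof.
move=> ja x01 y01; rewrite /piece.
have i1 := segment_integrable (piece_continuous ja x01 y01).
apply: le_trans (le_normr_Rintegral _ _) _ => //.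
have p1 := piece_start_ge1 j x01; have /andP[l0 l1] := piece_len_bound j x01.
(* At [x = 0] the first piece degenerates to a point, and the affine substitution requires a proper
   interval. *)
have [l00|ln0] := eqVneq (piece_len j x) 0.
  rewrite -piece_end l00 addr0 subrr mulr0.
  rewrite (_ : (fun s => _) = fun=> 0) ?Rintegral_cst ?mul0r//.
  by apply/funext => s; rewrite mul0r mulr0 normr0.
have lpos : 0 < piece_len j x by rewrite lt_def ln0.
have lt : piece_start j x < x + j.+1%:R by rewrite -piece_end ltrDl.
have cinv : {within `[piece_start j x, x + j.+1%:R], continuous (fun t : R => t^-1)}.
  apply: continuous_in_subspaceT => t; rewrite inE /= in_itv /= => /andP[pt _].
  by apply: cvgV; [apply: lt0r_neq0; lra|exact: cvg_id].
have p0 : 0 < piece_start j x by lra.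
rewrite -(Rintegral_inv p0 (ltW lt)) (Rintegral_affine lt cinv).
have E : x + j.+1%:R - piece_start j x = piece_len j x by rewrite -piece_end; ring.
rewrite E.
have cw : {within `[0, 1], continuous (fun s => (piece_pt j s x)^-1 * piece_len j x)}.
  apply: continuous_in_subspaceT => s; rewrite inE /= in_itv /= => s01.
  have /andP[h _] := piece_pt_bound j s01 x01.
  apply: cvgM; last exact: cvg_cst.
  apply: cvgV; first by apply: lt0r_neq0; lra.
  apply: cvgD; first exact: cvg_cst.
  by apply: cvgM; [exact: cvg_id|exact: cvg_cst].
have iw := segment_integrable cw.
rewrite -RintegralZl//; apply: le_Rintegral => //.
- exact: integrable_norm.
- exact: (integrableZl _ B iw).
move=> s; rewrite /= in_itv /= => s01.
have /andP[h _] := piece_pt_bound j s01 x01.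
rewrite normrM -/(piece_pt j s x) (mulrC (_^-1)); apply: ler_pM => //; first exact: PB.
by rewrite ger0_norm//; apply: divr_ge0; lra.
Qed.

(** Each piece ends where the next begins, so the logarithms telescope from ln 1 to ln (x + a +
    1). *)
Lemma slot_integral_bound a x y : unit_itv x -> unit_itv y ->
  `|slot_integral Phi a x y| <= B * ln a.+2%:R.
Proof.
move=> x01 y01; have /andP[x0 x1] := x01.
apply: le_trans (ler_norm_sum _ _ _) _.
apply: (@le_trans _ _ (\sum_(j < a.+1) B * (ln (x + j.+1%:R) - ln (piece_start j x)))).
  by apply: ler_sum => j _; apply: piece_bound => //; rewrite -ltnS.
suff -> : forall n, \sum_(j < n.+1) B * (ln (x + j.+1%:R) - ln (piece_start j x))
    = B * ln (x + n.+1%:R).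
  have xa : 0 < x + a.+1%:R by rewrite ltr_wpDl.
  by rewrite ler_wpM2l// ler_ln ?posrE// -(natr1 a.+1) addrC lerD2l.
elim=> [|n IH]; first by rewrite big_ord_recl big_ord0 /= ln1 subr0 addr0.
by rewrite big_ord_recr /= IH -mulrDr addrCA subrr addr0.
Qed.

Lemma slot_integral_lipschitz : slot_lipschitz (slot_integral Phi).
Proof.
move=> a; exists (a.+1%:R * ((L * a.+3%:R + B) * 4)); split.
  by rewrite mulr_ge0// mulr_ge0// addr_ge0// mulr_ge0.
move=> x x' y y' x01 x'01 y01 y'01; rewrite /slot_integral -sumrB.
apply: le_trans (ler_norm_sum _ _ _) _.
apply: (@le_trans _ _ (\sum_(j < a.+1) (L * a.+3%:R + B) * 4 * (`|x - x'| + `|y - y'|))).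
  by apply: ler_sum => j _; apply: piece_dist => //; rewrite -ltnS.
by rewrite sumr_const card_ord -[leLHS]mulr_natl !mulrA.
Qed.

End Bounds.
End SlotIntegral.

(** * The observables at a given scale *)

Section PointwiseValues.
Variable R : realType.
Implicit Types (alpha e t x y : R) (w : R * R) (n j : nat).

Lemma cf_N_eq alpha e n : regular alpha ->
  cf_d alpha n.+1 <= e < cf_d alpha n -> cf_N alpha e = n.+1.
Proof.
move=> ra /andP[h1 h2]; rewrite /cf_N; case: pselect => [h|]; last first.
  by move=> /forallNP /(_ n.+1).
case: ex_minnP => m hm min; apply/eqP; rewrite eqn_leq min//= ltnNge.
apply/negP => mn; have dm : cf_d alpha n <= cf_d alpha m.
  by move: mn; rewrite leq_eqVlt => /predU1P[->//|/(cf_d_lt ra)/ltW].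
by have := lt_le_trans h2 (le_trans dm hm); rewrite ltxx.
Qed.

Lemma cf_N_0 alpha e : regular alpha -> 1 <= e -> cf_N alpha e = 0%N.
Proof.
move=> ra e1; rewrite /cf_N; case: pselect => // h.
case: ex_minnP => m _ /(_ 0%N); rewrite cf_d0// => /(_ e1).
by rewrite leqn0 => /eqP.
Qed.

Lemma cf_d_double alpha m : regular alpha -> cf_d alpha m.*2 <= 2^-1 ^+ m.
Proof.
move=> ra; elim: m => [|m IH]; first by rewrite cf_d0.
rewrite doubleS !cf_dS// -mulrA exprSr.
have /andP[x0 _] := gauss_iter_bound m.*2 ra.
have /andP[x1 _] := gauss_iter_bound m.*2.+1 ra.
apply: ler_pM => //; first exact/ltW/cf_d_gt0.
  by rewrite mulr_ge0// ltW.
exact: gauss_iter_pair.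
Qed.

Lemma cf_d_small alpha e : regular alpha -> 0 < e -> exists n, cf_d alpha n <= e.
Proof.
move=> ra e0; have : (2^-1 : R) ^+ j @[j --> \oo] --> (0 : R).
  by apply: cvg_expr; rewrite ger0_norm; lra.
move=> /cvgr0Pnorm_le/(_ _ e0)[j _ /(_ j (leqnn j))] hj; exists j.*2.
by apply: le_trans (cf_d_double j ra) (le_trans (ler_norm _) hj).
Qed.

Lemma slot_exists alpha e : regular alpha -> 0 < e < 1 ->
  exists n, cf_d alpha n.+1 <= e < cf_d alpha n.
Proof.
move=> ra /andP[e0 e1]; have [N hN] := cf_d_small ra e0.
elim: N hN => [|N IH hN]; first by rewrite cf_d0// leNgt e1.
have [/IH//|lt] := leP (cf_d alpha N) e.
by exists N; rewrite hN.
Qed.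

Lemma cf_d_slot alpha n : regular alpha -> cf_d alpha n =
  cf_d alpha n.+1 * ((digit alpha n).+1%:R + gauss_iter alpha n.+1).
Proof.
move=> ra; rewrite cf_dS// [in RHS](gauss_iterS n ra) -mulrA /branch mulVf ?mulr1//.
have /andP[x0 _] := gauss_iter_bound n.+1 ra.
by apply: lt0r_neq0; rewrite ltr_wpDr// ltW.
Qed.

Lemma piece_exists a t x : unit_itv x -> 1 <= t < a.+1%:R + x ->
  exists j, (j <= a)%N /\ piece_start j x <= t < x + j.+1%:R.
Proof.
move=> /andP[x0 x1] /andP[t1]; rewrite addrC; elim: a => [|a IH] ta.
  by exists 0%N; rewrite /= t1.
have [lt|ge] := ltP t (x + a.+1%:R).
  by have [j [ja h]] := IH lt; exists j; split=> //; exact: leqW.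
by exists a.+1; rewrite /= ge ta.
Qed.

(** Here N = n + 1, and with epsilon = t d_{n+1} the relation [cf_d_slot] expresses A and B through
    t, while Q comes from [cf_q_d]. *)
Lemma observable_slot w n j r : 0 < w.1 -> regular (alpha_of w) ->
  let alpha := alpha_of w in
  let x := gauss_iter alpha n.+1 in let y := past R (word alpha n) in
  let a := digit alpha n in let t := eps_of w r / cf_d alpha n.+1 in
  (j <= a)%N -> piece_start j x <= t < x + j.+1%:R ->
  [/\ Aw w r = 1 - t^-1, Bw w r = 1 - (x + j%:R) / t,
      Qw w r = t / (a.+1%:R + x + y) & sigmaw w r = (-1) ^+ n.+1].
Proof.
move=> w0 ra alpha x y a t ja /andP[tl tu].
have x01 : unit_itv x.
  by have /andP[? ?] := gauss_iter_bound n.+1 ra; rewrite /unit_itv !ltW.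
have /andP[x0 x1] := x01; have /andP[y0 y1] := past_bound R (word alpha n).
have d0 := cf_d_gt0 n.+1 ra; have dE := cf_d_slot n ra.
have t1 : 1 <= t := le_trans (piece_start_ge1 j x01) tl.
have eE : eps_of w r = t * cf_d alpha n.+1 by rewrite /t divfK// gt_eqF.
have jaR : j%:R <= a%:R :> R by rewrite ler_nat.
have NE : cf_N alpha (eps_of w r) = n.+1.
  apply: cf_N_eq => //; rewrite eE dE -/alpha -/a -/x; apply/andP; split.
    by rewrite ler_peMl// ltW.
  rewrite mulrC ltr_pM2l//; apply: (lt_le_trans tu).
  by rewrite addrC -(natr1 j) -(natr1 a); lra.
have E : cf_d alpha n / eps_of w r = (a.+1%:R + x) / t.
  by rewrite eE dE -/a -/x; field; rewrite !lt0r_neq0//; lra.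
have E1 : cf_d alpha n.+1 / eps_of w r = t^-1.
  by rewrite eE; field; rewrite !lt0r_neq0//; lra.
rewrite /Aw /Bw /Qw /sigmaw -/alpha NE /= E E1; split=> //.
- have -> : (eps_of w r - cf_d alpha n) / cf_d alpha n.+1 = t - (a.+1%:R + x).
    by rewrite eE dE -/a -/x; field; rewrite lt0r_neq0.
  (* The floor is negative because epsilon < d_n; its part [- a.+1] cancels the digit in d_n, which
     leaves only x + j in B. *)
  have -> : Num.floor (t - (a.+1%:R + x)) = j%:Z - a.+1%:Z.
    apply: floor_def; rewrite rmorphB rmorphD rmorphB /= -!pmulrn.
    have := piece_start_ge j x01; move: tu; rewrite -(natr1 j) -(natr1 a).
    by move=> *; apply/andP; split; lra.
  rewrite -[_ * _ / _]mulrA E1 rmorphB /= -!pmulrn -(natr1 a).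
  by field; rewrite lt0r_neq0//; lra.
- have := cf_q_d n ra; rewrite eE -mulrA -/alpha -/y => ->.
  by rewrite (gauss_iterS n ra) /branch invrK.
Qed.

(** Here N = 0 and [N.-1] is again 0, so B uses d_0 = 1 in both places; the floor is 0 as epsilon <
    2, and Q vanishes with q_0. These scales fill a fixed range of r and do not influence the
    limit. *)
Lemma observable_top w r : 0 < w.1 -> regular (alpha_of w) ->
  1 <= eps_of w r < 2 ->
  [/\ Aw w r = 1 - (eps_of w r)^-1, Bw w r = 1 - (eps_of w r)^-1,
      Qw w r = 0 & sigmaw w r = 1].
Proof.
move=> w0 ra /andP[e1 e2]; rewrite /Aw /Bw /Qw /sigmaw cf_N_0//= cf_d0// div1r.
split=> //; last by rewrite /cf_q /= mulr0.
rewrite (floor_def (m := 0)); first by rewrite !mul0r subr0.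
by rewrite divr1 /=; apply/andP; split; lra.
Qed.

Lemma observable_in_K w r : 2^-1 < w.1 -> regular (alpha_of w) -> 0 < r <= 2^-1 ->
  Kset (Aw w r, Bw w r, Qw w r, sigmaw w r).
Proof.
move=> w2 ra /andP[r0 r1]; have w0 : 0 < w.1 by lra.
have e0 : 0 < eps_of w r by rewrite /eps_of divr_gt0// mulr_gt0.
have inv01 t : 1 <= t -> 0 <= t^-1 <= 1.
  by move=> t1; rewrite invr_ge0 invf_le1; lra.
have [e1|e1] := ltP (eps_of w r) 1; last first.
  have e2 : eps_of w r < 2 by rewrite /eps_of ltr_pdivrMr//; lra.
  have [-> -> -> ->] := observable_top w0 ra (introT andP (conj e1 e2)).
  have /andP[i0 i1] := inv01 _ e1.
  by rewrite /Kset /= !in_itv /=; split; [|split;[|split]];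
     [apply/andP; split; lra..|left].
have [n /andP[h1 h2]] := slot_exists ra (introT andP (conj e0 e1)).
pose x := gauss_iter (alpha_of w) n.+1; pose a := digit (alpha_of w) n.
pose t := eps_of w r / cf_d (alpha_of w) n.+1.
have d0 := cf_d_gt0 n.+1 ra.
have x01 : unit_itv x.
  by have /andP[? ?] := gauss_iter_bound n.+1 ra; rewrite /unit_itv !ltW.
have [j [ja jt]] : exists j, (j <= a)%N /\ piece_start j x <= t < x + j.+1%:R.
  apply: piece_exists => //; rewrite /t ler_pdivlMr// mul1r h1 /= ltr_pdivrMr//.
  by rewrite mulrC -cf_d_slot.
have [-> -> -> ->] := observable_slot w0 ra ja jt; rewrite -/x -/a -/t.
have /andP[x0 x1] := x01; have /andP[y0 y1] := past_bound R (word (alpha_of w) n).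
have /andP[jl ju] := jt; have t1 := le_trans (piece_start_ge1 j x01) jl.
have xj := le_trans (piece_start_ge j x01) jl.
have /andP[i0 i1] := inv01 _ t1.
move: t t1 jl ju jt xj i0 i1 => t t1 jl ju jt xj i0 i1.
have t0 : 0 < t by lra.
have q0 : 0 <= (x + j%:R) / t by apply: divr_ge0; [exact: addr_ge0|exact: ltW].
have q1 : (x + j%:R) / t <= 1 by rewrite ler_pdivrMr ?mul1r.
have D0 : 0 < a.+1%:R + x + past R (word (alpha_of w) n).
  by rewrite -addrA ltr_wpDr// addr_ge0.
have jaR : j.+1%:R <= a.+1%:R :> R by rewrite ler_nat.
rewrite /Kset /= !in_itv /=; split; [|split;[|split]].
- by apply/andP; split; lra.
- by apply/andP; split; lra.
- apply/andP; split; first by apply: divr_ge0; exact: ltW.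
  by rewrite ler_pdivrMr// mul1r; lra.
- by rewrite -signr_odd; case: (odd _) => /=; [right|left].
Qed.

End PointwiseValues.

(** * From the integral over r to sums over windows *)

Section AverageLink.
Variable R : realType.
Local Notation mu := (@lebesgue_measure R).
Implicit Types (p q r t x y s : R) (n j a : nat).
Variables (F : R * R * R * R -> R) (w : R * R) (L B : R).
Hypothesis FB : forall z, `|F z| <= B.
Hypothesis FL : forall s, lipschitz3 L (fun u v z => F (u, v, z, s)).
Hypotheses (L0 : 0 <= L) (w2 : 2^-1 < w.1) (w1 : w.1 <= 1) (ra : regular (alpha_of w)).

Let B0 : 0 <= B. Proof. exact: le_trans (FB (0, 0, 0, 0)). Qed.
Let w0 : 0 < w.1. Proof. by apply: lt_trans w2; rewrite invr_gt0. Qed.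

Definition orbit_integrand r : R := F (Aw w r, Bw w r, Qw w r, sigmaw w r) / r.

Local Notation h := orbit_integrand.
Local Notation c0 := (w.1 / 2).
Local Notation alpha := (alpha_of w).

Definition orbit_slot n : R := slot_integral (fun u v z => F (u, v, z, (-1) ^+ n.+1))
  (digit alpha n) (gauss_iter alpha n.+1) (past R (word alpha n)).

Lemma orbit_integrable (b : bool) p q : 0 < p ->
  measurable_fun [set` Interval (BLeft p) (BSide b q)] h ->
  mu.-integrable [set` Interval (BLeft p) (BSide b q)] (EFin \o h).
Proof.
move=> p0 mh; apply: measurable_bounded_integrable => //.
- have : (mu [set` Interval (BLeft p) (BSide b q)] < +oo)%E.
    rewrite lebesgue_measure_itv /=; case: ifP => _; last exact: ltry.
    by rewrite -EFinD ltry.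
  by [].
- exists (B / p); split; first exact: num_real.
  move=> M BM r; rewrite /= in_itv /= => /andP[pr _].
  apply: le_trans (ltW BM); rewrite /orbit_integrand normrM; apply: ler_pM => //.
  have r0 : 0 < r by exact: lt_le_trans pr.
  by rewrite ger0_norm ?invr_ge0 ?(ltW r0)// lef_pV2.
Qed.

(** Half-open intervals match the windows and are glued without overlap. Measurability accompanies
    the value because the integrand is understood piece by piece only. *)
Definition has_orbit_integral p q (I : R) : Prop :=
  measurable_fun `[p, q[ h /\ \int[mu]_(r in `[p, q[) h r = I.

Lemma has_orbit_integral_glue p q q' I J : 0 < p -> p <= q -> q <= q' ->
  has_orbit_integral p q I -> has_orbit_integral q q' J ->
  has_orbit_integral p q' (I + J).
Proof.
move=> p0 pq qq [m1 i1] [m2 i2].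
have E : `[p, q'[%classic = `[p, q[%classic `|` `[q, q'[%classic.
  by rewrite -itv_bndbnd_setU// bnd_simp.
have m : measurable_fun `[p, q'[ h by rewrite E; apply/measurable_funU.
split=> //; rewrite E Rintegral_setU//; first by rewrite i1 i2.
  by rewrite -E; exact: (@orbit_integrable true).
apply/disj_setPS => r [] /=; rewrite !in_itv /= => /andP[_ rq] /andP[qr _].
by have := lt_le_trans rq qr; rewrite ltxx.
Qed.

Let x01 n : unit_itv (gauss_iter alpha n).
Proof. by have /andP[? ?] := gauss_iter_bound n ra; rewrite /unit_itv !ltW. Qed.

Let c_gt0 n : 0 < c0 * cf_d alpha n.
Proof. by rewrite mulr_gt0 ?divr_gt0 ?cf_d_gt0. Qed.

Lemma scaled_density_continuous K Phi a j c p q x y : 0 < c -> 0 <= K ->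
  lipschitz3 K Phi -> bounded3 B Phi -> (j <= a)%N -> unit_itv x -> unit_itv y ->
  c <= p -> q <= c * a.+2%:R ->
  {within `[p, q], continuous (fun r => slot_value Phi a j (r / c) x y * (1 / (r / c)) / c)}.
Proof.
move=> cp K0 PK PB ja x0 y0 pc qc.
apply: (@lipschitz_within_continuous _ _ _ ((K * a.+3%:R + B) / c ^+ 2)).
have tb r : `[p, q]%classic r -> 1 <= r / c <= a.+2%:R.
  rewrite /= in_itv /= => /andP[pr rq]; apply/andP; split.
    by rewrite ler_pdivlMr// mul1r (le_trans pc).
  by rewrite ler_pdivrMr// mulrC (le_trans rq).
move=> r r' hr hr'; rewrite -mulrBl normrM [X in _ * X]ger0_norm ?invr_ge0 ?(ltW cp)//.
have l1 : 0 <= (1 : R) <= 1 by rewrite ler01 lexx.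
have := slot_density_dist PK K0 PB B0 ja (tb _ hr) (tb _ hr') l1 l1 x0 x0 y0 y0.
have nE : `|r / c - r' / c| = `|r - r'| / c.
  by rewrite -mulrBl normrM (gtr0_norm (_ : 0 < c^-1)) ?invr_gt0.
rewrite !subrr normr0 !addr0 nE => H.
rewrite ler_pdivrMr//; apply: (le_trans H).
by rewrite le_eqVlt; apply/orP; left; apply/eqP; field; rewrite lt0r_neq0.
Qed.

(** On the half-open interval the integrand agrees with a function continuous on the closure, the
    jump of the floor sitting at the excluded right end. The rescaling to t leaves no factor since
    dr / r = dt / t. *)
Lemma orbit_piece n j : (j <= digit alpha n)%N ->
  has_orbit_integral (c0 * cf_d alpha n.+1 * piece_start j (gauss_iter alpha n.+1))
    (c0 * cf_d alpha n.+1 * (gauss_iter alpha n.+1 + j.+1%:R))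
    (piece (fun u v z => F (u, v, z, (-1) ^+ n.+1)) (digit alpha n) j
       (gauss_iter alpha n.+1) (past R (word alpha n))).
Proof.
move=> ja; have cp := c_gt0 n.+1.
have tE r : eps_of w r / cf_d alpha n.+1 = r / (c0 * cf_d alpha n.+1).
  by rewrite /eps_of; field; rewrite !lt0r_neq0// cf_d_gt0.
move: tE; set c := c0 * _ in cp * => tE.
set x := gauss_iter alpha n.+1; set y := past R _; set a := digit alpha n in ja *.
set Phi := fun u v z => _.
have xx : unit_itv x := x01 n.+1; have yy : unit_itv y := past_bound R _.
have x0 : 0 < x by case/andP: (gauss_iter_bound n.+1 ra).
have lp : 0 < piece_len j x by case: (j).
have lt : c * piece_start j x < c * (x + j.+1%:R).
  by rewrite ltr_pM2l// -piece_end ltrDl.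
have pc : c <= c * piece_start j x by rewrite ler_peMr ?(ltW cp)//; exact: piece_start_ge1.
have qc : c * (x + j.+1%:R) <= c * a.+2%:R.
  rewrite ler_pM2l// -(natr1 a.+1); have /andP[_ x1] := xx.
  have : j.+1%:R <= a.+1%:R :> R by rewrite ler_nat.
  by lra.
have qpE : c * (x + j.+1%:R) - c * piece_start j x = c * piece_len j x.
  by rewrite -piece_end; ring.
have itvE r : (c * piece_start j x <= r < c * (x + j.+1%:R)) =
    (piece_start j x <= r / c < x + j.+1%:R).
  by rewrite ler_pdivlMr// ltr_pdivrMr// ![_ * c]mulrC.
set p := c * piece_start j x in lt pc qpE itvE *.
set q := c * (x + _) in lt qc qpE itvE *.
pose g r := slot_value Phi a j (r / c) x y * (1 / (r / c)) / c.
have cg : {within `[p, q], continuous g}.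
  apply: (@scaled_density_continuous L) => //; first exact: FL.
  by move=> u v z; exact: FB.
have ig := segment_integrable cg.
have sub : `[p, q[%classic `<=` `[p, q]%classic by apply: subset_itvl; rewrite bnd_simp.
have ig' : mu.-integrable `[p, q[ (EFin \o g) by apply: integrableS ig.
have hg r : `[p, q[%classic r -> h r = g r.
  rewrite /= in_itv /= => pqr.
  have r0 : 0 < r.
    by case/andP: pqr => pr _; apply: lt_le_trans pr; apply: lt_le_trans pc.
  rewrite itvE -tE in pqr.
  have [E1 E2 E3 E4] := observable_slot w0 ra ja pqr.
  rewrite /h E1 E2 E3 E4 tE /g /slot_value /Phi -/x -/y -/a.
  by rewrite -[RHS]mulrA; congr (_ * _); field; rewrite !lt0r_neq0.
split.
  apply: (eq_measurable_fun g).
    by move=> r; rewrite inE => rpq; rewrite hg.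
  by apply/measurable_EFinP; case/integrableP: ig'.
transitivity (\int[mu]_(r in `[p, q[) g r).
  by apply: eq_Rintegral => r; rewrite inE => /hg.
rewrite Rintegral_itv_bndo_bndc// Rintegral_affine// /piece.
apply: eq_Rintegral => s; rewrite inE /= in_itv /= => s01; rewrite /g qpE.
have -> : p + s * (c * piece_len j x) = c * piece_pt j s x by rewrite /p /piece_pt; ring.
have -> : c * piece_pt j s x / c = piece_pt j s x by field; rewrite lt0r_neq0.
have t0 : piece_pt j s x != 0.
  have /andP[t1 _] := piece_pt_itv ja s01 xx; apply: lt0r_neq0; lra.
by rewrite -[LHS]mulrA -[LHS]mulrA; congr (_ * _); field; rewrite t0 lt0r_neq0.
Qed.

Lemma orbit_slotP n :
  has_orbit_integral (c0 * cf_d alpha n.+1) (c0 * cf_d alpha n) (orbit_slot n).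
Proof.
have cp := c_gt0 n.+1; have xx := x01 n.+1; have /andP[x0 x1] := xx.
rewrite (cf_d_slot n ra) mulrA addrC /orbit_slot /slot_integral.
suff : forall k, (k <= digit alpha n)%N ->
  has_orbit_integral (c0 * cf_d alpha n.+1)
    (c0 * cf_d alpha n.+1 * (gauss_iter alpha n.+1 + k.+1%:R))
    (\sum_(j < k.+1) piece (fun u v z => F (u, v, z, (-1) ^+ n.+1)) (digit alpha n) j
       (gauss_iter alpha n.+1) (past R (word alpha n))) by apply.
elim=> [|k IH] kn.
  rewrite big_ord_recl big_ord0 addr0 -[X in has_orbit_integral X]mulr1.
  exact: (@orbit_piece n 0).
rewrite big_ord_recr /=; apply: has_orbit_integral_glue (IH (ltnW kn)) (orbit_piece kn) => //.
- by rewrite ler_peMr ?(ltW cp)// -[leLHS]add0r lerD// ler1n.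
- by rewrite ler_pM2l// lerD2l ler_nat.
Qed.

Lemma orbit_chain n :
  has_orbit_integral (c0 * cf_d alpha n) c0 (\sum_(i < n) orbit_slot i).
Proof.
have cd m : cf_d alpha m <= 1.
  rewrite -(cf_d0 ra); case: m => [|m]; first exact: lexx.
  by apply/ltW/cf_d_lt.
have c00 : 0 < c0 by rewrite divr_gt0.
elim: n => [|n IH].
  rewrite big_ord0 cf_d0// mulr1 /has_orbit_integral set_itvco0.
  by split; [exact: measurable_fun_set0|exact: Rintegral_set0].
rewrite big_ord_recr /= addrC; apply: has_orbit_integral_glue (orbit_slotP n) IH => //.
- by rewrite ler_pM2l// ltW// cf_d_lt.
- by rewrite ler_piMr// ltW.
Qed.

Lemma orbit_integral_bound (b : bool) p q : 0 < p -> p <= q ->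
  measurable_fun [set` Interval (BLeft p) (BSide b q)] h ->
  `|\int[mu]_(r in [set` Interval (BLeft p) (BSide b q)]) h r| <= B * (ln q - ln p).
Proof.
move=> p0 pq mh; have ih := orbit_integrable p0 mh.
apply: le_trans (le_normr_Rintegral _ ih) _ => //.
have cinv : {within `[p, q], continuous (fun t : R => t^-1)}.
  apply: continuous_in_subspaceT => t; rewrite inE /= in_itv /= => /andP[pt _].
  by apply: cvgV; [apply: lt0r_neq0; lra|exact: cvg_id].
have iinv := segment_integrable cinv.
have sub : [set` Interval (BLeft p) (BSide b q)] `<=` `[p, q]%classic.
  by apply: subset_itvl; case: (b); rewrite bnd_simp.
have iinv' : mu.-integrable [set` Interval (BLeft p) (BSide b q)] (EFin \o (fun t : R => t^-1)).
  by apply: integrableS iinv.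
have -> : ln q - ln p = \int[mu]_(r in [set` Interval (BLeft p) (BSide b q)]) r^-1.
  rewrite -(Rintegral_inv p0 pq); case: (b) iinv' => // iinv'.
  by rewrite Rintegral_itv_bndo_bndc.
rewrite -RintegralZl//; apply: le_Rintegral => //.
- exact: integrable_norm.
- exact: (integrableZl _ B iinv').
move=> r; rewrite /= in_itv /= => /andP[pr _].
have r0 : 0 < r by exact: lt_le_trans pr.
rewrite normrM; apply: ler_pM => //.
by rewrite ger0_norm// invr_ge0 ltW.
Qed.

Lemma orbit_top : measurable_fun `[c0, 2^-1] h.
Proof.
have c00 : 0 < c0 by rewrite divr_gt0.
(* A and B coincide and Q = 0 at these scales, so this [Phi] presents them as a slot with all
   parameters 0; repeating [u] doubles the Lipschitz constant. *)
pose Phi := fun u v z : R => F (u, u, 0, 1).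
have PL : lipschitz3 (2 * L) Phi.
  move=> u v z u' v' z'; apply: le_trans (@FL 1 _ _ _ _ _ _) _.
  rewrite subrr normr0 addr0 (mulrC 2) -mulrA ler_wpM2l//.
  have := normr_ge0 (u - u'); have := normr_ge0 (v - v'); have := normr_ge0 (z - z').
  lra.
pose g r := slot_value Phi 0 0 (r / c0) 0 0 * (1 / (r / c0)) / c0.
have cg : {within `[c0, 2^-1], continuous g}.
  have u0 : unit_itv (0 : R) by rewrite /unit_itv lexx ler01.
  apply: (@scaled_density_continuous (2 * L)) => //; first by rewrite mulr_ge0.
    by move=> u v z; exact: FB.
  by have := w2; lra.
have hg r : c0 <= r -> r <= 2^-1 -> h r = g r.
  move=> cr r2.
  have r0 : 0 < r by exact: lt_le_trans cr.
  have eE : eps_of w r = r / c0 by rewrite /eps_of; field; rewrite lt0r_neq0.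
  have e12 : 1 <= eps_of w r < 2.
    by rewrite eE ler_pdivlMr// mul1r cr /= ltr_pdivrMr//; have := w2; lra.
  have [E1 E2 E3 E4] := observable_top w0 ra e12.
  rewrite /h E1 E2 E3 E4 eE /g /slot_value /Phi -[RHS]mulrA; congr (_ * _).
  by field; rewrite !lt0r_neq0.
apply: (eq_measurable_fun g).
  by move=> r; rewrite inE /= in_itv /= => /andP[cr r2]; rewrite hg.
by apply/measurable_EFinP; case/integrableP: (segment_integrable cg).
Qed.

(** The window containing [eta] is covered in part only; its full logarithmic length ln (d_n /
    d_{n+1}) bounds the error. *)
Lemma orbit_integral_near n eta : c0 * cf_d alpha n.+1 <= eta < c0 * cf_d alpha n ->
  measurable_fun `[eta, 2^-1] h /\
  `|\int[mu]_(r in `[eta, 2^-1]) h r -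
     (\sum_(i < n) orbit_slot i + \int[mu]_(r in `[c0, 2^-1]) h r)|
    <= B * - ln (gauss_iter alpha n).
Proof.
move=> /andP[e1 e2].
have e0 : 0 < eta by exact: lt_le_trans (c_gt0 n.+1) e1.
have [m1 _] := orbit_slotP n; have [m2 i2] := orbit_chain n.
have c00 : 0 < c0 by rewrite divr_gt0.
have cd : c0 * cf_d alpha n <= c0.
  rewrite ler_piMr ?(ltW c00)//; rewrite -(cf_d0 ra).
  by case: (n) => [|m]; [exact: lexx|apply/ltW/cf_d_lt].
have m1' : measurable_fun `[eta, c0 * cf_d alpha n[ h.
  apply: measurable_funS m1 => //; apply: subset_itvr; by rewrite bnd_simp.
have G : has_orbit_integral eta c0
    (\int[mu]_(r in `[eta, c0 * cf_d alpha n[) h r + \sum_(i < n) orbit_slot i).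
  by apply: has_orbit_integral_glue (ltW e2) cd _ _.
have ec : eta <= c0 := le_trans (ltW e2) cd.
have E : `[eta, 2^-1]%classic = `[eta, c0[%classic `|` `[c0, 2^-1]%classic.
  by rewrite -itv_bndbnd_setU// bnd_simp//; have := w1; lra.
have [mG iG] := G.
have m : measurable_fun `[eta, 2^-1] h.
  by rewrite E; apply/measurable_funU => //; split => //; exact: orbit_top.
split=> //; rewrite E Rintegral_setU//; last 2 first.
- by rewrite -E; exact: (@orbit_integrable false).
- apply/disj_setPS => r [] /=; rewrite !in_itv /= => /andP[_ rq] /andP[qr _].
  by have := lt_le_trans rq qr; rewrite ltxx.
rewrite iG opprD addrACA subrr addr0 addrK.
apply: le_trans (@orbit_integral_bound true _ _ e0 (ltW e2) m1') _.
rewrite ler_wpM2l//.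
have /andP[g0 _] := gauss_iter_bound n ra.
have -> : - ln (gauss_iter alpha n) = ln (c0 * cf_d alpha n) - ln (c0 * cf_d alpha n.+1).
  have cn := c_gt0 n.
  by rewrite cf_dS// mulrA [X in _ = _ - X]lnM ?posrE// opprD addrA subrr add0r.
by rewrite lerD2l lerN2 ler_ln ?posrE// c_gt0.
Qed.

End AverageLink.

(** * Logarithmic averages *)

Section LogarithmicAverages.
Variable R : realType.
Implicit Types (alpha : R) (G : nat -> R -> R -> R) (u l d : nat -> R).
Local Notation mu := (@lebesgue_measure R).

(** A deterministic statement: I(e) is n g up to o(n) and ln (1/e) is n ell up to o(n). The last
    window is o(n) because l_n is the difference of two successive sums. *)
Lemma log_average_limit u l d (I : R -> R) (g ell c B T : R) :
  0 < ell -> 0 < c <= 1 -> 0 <= B ->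
  avg u n @[n --> \oo] --> g -> avg l n @[n --> \oo] --> ell ->
  (forall n, 0 < d n) -> (forall n, ln (d n) = - \sum_(i < n) l i) ->
  (forall m n, (m <= n)%N -> d n <= d m) ->
  (forall e, 0 < e < c -> exists n, c * d n.+1 <= e < c * d n) ->
  (forall n e, c * d n.+1 <= e < c * d n ->
     `|I e - (\sum_(i < n) u i + T)| <= B * l n) ->
  (ln e^-1)^-1 * I e @[e --> 0^'+] --> g / ell.
Proof.
move=> l0 /andP[c0 c1] B0 ug ll d0 dl dm dc IB.
apply/cvgrPdist_le => eps eps0.
pose K := `|g / ell|; have K0 : 0 <= K by exact: normr_ge0.
(* In units of n [del]: 4 B from the last window, K + 4 K from comparing n ell with ln (1/e), 1 from
   the constants [T] and [ln c], and 1 from the sum of [u]. The 2 in [del] reflects that ln (1/e) is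
   at least n ell / 2. *)
pose M := 4 * B + 5 * K + 2; have M0 : 0 < M by rewrite /M; lra.
pose del := eps * ell / (2 * M).
have del0 : 0 < del by rewrite divr_gt0 ?mulr_gt0.
have l20 : 0 < ell / 2 by rewrite divr_gt0.
move/cvgrPdist_le : ug => /(_ _ del0)[N1 _ H1].
move/cvgrPdist_le : (ll) => /(_ _ del0)[N2 _ H2].
move/cvgrPdist_le : (ll) => /(_ _ l20)[N3 _ H3].
have natub (y : R) : exists N : nat, y <= N%:R.
  by exists (Num.truncn y).+1; exact/ltW/truncnS_gt.
have [N4 H4] := natub (ell / del).
have [N5 H5] := natub ((`|T| + K * - ln c) / del).
pose N := (N1 + N2 + N3 + N4 + N5).+1.
have [NN1 NN2 NN3 NN4 NN5] :
    [/\ (N1 <= N)%N, (N2 <= N)%N, (N3 <= N)%N, (N4 <= N)%N & (N5 <= N)%N].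
  by rewrite /N; clear; split; lia.
have cN : 0 < c * d N by rewrite mulr_gt0.
near=> e.
have e0 : 0 < e by near: e; exact: nbhs_right_gt.
have eN : e < c * d N by near: e; exact: nbhs_right_lt.
have ec : e < c by near: e; exact: nbhs_right_lt.
have [n hn] := dc e (introT andP (conj e0 ec)); have /andP[en1 en2] := hn.
have Nn : (N <= n)%N.
  rewrite leqNgt; apply/negP => nN; have := le_lt_trans en1 eN.
  by rewrite ltr_pM2l// ltNge dm.
have n1 : 1 <= n%:R :> R by rewrite ler1n (leq_trans _ Nn).
have h4 : ell <= n%:R * del.
  rewrite -ler_pdivrMr//; apply: (le_trans H4); rewrite ler_nat.
  exact: leq_trans NN4 Nn.
have h5 : `|T| + K * - ln c <= n%:R * del.
  rewrite -ler_pdivrMr//; apply: (le_trans H5); rewrite ler_nat.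
  exact: leq_trans NN5 Nn.
have near_sum (v : nat -> R) a b k : `|a - avg v k| <= b -> (0 < k)%N ->
    `|\sum_(i < k) v i - k%:R * a| <= k%:R * b.
  move=> h k0; have kp : 0 < k%:R :> R by rewrite ltr0n.
  have -> : \sum_(i < k) v i - k%:R * a = k%:R * (avg v k - a).
    by rewrite /avg mulrBr mulVKf// gt_eqF.
  by rewrite normrM (gtr0_norm kp) ler_pM2l// distrC.
have n0 : (0 < n)%N by apply: leq_trans Nn.
have B1 : `|\sum_(i < n) u i - n%:R * g| <= n%:R * del.
  by apply: near_sum => //; apply: H1; exact: leq_trans NN1 Nn.
have B2 : `|\sum_(i < n) l i - n%:R * ell| <= n%:R * del.
  by apply: near_sum => //; apply: H2; exact: leq_trans NN2 Nn.
have B2' : `|\sum_(i < n.+1) l i - n.+1%:R * ell| <= n.+1%:R * del.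
  by apply: near_sum => //; apply: H2; exact: leq_trans NN2 (leqW Nn).
have B3 : `|\sum_(i < n) l i - n%:R * ell| <= n%:R * (ell / 2).
  by apply: near_sum => //; apply: H3; exact: leq_trans NN3 Nn.
move: B2'; rewrite big_ord_recr /= -(natr1 n) => B2'.
have dl1 := dl n.+1; rewrite big_ord_recr /= in dl1; have dl0 := dl n.
have BI := IB n e hn.
have Elo : ln c - \sum_(i < n) l i - l n <= ln e.
  have : ln (c * d n.+1) <= ln e by rewrite ler_ln ?posrE// mulr_gt0.
  by rewrite lnM ?posrE// dl1; lra.
have Ehi : ln e <= ln c - \sum_(i < n) l i.
  have : ln e <= ln (c * d n) by rewrite ler_ln ?posrE ?mulr_gt0// ltW.
  by rewrite lnM ?posrE// dl0.
have lc : ln c <= 0 by exact: ln_le0.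
set U := \sum_(i < n) u i in B1 BI; set S := \sum_(i < n) l i in B2 B2' B3 Elo Ehi.
move: B1 B2 B2' B3 Elo Ehi BI h4 h5 n1; set x : R := n%:R; set ln_ := l n.
move=> B1 B2 B2' B3 Elo Ehi BI h4 h5 x1.
rewrite lnV ?posrE//; set lam := - ln e.
have lamE : ln e = - lam by rewrite /lam opprK.
rewrite lamE in Elo Ehi.
have lam1 : S - ln c <= lam by lra.
have lam2 : lam <= S + ln_ - ln c by lra.
have S1 : x * (ell / 2) <= S.
  by move: B3; rewrite ler_norml => /andP[+ _]; lra.
have xl : 0 < x * (ell / 2) by rewrite mulr_gt0//; lra.
have lam0 : 0 < lam by lra.
have ln4 : ln_ <= 4 * (x * del).
  move: B2 B2'; rewrite !ler_norml => /andP[b1 b2] /andP[b3 b4].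
  have : del <= x * del by rewrite ler_peMl// ltW.
  by lra.
have lnlo : 0 <= ln_ by lra.
have main : `|I e - (g / ell) * lam| <= M * (x * del).
  have -> : I e - g / ell * lam = (I e - (U + T)) + (T + ((U - x * g) +
      ((g / ell) * (x * ell - S) + (g / ell) * (S - lam)))).
    by field; rewrite gt_eqF.
  have t1 : `|(g / ell) * (x * ell - S)| <= K * (x * del).
    by rewrite normrM ler_wpM2l// distrC.
  have t2 : `|(g / ell) * (S - lam)| <= K * (- ln c + 4 * (x * del)).
    rewrite normrM ler_wpM2l// ler_norml; apply/andP; split; lra.
  have t3 : B * ln_ <= B * (4 * (x * del)) by rewrite ler_wpM2l.
  apply: le_trans (ler_normD _ _) _; apply: le_trans (lerD BI (ler_normD _ _)) _.
  have t4 := ler_normD (U - x * g) ((g / ell) * (x * ell - S) + (g / ell) * (S - lam)).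
  have t5 := ler_normD ((g / ell) * (x * ell - S)) ((g / ell) * (S - lam)).
  rewrite /M; lra.
have -> : g / ell - lam^-1 * I e = - (lam^-1 * (I e - g / ell * lam)).
  by field; rewrite !gt_eqF.
rewrite normrN normrM gtr0_norm ?invr_gt0// mulrC ler_pdivrMr//.
apply: (le_trans main).
have -> : M * (x * del) = eps * (x * (ell / 2)).
  by rewrite /del; field; rewrite gt_eqF.
by rewrite ler_pM2l//; lra.
Unshelve. all: by end_near. Qed.

Lemma slot_lipschitz_lin G G' (p q : R) : slot_lipschitz G -> slot_lipschitz G' ->
  slot_lipschitz (fun a x y => p * G a x y + q * G' a x y).
Proof.
move=> h h' a; have [L [L0 HL]] := h a; have [L' [L'0 HL']] := h' a.
exists (`|p| * L + `|q| * L'); split; first by rewrite addr_ge0// mulr_ge0.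
move=> x x' y y' x0 x'0 y0 y'0.
have -> : p * G a x y + q * G' a x y - (p * G a x' y' + q * G' a x' y') =
  p * (G a x y - G a x' y') + q * (G' a x y - G' a x' y') by ring.
apply: le_trans (ler_normD _ _) _; rewrite !normrM mulrDl -!mulrA.
by apply: lerD; rewrite ler_wpM2l//; [exact: HL|exact: HL'].
Qed.

Lemma ln_dist (p q : R) : 1 <= p -> 1 <= q -> `|ln p - ln q| <= `|p - q|.
Proof.
wlog pq : p q / q <= p => [H p1 q1|p1 q1].
  case/orP: (le_total q p) => [qp|qp]; first exact: H.
  by rewrite distrC (distrC p); exact: H.
have q0 : 0 < q by lra.
rewrite !ger0_norm ?subr_ge0// ?ler_ln ?posrE//; last by lra.
rewrite -ln_div ?posrE//; last by lra.
have -> : p / q = 1 + (p - q) / q by field; rewrite gt_eqF.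
apply: le_trans (le_ln1Dx _) _.
  by apply: lt_le_trans (_ : 0 <= _); [lra|rewrite divr_ge0; lra].
by rewrite ler_pdivrMr// ler_peMr//; lra.
Qed.

Lemma ln_cf_d alpha n : regular alpha ->
  ln (cf_d alpha n) = - \sum_(i < n) - ln (gauss_iter alpha i).
Proof.
move=> ra; elim: n => [|n IH]; first by rewrite big_ord0 cf_d0// ln1 oppr0.
rewrite big_ord_recr /= opprD opprK cf_dS// lnM ?posrE ?cf_d_gt0// ?IH//.
by case/andP: (gauss_iter_bound n ra).
Qed.

(** The increment is the logarithm of a digit plus the next iterate, hence covered by
    [erg_observable]. Positivity, required for dividing by [ell], holds because d_n at least halves
    every two steps, so that ell >= ln 2 / 2. *)
Lemma log_increment_limit : exists2 ell : R, 0 < ell &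
  ae_slope (fun alpha => avg (fun i => - ln (gauss_iter alpha i)) n @[n --> \oo] --> ell).
Proof.
pose G a (x y : R) : R := ln (a.+1%:R + x).
have a1 a x : unit_itv x -> 1 <= a.+1%:R + x :> R.
  by move=> /andP[x0 _]; rewrite -natr1; have := ler0n R a; lra.
have GB a x y : unit_itv x -> unit_itv y -> `|G a x y| <= 1 * ln a.+2%:R.
  move=> x01 _; rewrite mul1r ger0_norm; last by rewrite ln_ge0// a1.
  have := a1 a x x01 => ax; rewrite ler_ln ?posrE//; last by lra.
  by rewrite -(natr1 a.+1) lerD2l; case/andP: x01.
have GL : slot_lipschitz G.
  move=> a; exists 1; split=> // x x' y y' x01 x'01 _ _; rewrite mul1r /G.
  apply: le_trans (ln_dist (a1 a _ x01) (a1 a _ x'01)) _.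
  by rewrite opprD addrACA subrr add0r lerDl.
have [ell hell] := erg_cvg (erg_observable (or_introl erefl) ler01 GB GL).
have E alpha i : regular alpha -> 1 ^+ i *
    G (digit alpha i) (gauss_iter alpha i.+1) (past R (word alpha i)) =
    - ln (gauss_iter alpha i).
  move=> ra; have /andP[x0 _] := gauss_iter_bound i ra.
  rewrite expr1n mul1r -lnV ?posrE// (gauss_iterS i ra) /branch invrK //.
have hell' : ae_slope (fun alpha =>
    avg (fun i => - ln (gauss_iter alpha i)) n @[n --> \oo] --> ell).
  apply: ae_slopeW hell => alpha ra.
  by rewrite (_ : (fun i => 1 ^+ i * _) = fun i => - ln (gauss_iter alpha i))//;
     apply/funext => i; rewrite E.
exists ell => //; have [alpha [ra h]] := ae_slope_witness hell'.
have ln20 : 0 < ln 2 :> R by rewrite ln_gt0//; lra.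
suff : ln 2 / 2 <= ell by apply: lt_le_trans; rewrite divr_gt0.
apply/ler_addgt0Pr => e e0.
move/cvgrPdist_le : h => /(_ _ e0)[N _ /(_ N.+1.*2)] /=.
rewrite /avg -[X in _ * X]opprK -ln_cf_d// => H; have {H} : `|ell - (N.+1.*2)%:R^-1 * - ln (cf_d alpha N.+1.*2)| <= e.
  by apply: H; lia.
have d2 := cf_d_double N.+1 ra.
have lnd : ln (cf_d alpha N.+1.*2) <= - (N.+1%:R * ln 2).
  have : ln (cf_d alpha N.+1.*2) <= ln (2^-1 ^+ N.+1).
    by rewrite ler_ln ?posrE ?cf_d_gt0 ?exprn_gt0 ?invr_gt0.
  by rewrite lnXn ?invr_gt0// lnV ?posrE// -[_ *+ _]mulr_natl mulrN.
have lo : ln 2 / 2 <= (N.+1.*2)%:R^-1 * - ln (cf_d alpha N.+1.*2).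
  move: lnd; set D := ln _ => lnd.
  by rewrite -muln2 natrM invfM -mulrA ler_pdivlMl// mulrC; lra.
by rewrite ler_norml => /andP[+ _]; lra.
Qed.

End LogarithmicAverages.

(** * Lipschitz observables *)

Section LipschitzLimit.
Variable R : realType.
Local Notation mu := (@lebesgue_measure R).
Variables (F : R * R * R * R -> R) (L B : R).
Hypothesis FB : forall z, `|F z| <= B.
Hypothesis FL : forall s, lipschitz3 L (fun u v z => F (u, v, z, s)).
Hypothesis L0 : 0 <= L.

(** Below pi / 4 the cosine exceeds the sine, so both cannot be at most 1/2. The bound keeps epsilon
    = 2 r / omega_1 below 2 for r <= 1/2. *)
Lemma cos_gt_half (th : R) : th \in `]0, pi / 4[ -> 2^-1 < cos th.
Proof.
move=> hth; have c0 := cos_gt0_quarter hth; have /andP[t0 t1] := tan_unit hth.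
have sE : sin th = tan th * cos th by rewrite /tan divfK// gt_eqF.
have s0 : 0 < sin th by rewrite sE mulr_gt0.
have s1 : sin th < cos th by rewrite sE gtr_pMl.
have := cos2Dsin2 th; move: c0 s0 s1; set c := cos th; set u := sin th.
rewrite !expr2 => c0 s0 s1 E; rewrite ltNge; apply/negP => c2.
have h1 : c * c <= 4^-1 by nra.
have h2 : u * u <= 4^-1 by nra.
lra.
Qed.

(** The value at the sign (-1)^(i+1) is half the sum of the values at 1 and -1, plus (-1)^i times
    half the value at -1 minus the value at 1. Both parts fall under [erg_observable], with weights
    s = 1 and s = -1. *)
Lemma slot_average_limit : exists g : R, ae_slope (fun alpha =>
  avg (fun i => slot_integral (fun u v z => F (u, v, z, (-1) ^+ i.+1))
    (digit alpha i) (gauss_iter alpha i.+1) (past R (word alpha i))) n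
    @[n --> \oo] --> g).
Proof.
have B0 : 0 <= B by exact: le_trans (FB (0, 0, 0, 0)).
pose G s := slot_integral (fun u v z => F (u, v, z, s)).
have GB s a x y : unit_itv x -> unit_itv y -> `|G s a x y| <= B * ln a.+2%:R.
  by apply: (@slot_integral_bound _ _ L).
have GL s : slot_lipschitz (G s).
  by apply: (@slot_integral_lipschitz _ _ L B).
have comb (p q : R) : `|p| + `|q| <= 1 -> forall s, s = 1 \/ s = -1 ->
  erg (fun alpha i => s ^+ i * (p * G 1 (digit alpha i) (gauss_iter alpha i.+1)
    (past R (word alpha i)) + q * G (-1) (digit alpha i) (gauss_iter alpha i.+1)
    (past R (word alpha i)))).
  move=> pq s hs.
  apply: (@erg_observable _ s (fun a x y => p * G 1 a x y + q * G (-1) a x y) B) => //.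
    move=> a x y x01 y01; apply: le_trans (ler_normD _ _) _; rewrite !normrM.
    have h1 := GB 1 a _ _ x01 y01; have h2 := GB (-1) a _ _ x01 y01.
    have h0 : 0 <= B * ln a.+2%:R by exact: le_trans h1.
    apply: le_trans (lerD (ler_wpM2l (normr_ge0 p) h1) (ler_wpM2l (normr_ge0 q) h2)) _.
    by rewrite -mulrDl ler_piMl.
  exact: slot_lipschitz_lin.
have half : `|2^-1 : R| = 2^-1 by rewrite ger0_norm// invr_ge0.
have e1 : erg (fun alpha i => 1 ^+ i * (2^-1 * G 1 (digit alpha i) (gauss_iter alpha i.+1)
    (past R (word alpha i)) + 2^-1 * G (-1) (digit alpha i) (gauss_iter alpha i.+1)
    (past R (word alpha i)))).
  by apply: comb; [rewrite half; lra|left].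
have e2 : erg (fun alpha i => (-1) ^+ i * ((- 2^-1) * G 1 (digit alpha i) (gauss_iter alpha i.+1)
    (past R (word alpha i)) + 2^-1 * G (-1) (digit alpha i) (gauss_iter alpha i.+1)
    (past R (word alpha i)))).
  by apply: comb; [rewrite normrN half; lra|right].
have [g hg] := erg_cvg (ergD e1 e2); exists g; apply: ae_slopeW hg => alpha _ h.
apply: (eq_ind _ (fun f => avg f n @[n --> \oo] --> g) h); apply/funext => i.
rewrite expr1n mul1r -/(G _) exprS -signr_odd.
by case: (odd i) => /=; rewrite ?expr1 ?expr0 ?mulN1r ?opprK ?mul1r; lra.
Qed.

Lemma lipschitz_limit : exists l : R, mu.-negligible [set th : R |
  (th \in `]0, pi / 4[) /\ ~ (regular (tan th) /\
     avgF F (omega_of th) eta @[eta --> 0^'+] --> l)].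
Proof.
have B0 : 0 <= B by exact: le_trans (FB (0, 0, 0, 0)).
have [g hg] := slot_average_limit; have [ell ell0 hell] := log_increment_limit R.
exists (g / ell).
apply: negligibleS (negligibleU (irregular_negligible R) (ae_slope_and hg hell)).
move=> th [hth]; have [rt|nrt] := pselect (regular (tan th)); last by left.
move=> nlim; right; split=> // -[ag al]; apply: nlim; split => //.
have p0 := pi_gt0 R.
have cth := cos_gt_half hth.
have ra : regular (alpha_of (omega_of th)) by [].
set w := omega_of th in ra *.
have w2 : 2^-1 < w.1 by [].
have w1 : w.1 <= 1 by exact: cos_le1.
have w0 : 0 < w.1 by apply: lt_trans w2; rewrite invr_gt0.
apply: (@log_average_limit _ _ _ (cf_d (tan th)) _ g ell (w.1 / 2) B
   (\int[mu]_(r in `[w.1 / 2, 2^-1]) orbit_integrand F w r) ell0 _ B0 ag al) => //.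
- by apply/andP; split; lra.
- by move=> n; exact: cf_d_gt0.
- by move=> n; exact: ln_cf_d.
- move=> m n; rewrite leq_eqVlt => /predU1P[->//|mn]; exact/ltW/cf_d_lt.
- move=> e /andP[e0 ec].
  have c0 : 0 < w.1 / 2 by lra.
  have [n /andP[h1 h2]] : exists n, cf_d (tan th) n.+1 <= e / (w.1 / 2) < cf_d (tan th) n.
    by apply: slot_exists => //; rewrite divr_gt0//= ltr_pdivrMr// mul1r.
  exists n; apply/andP; split.
    by rewrite mulrC -ler_pdivlMr.
  by rewrite mulrC -ltr_pdivrMr.
- move=> n e he.
  by have [] := orbit_integral_near FB FL L0 w2 w1 ra he.
Qed.

End LipschitzLimit.

(** * Lipschitz approximation *)

Section LipschitzApproximation.
Variable R : realType.
Implicit Types (F : R * R * R * R -> R) (z q : R * R * R * R) (e L B : R).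
Local Notation mu := (@lebesgue_measure R).

Definition dist4 z q : R := `|z.1.1.1 - q.1.1.1| + `|z.1.1.2 - q.1.1.2|
  + `|z.1.2 - q.1.2| + `|z.2 - q.2|.

Lemma dist4_ge0 z q : 0 <= dist4 z q.
Proof. by rewrite !addr_ge0. Qed.

Lemma dist4_triangle z q p : dist4 z p <= dist4 z q + dist4 q p.
Proof.
have := ler_distD q.1.1.1 z.1.1.1 p.1.1.1; have := ler_distD q.1.1.2 z.1.1.2 p.1.1.2.
have := ler_distD q.1.2 z.1.2 p.1.2; have := ler_distD q.2 z.2 p.2.
by rewrite /dist4; lra.
Qed.

Lemma dist4_ball z q e : dist4 z q < e -> ball z e q.
Proof.
rewrite /dist4 => h.
have := normr_ge0 (z.1.1.1 - q.1.1.1); have := normr_ge0 (z.1.1.2 - q.1.1.2).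
have := normr_ge0 (z.1.2 - q.1.2); have := normr_ge0 (z.2 - q.2).
by move=> *; split; [split; [split|]|]; rewrite /ball /=; lra.
Qed.

Lemma Kset_compact : compact (@Kset R).
Proof.
have -> : @Kset R = ((`[0, 1]%classic `*` `[0, 1]%classic) `*` `[0, 1]%classic)
    `*` ([set 1] `|` [set -1]).
  apply/seteqP; split=> [[[[a b] c] s]|[[[a b] c] s]] /=.
    by move=> [? [? [? ?]]].
  by move=> [[[? ?] ?] ?].
apply: compact_setX; last by apply: compactU; exact: compact_set1.
apply: compact_setX; last exact: segment_compact.
by apply: compact_setX; exact: segment_compact.
Qed.

Lemma Kset_uniformly_continuous F e : {within @Kset R, continuous F} -> 0 < e ->
  exists2 d, 0 < d & forall z q, Kset z -> Kset q -> dist4 z q < d ->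
    `|F z - F q| <= e.
Proof.
move=> /subspace_continuousP cF e0; have e2 : 0 < e / 2 by rewrite divr_gt0.
have /compact_near_coveringP nc := Kset_compact.
pose P (d : R) z := Kset z -> forall q, Kset q -> dist4 z q < d -> `|F z - F q| <= e.
have cover x : Kset x -> \forall x' \near x & d \near 0^'+, P d x'.
  move=> Kx; move: (cF x Kx) => /cvgrPdist_le/(_ _ e2); rewrite near_withinE.
  move=> /nbhs_ballP[r /= r0 hr].
  have r2 : 0 < r / 2 by rewrite divr_gt0.
  exists (ball x (r / 2), [set d : R | d < r / 2]) => /=.
    split; first exact: nbhsx_ballx.
    exact: nbhs_right_lt.
  move=> [z d] /= [xz dr] Kz q Kq zq.
  have bz : ball x r z by apply: le_ball xz; lra.
  have bq : ball x r q.
    rewrite [r]splitr; apply: (ball_triangle xz); apply: dist4_ball.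
    exact: lt_trans dr.
  rewrite [e]splitr; apply: le_trans (ler_distD (F x) _ _) _.
  by apply: lerD; [rewrite distrC|]; exact: hr.
have near_P : \forall d \near 0^'+, @Kset R `<=` P d by exact: nc.
near (0 : R)^'+ => d; exists d; first by near: d; exact: nbhs_right_gt.
have Pd : @Kset R `<=` P d by near: d.
by move=> z q Kz Kq; exact: Pd.
Unshelve. all: by end_near. Qed.

Lemma Kset_bounded F : {within @Kset R, continuous F} ->
  exists2 B, 0 <= B & forall z, Kset z -> `|F z| <= B.
Proof.
move=> cF; have /compact_bounded[M [_ hM]] := continuous_compact cF Kset_compact.
exists (`|M| + 1); first by rewrite addr_ge0.
move=> z Kz; apply: (hM (`|M| + 1)); last by exists z.
by apply: le_lt_trans (ler_norm M) _; rewrite ltrDl.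
Qed.

Lemma Kset_nonempty : Kset ((0, 0, 0, 1) : R * R * R * R).
Proof. by rewrite /Kset /= !in_itv /= lexx ler01; do 3 split => //; left. Qed.

Definition truncated_dist z q : R := Num.min (dist4 z q) 1.

Lemma truncated_dist_bound z q : 0 <= truncated_dist z q <= 1.
Proof. by rewrite /truncated_dist le_min dist4_ge0 ler01 ge_min lexx orbT. Qed.

Lemma truncated_dist_triangle z q p :
  truncated_dist z p <= truncated_dist q p + dist4 z q.
Proof.
have := dist4_triangle z q p; have := dist4_ge0 z q.
rewrite /truncated_dist => h1 h2.
case: (leP (dist4 q p) 1) => h; rewrite ge_min; apply/orP; [left|right]; lra.
Qed.

(* Truncating the distance keeps this inf-convolution bounded off [Kset]. *)
Definition lipschitz_regularization F L z : R :=
  inf [set F q + L * truncated_dist z q | q in @Kset R].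

(** An infimum of functions of [z] with a common Lipschitz constant inherits it. On [Kset] the
    choice q = z shows that the infimum is at most F z; nearby q change F by at most [e], and
    distant q are too costly to lower it. *)
Lemma lipschitz_approximation F e : {within @Kset R, continuous F} -> 0 < e ->
  exists F', [/\ exists L B, [/\ 0 <= L, forall z, `|F' z| <= B &
      forall s, lipschitz3 L (fun a b c => F' (a, b, c, s))] &
    forall z, Kset z -> `|F z - F' z| <= e].
Proof.
move=> cF e0; have [B B0 FB] := Kset_bounded cF.
have [d d0 hd] := Kset_uniformly_continuous cF e0.
(* Beyond distance [d] the truncated distance is at least [d1], so the penalty is at least 2 B,
   which bounds the oscillation of F; the minimum with 1 allows for the truncation. *)
pose d1 := Num.min d 1; have d10 : 0 < d1 by rewrite lt_min d0 ltr01.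
pose L := 2 * B / d1; have L0 : 0 <= L by rewrite divr_ge0 ?mulr_ge0// ltW.
pose S z := [set F q + L * truncated_dist z q | q in @Kset R].
have S0 z : S z !=set0 by exists (F (0, 0, 0, 1) + L * truncated_dist z (0, 0, 0, 1));
  exists (0, 0, 0, 1) => //; exact: Kset_nonempty.
have Slb z : lbound (S z) (- B).
  move=> _ [q Kq <-]; have /andP[t0 _] := truncated_dist_bound z q.
  have := FB q Kq; rewrite ler_norml => /andP[+ _].
  have := mulr_ge0 L0 t0; lra.
have Sinf z q : Kset q -> inf (S z) <= F q + L * truncated_dist z q.
  by move=> Kq; apply: ge_inf; [exists (- B); exact: Slb|exists q].
have lip z z' : inf (S z) - L * dist4 z z' <= inf (S z').
  apply: lb_le_inf => // _ [q Kq <-]; rewrite lerBlDr.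
  apply: le_trans (Sinf z q Kq) _; rewrite -addrA lerD2l -mulrDr ler_wpM2l//.
  exact: truncated_dist_triangle.
exists (lipschitz_regularization F L); split.
  exists L, (B + L); split=> // [z|s u v z u' v' z'].
    rewrite ler_norml; apply/andP; split.
      by apply: le_trans (lb_le_inf (S0 z) (Slb z)); lra.
    apply: le_trans (Sinf z _ Kset_nonempty) _; apply: lerD.
      by apply: le_trans (ler_norm _) (FB _ Kset_nonempty).
    by rewrite ler_piMr//; case/andP: (truncated_dist_bound z (0, 0, 0, 1)).
  have dE (p q : R * R * R) : dist4 (p, s) (q, s) =
      `|p.1.1 - q.1.1| + `|p.1.2 - q.1.2| + `|p.2 - q.2|.
    by rewrite /dist4 /= subrr normr0 addr0.
  have h1 := lip (u, v, z, s) (u', v', z', s).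
  have h2 := lip (u', v', z', s) (u, v, z, s).
  rewrite !dE /= in h1 h2; rewrite /lipschitz_regularization -/(S _) -/(S _).
  rewrite (distrC u') (distrC v') (distrC z') in h2.
  by rewrite ler_norml; apply/andP; split; lra.
move=> z Kz; have h1 : inf (S z) <= F z.
  apply: le_trans (Sinf z z Kz) _.
  have -> : truncated_dist z z = 0.
    by rewrite /truncated_dist /dist4 !subrr normr0 !addr0 min_l.
  by rewrite mulr0 addr0.
have h2 : F z - e <= inf (S z).
  apply: lb_le_inf => // _ [q Kq <-].
  have /andP[t0 _] := truncated_dist_bound z q.
  have [lt|ge] := ltP (dist4 z q) d.
    have := hd z q Kz Kq lt; rewrite ler_norml => /andP[_ +].
    by have := mulr_ge0 L0 t0; lra.
  have td : d1 <= truncated_dist z q.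
    by rewrite /truncated_dist le_min /d1 !ge_min ge lexx orbT.
  have : 2 * B <= L * truncated_dist z q.
    by apply: le_trans (ler_wpM2l L0 td); rewrite /L divfK// gt_eqF.
  have := FB z Kz; have := FB q Kq; rewrite !ler_norml => /andP[? ?] /andP[? ?].
  lra.
by rewrite ler_norml; apply/andP; rewrite /lipschitz_regularization -/(S z); split; lra.
Qed.

End LipschitzApproximation.

(** * Passage to continuous observables *)

Section UniformLimit.
Variable R : realType.
Local Notation mu := (@lebesgue_measure R).
Implicit Types (F : R * R * R * R -> R) (w : R * R) (e eta th : R).

Definition regularized (F' : R * R * R * R -> R) : Prop :=
  exists L B, [/\ 0 <= L, forall z, `|F' z| <= B &
    forall s, lipschitz3 L (fun a b c => F' (a, b, c, s))].

Lemma regularized_integrable F' w eta : regularized F' ->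
  2^-1 < w.1 -> w.1 <= 1 -> regular (alpha_of w) -> 0 < eta < w.1 / 2 ->
  mu.-integrable `[eta, 2^-1] (EFin \o orbit_integrand F' w).
Proof.
move=> [L [B [L0 FB FL]]] w2 w1 ra /andP[e0 ec].
have c0 : 0 < w.1 / 2 by lra.
have [n /andP[h1 h2]] : exists n, cf_d (alpha_of w) n.+1 <= eta / (w.1 / 2) < cf_d (alpha_of w) n.
  by apply: slot_exists => //; rewrite divr_gt0//= ltr_pdivrMr// mul1r.
apply: (orbit_integrable (B := B) FB (b := false) e0).
have he : w.1 / 2 * cf_d (alpha_of w) n.+1 <= eta < w.1 / 2 * cf_d (alpha_of w) n.
  by rewrite ![w.1 / 2 * _]mulrC -ler_pdivlMr// -ltr_pdivrMr// h1.
by have [] := orbit_integral_near FB FL L0 w2 w1 ra he.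
Qed.

(** The weight dr / r has mass ln (1/eta) - ln 2 on the interval, so averaging does not increase the
    uniform distance. The whole sequence [G] enters, because the integrand of F is shown to be
    measurable as a pointwise limit. *)
Lemma avgF_dist F (G : nat -> R * R * R * R -> R) w eta m :
  (forall m, regularized (G m)) ->
  (forall m z, Kset z -> `|F z - G m z| <= m.+1%:R^-1) ->
  2^-1 < w.1 -> w.1 <= 1 -> regular (alpha_of w) -> 0 < eta < w.1 / 2 ->
  `|avgF F w eta - avgF (G m) w eta| <= m.+1%:R^-1.
Proof.
move=> Gr FG w2 w1 ra he; have /andP[e0 ec] := he.
have e12 : eta <= 2^-1 by lra.
have iG k := regularized_integrable (Gr k) w2 w1 ra he.
have K r : `[eta, 2^-1]%classic r -> Kset (Aw w r, Bw w r, Qw w r, sigmaw w r).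
  rewrite /= in_itv /= => /andP[er r2]; apply: observable_in_K => //.
  by rewrite r2 (lt_le_trans e0).
have pos r : `[eta, 2^-1]%classic r -> 0 < r.
  by rewrite /= in_itv /= => /andP[er _]; exact: lt_le_trans er.
have dist k r : `[eta, 2^-1]%classic r ->
    `|orbit_integrand F w r - orbit_integrand (G k) w r| <= k.+1%:R^-1 * r^-1.
  move=> hr; rewrite /orbit_integrand -mulrBl normrM.
  rewrite [X in _ * X]ger0_norm; last by rewrite invr_ge0 ltW// pos.
  apply: ler_wpM2r; first by rewrite invr_ge0 ltW// pos.
  by apply: FG; exact: K.
have mF : measurable_fun `[eta, 2^-1] (orbit_integrand F w).
  apply: (measurable_fun_cvg (h := fun k => orbit_integrand (G k) w)).
    by move=> k; apply/measurable_EFinP; case/integrableP: (iG k).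
  move=> r hr; apply/cvgrPdist_le => e ep.
  have r0 := pos r hr.
  exists (Num.truncn ((e * r)^-1)) => //= k hk.
  apply: le_trans (dist k r hr) _; rewrite ler_pdivrMr//.
  rewrite -[leRHS]invrK lef_pV2 ?posrE ?invr_gt0 ?mulr_gt0//.
  apply: le_trans (ltW (truncnS_gt _)) _.
  by rewrite ler_nat ltnS.
have cinv : {within `[eta, 2^-1], continuous (fun t : R => t^-1)}.
  apply: continuous_in_subspaceT => t; rewrite inE => /pos t0.
  by apply: cvgV; [exact: lt0r_neq0|exact: cvg_id].
have iinv := segment_integrable cinv.
have cd : {within `[eta, 2^-1], continuous (fun t : R => m.+1%:R^-1 * t^-1)}.
  apply: continuous_in_subspaceT => t; rewrite inE => /pos t0.
  by apply: cvgM; [exact: cvg_cst|apply: cvgV; [exact: lt0r_neq0|exact: cvg_id]].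
have idm := segment_integrable cd.
have iD : mu.-integrable `[eta, 2^-1]
    (EFin \o (fun r => orbit_integrand F w r - orbit_integrand (G m) w r)).
  apply: le_integrable idm => //.
    apply/measurable_EFinP; apply: measurable_funB => //.
    by apply/measurable_EFinP; case/integrableP: (iG m).
  move=> r hr /=; rewrite lee_fin; apply: le_trans (dist m r hr) _; exact: ler_norm.
have iF : mu.-integrable `[eta, 2^-1] (EFin \o orbit_integrand F w).
  apply: (eq_integrable _ _ _ _ (integrableD _ iD (iG m))) => // r _ /=.
  by rewrite -EFinD subrK.
have ln0 : 0 < ln eta^-1 by rewrite ln_gt0// invf_gt1//; lra.
rewrite /avgF -mulrBr normrM gtr0_norm ?invr_gt0// ler_pdivrMl//.
rewrite -/(orbit_integrand F w) -/(orbit_integrand (G m) w) -RintegralB//; last exact: (iG m).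
apply: le_trans (le_normr_Rintegral _ iD) _ => //.
apply: (@le_trans _ _ (\int[mu]_(r in `[eta, 2^-1]) (m.+1%:R^-1 * r^-1))).
  apply: le_Rintegral => //; first exact: (integrable_norm iD).
  by move=> r hr; exact: dist.
rewrite RintegralZl// Rintegral_inv// mulrC ler_wpM2r ?invr_ge0//.
have l2 : ln 2^-1 <= 0 :> R by apply: ln_le0; lra.
by rewrite [leRHS]lnV ?posrE//; lra.
Qed.

End UniformLimit.

Theorem theorem4p4 (R : realType) (F : R * R * R * R -> R) :
  {within @Kset R, continuous F} ->
  exists L : R,
    {ae (@lebesgue_measure R), forall theta : R,
       theta \in `]0, pi / 4[ ->
       avgF F (omega_of theta) eta @[eta --> 0^'+] --> L}.
Proof.
move=> cF.
have /choice[G hG] (m : nat) : exists F' : R * R * R * R -> R, regularized F' /\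
    forall z, Kset z -> `|F z - F' z| <= m.+1%:R^-1.
  have e0 : 0 < m.+1%:R^-1 :> R by rewrite invr_gt0.
  by have [F' [h1 h2]] := lipschitz_approximation cF e0; exists F'.
have Gr m : regularized (G m) by case: (hG m).
have FG m z : Kset z -> `|F z - G m z| <= m.+1%:R^-1 by case: (hG m) => _; exact.
have /choice[l hl] (m : nat) := let: ex_intro L (ex_intro B (And3 L0 GB GL)) := Gr m in
  lipschitz_limit GB GL L0.
have hall := negligible_bigcup hl.
(* One null set serves all [m]: whatever follows from convergence for every [G m] holds almost
   everywhere. *)
have good (P : R -> Prop) : (forall th, (th \in `]0, pi / 4[) -> (forall m : nat,
    regular (tan th) /\ avgF (G m) (omega_of th) eta @[eta --> 0^'+] --> l m) -> P th) ->
    (@lebesgue_measure R).-negligible [set th | (th \in `]0, pi / 4[) /\ ~ P th].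
  move=> h; apply: negligibleS hall => th /= [hth nP].
  have /existsNP[m hm] : ~ (forall m : nat, regular (tan th) /\
      avgF (G m) (omega_of th) eta @[eta --> 0^'+] --> l m) by move=> k; exact/nP/h.
  by exists m.
have close th m : (th \in `]0, pi / 4[) -> regular (tan th) ->
    \forall eta \near (0 : R)^'+,
      `|avgF F (omega_of th) eta - avgF (G m) (omega_of th) eta| <= m.+1%:R^-1.
  move=> hth rt; have c2 := cos_gt_half hth; have c1 := cos_le1 th.
  near=> eta; apply: avgF_dist => //; apply/andP; split.
    by near: eta; exact: nbhs_right_gt.
  by near: eta; apply: nbhs_right_lt; rewrite /omega_of /=; lra.
(* A single good angle compares the two limits, which do not depend on it. *)
have lcauchy m k : `|l m - l k| <= m.+1%:R^-1 + k.+1%:R^-1.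
  have [th [hth h]] := @angle_witness R _ (good _ (fun th _ h => h)).
  apply/ler_addgt0Pr => e e0; have e2 : 0 < e / 2 by rewrite divr_gt0.
  have hm := close th m hth (h m).1; have hk := close th k hth (h k).1.
  have /cvgrPdist_le/(_ _ e2) lm := (h m).2; have /cvgrPdist_le/(_ _ e2) lk := (h k).2.
  near (0 : R)^'+ => eta.
  have hm' : `|avgF F (omega_of th) eta - avgF (G m) (omega_of th) eta| <= m.+1%:R^-1.
    by near: eta.
  have hk' : `|avgF F (omega_of th) eta - avgF (G k) (omega_of th) eta| <= k.+1%:R^-1.
    by near: eta.
  have lm' : `|l m - avgF (G m) (omega_of th) eta| <= e / 2 by near: eta.
  have lk' : `|l k - avgF (G k) (omega_of th) eta| <= e / 2 by near: eta.
  move: hm' hk' lm' lk'; rewrite !ler_norml.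
  set x := avgF F _ _; set y := avgF (G m) _ _; set z := avgF (G k) _ _.
  set a : R := m.+1%:R^-1; set b : R := k.+1%:R^-1.
  move=> /andP[? ?] /andP[? ?] /andP[? ?] /andP[? ?]; apply/andP; split; lra.
have small e : 0 < e -> exists m : nat, m.+1%:R^-1 < e :> R.
  move=> e0; exists (Num.truncn e^-1); rewrite invf_plt ?posrE//; exact: truncnS_gt.
have cvl : cvgn l.
  apply/cauchy_cvgP/cauchy_exP => e e0.
  have [m hm] : exists m : nat, m.+1%:R^-1 < e / 2 by apply: small; rewrite divr_gt0.
  exists (l m); exists m => // k /= mk; rewrite /ball /=.
  apply: le_lt_trans (lcauchy m k) _; rewrite [e]splitr; apply: ltr_leD => //.
  by apply: le_trans (ltW hm); rewrite lef_pV2 ?posrE// ler_nat ltnS.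
exists (limn l).
have ll m : `|limn l - l m| <= m.+1%:R^-1.
  apply/ler_addgt0Pr => e e0; have e2 : 0 < e / 2 by rewrite divr_gt0.
  have [j hj] := small _ e2.
  near \oo => k.
  apply: le_trans (ler_distD (l k) _ _) _; rewrite [X in X <= _]addrC.
  rewrite [e]splitr addrA; apply: lerD; last first.
    by near: k; move/cvgrPdist_le : cvl; apply.
  rewrite distrC; apply: le_trans (lcauchy m k) _; rewrite lerD2l.
  apply: le_trans (ltW hj); rewrite lef_pV2 ?posrE// ler_nat ltnS.
  by near: k; exact: nbhs_infty_ge.
have := good (fun th => avgF F (omega_of th) eta @[eta --> 0^'+] --> limn l).
move=> H; apply: negligibleS (H _) => [th /= nP|th hth h].
  by have /not_implyP := nP.
apply/cvgrPdist_le => e e0; have e3 : 0 < e / 3 by rewrite divr_gt0.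
have [m hm] := small _ e3.
have cm := close th m hth (h m).1; have /cvgrPdist_le/(_ _ e3) lm := (h m).2.
near=> eta.
have cm' : `|avgF F (omega_of th) eta - avgF (G m) (omega_of th) eta| <= m.+1%:R^-1.
  by near: eta.
have lm' : `|l m - avgF (G m) (omega_of th) eta| <= e / 3 by near: eta.
have := ll m; move: cm' lm'; rewrite !ler_norml.
set x := avgF F _ _; set y := avgF (G m) _ _; set a : R := m.+1%:R^-1 in hm *.
by move=> /andP[? ?] /andP[? ?] /andP[? ?]; apply/andP; split; lra.
Unshelve. all: by end_near. Qed.
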